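(* Let $\Omega\subseteq\mathbb{R}^n$ be an open bounded Lipschitz set, let $u\in SBV(\Omega;\mathbb{R}^m)$ be such that $\nabla u\in L^p(\Omega;\mathbb{R}^{m\times n})$ for some $p\in[1,\infty)$ and $g_0(|[u]|)\in L^1(\Omega;\mathcal{H}^{n-1}\llcorner J_u)$, where $g_0:[0,\infty)\to[0,\infty)$ is continuous, nondecreasing, subadditive, and $g_0^{-1}(0)=\{0\}$. Assume $\mathcal{H}^{n-1}(J_u)<\infty$. Let $(u_j)_{j\in\mathbb{N}}$, $(\Phi_j)_{j\in\mathbb{N}}$ be an approximating sequence for $u$ (in the sense of the context). Then $$\lim_j\int_\Omega\Psi(\nabla u_j)\,dx=\int_\Omega\Psi(\nabla u)\,dx$$ and $$\lim_j\int_{J_{u_j}}g([u_j],\nu_{u_j})\,d\mathcal{H}^{n-1}=\int_{J_{u}}g([u],\nu_u)\,d\mathcal{H}^{n-1}$$ for all functions $\Psi\in C^0(\mathbb{R}^{m\times n})$ for which there is $C>0$ with $|\Psi(\xi)|\le C(|\xi|^p+1)$ for all $\xi$, and all $g\in C^0(\mathbb{R}^m\times S^{n-1};[0,\infty))$ satisfying: (a) $g(-s,-\nu)=g(s,\nu)$ for all $(s,\nu)\in\mathbb{R}^m\times S^{n-1}$; (b) there is $C>0$ such that $g(s+s',\nu)\le g(s,\nu)+C\,g_0(|s'|)$ for all $(s,s',\nu)\in\mathbb{R}^m\times\mathbb{R}^m\times S^{n-1}$; (c') there is $\alpha>0$ such that $g(0,\nu)\ge\alpha$ for all $\nu\in S^{n-1}$.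 In particular, $\lim_jE_{\Psi,g}[u_j,\Omega]=E_{\Psi,g}[u,\Omega]$.
   Context: $SBV(\Omega;\mathbb{R}^m)$ is the set of $u\in BV(\Omega;\mathbb{R}^m)$ with $Du=\nabla u\,\mathcal{L}^n+[u]\otimes\nu_u\,\mathcal{H}^{n-1}\llcorner J_u$, where $\nabla u$ is the approximate gradient, $J_u\subseteq\Omega$ the jump set, $\nu_u$ its (measurably oriented) unit normal and $[u]=u^+-u^-$ the jump. $[u]$ is extended by $0$ outside $J_u$; the normals are set equal to $0$ outside the respective jump set. For a Borel set $A\subseteq\Omega$, $$E_{\Psi,g}[u,A]:=\int_A \Psi(\nabla u)\,dx+\int_{J_u\cap A}g([u],\nu_u)\,d\mathcal{H}^{n-1}.$$ A set $\Omega\subseteq\mathbb{R}^n$ is Lipschitz if for every $x\in\partial\Omega$ there are $\varepsilon_x>0$, a Lipschitz function $G_x:\mathbb{R}^{n-1}\to\mathbb{R}$ and an isometry $A_x:\mathbb{R}^n\to\mathbb{R}^n$ with $A_x0=x$ and $B_{\varepsilon_x}(x)\cap\Omega=B_{\varepsilon_x}(x)\cap A_x\{(y',y_n): y_n<G_x(y')\}$. Bilipschitz means injective and Lipschitz with Lipschitz inverse. Approximating sequence for $u$: sequences $u_j\in SBV\cap L^\infty(\Omega;\mathbb{R}^m)$ and $\Phi_j\in\mathrm{Lip}(\mathbb{R}^n;\mathbb{R}^n)$ such that (i) for each $j$ there is a locally finite decomposition of $\mathbb{R}^n$ in simplexes such that $u_j$ is affine in the interior (intersected with $\Omega$) of each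 of them; (ii) $u_j\to u$ in $L^1(\Omega;\mathbb{R}^m)$; (iii) $\nabla u_j\to\nabla u$ in $L^p(\Omega;\mathbb{R}^{m\times n})$; (iv) $\Phi_j$ is bilipschitz, $\Phi_j(x)-x\to 0$ in $L^\infty(\mathbb{R}^n;\mathbb{R}^n)$, $D\Phi_j\to\mathrm{Id}$ in $L^\infty(\mathbb{R}^n;\mathbb{R}^{n\times n})$, and $\Phi_j(x)=x$ for $x\in\mathbb{R}^n\setminus\Omega$; (v) for a suitable orientation of the normal $\nu_j=\nu_{u_j}$ to $J_{u_j}$, $\lim_j\int_{J_u\cup \Phi_j^{-1}(J_{u_j})}g_0(|[u]-[u_j]\circ\Phi_j|)\,d\mathcal{H}^{n-1}= 0$ and $\lim_j\int_{J_u\cup \Phi_j^{-1}(J_{u_j})}g_0(|[u]|+|[u_j]\circ\Phi_j|)\,|\nu_u - \nu_j\circ\Phi_j|\,d\mathcal{H}^{n-1}= 0$; (vi) if $\mathcal{H}^{n-1}(J_{u})<\infty$, then $\mathcal{H}^{n-1}(J_u\triangle\Phi_j^{-1}(J_{u_j}))\to0$; (vii) if $\nabla u=0$ $\mathcal{L}^n$-a.e. on $\Omega$, then $\nabla u_j=0$ $\mathcal{L}^n$-a.e. on $\Omega$ for all $j$; if $u\in W^{1,p}(\Omega;\mathbb{R}^m)$, then $u_j\in W^{1,p}(\Omega;\mathbb{R}^m)$ for all $j$. *)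

(* Defs.v *)
From HB Require Import structures.
From mathcomp Require Import all_boot all_order all_algebra.
From mathcomp Require Import all_classical all_reals all_analysis.
Set Implicit Arguments.
Unset Strict Implicit.
Unset Printing Implicit Defensive.
Import Order.TTheory GRing.Theory Num.Theory.
Import numFieldNormedType.Exports.
Local Open Scope classical_set_scope.
Local Open Scope ring_scope.

(* Points of R^n are row vectors.  The library norm of a matrix is the sup
   norm, so the Euclidean (Frobenius) norm is defined here; the topology,
   boundedness and differentiability of the library do not depend on the
   choice of the norm.  A gradient is a matrix L in R^{m x n} acting on row
   vectors by h |-> h *m L^T. *)

Section Euclidean.
Context {R : realType}.

Definition enorm m n (A : 'M[R]_(m, n)) : R :=
  Num.sqrt (\sum_(i < m) \sum_(j < n) A i j ^+ 2).

Definition dot n (x y : 'rV[R]_n) : R := \sum_(i < n) x 0 i * y 0 i.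

Definition eball n (x : 'rV[R]_n) (r : R) : set 'rV[R]_n :=
  [set y | enorm (y - x) < r].

Definition half_ball n (x nu : 'rV[R]_n) (r : R) : set 'rV[R]_n :=
  [set y | eball x r y /\ 0 < dot (y - x) nu].

Definition is_lipschitz m n (f : 'rV[R]_n -> 'rV[R]_m) :=
  exists L : R, forall x y, enorm (f x - f y) <= L * enorm (x - y).

Definition is_bilipschitz m n (f : 'rV[R]_n -> 'rV[R]_m) :=
  [/\ injective f, is_lipschitz f &
      exists L : R, forall x y, enorm (x - y) <= L * enorm (f x - f y)].

Definition is_isometry n (f : 'rV[R]_n -> 'rV[R]_n) :=
  forall x y, enorm (f x - f y) = enorm (x - y).

End Euclidean.

Section OuterMeasures.
Context {R : realType}.
Local Open Scope ereal_scope.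

(* Outer measure obtained from a gauge h by countable coverings, with the
   convention that the empty set always has gauge 0. *)
Definition gauge0 T (h : set T -> \bar R) (F : set T) : \bar R :=
  if `[< F = set0 >] then 0 else h F.

Definition cover_measure T (h : set T -> \bar R) (X : set T) : \bar R :=
  ereal_inf [set \sum_(k <oo) gauge0 h (F k) |
             F in [set F : (set T)^nat | X `<=` \bigcup_k F k]].

Section CoverMeasureTheory.
Context (T : pointedType) (h : set T -> \bar R).
Hypothesis h_ge0 : forall F, 0 <= h F.

Lemma gauge0_ge0 F : 0 <= gauge0 h F.
Proof. by rewrite /gauge0; case: ifP. Qed.

Lemma gauge0_set0 : gauge0 h set0 = 0.
Proof. by rewrite /gauge0; case: asboolP. Qed.

Let D := g_sigma_algebraType [set: set T].

Lemma cover_measureE :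
  cover_measure h = @mu_ext _ D R (gauge0 h : set D -> \bar R).
Proof.
apply/funext => X; congr ereal_inf; congr (_ @` _).
apply/seteqP; split => F /=; last by case.
by move=> XF; split=> // i; apply: sub_gen_smallest.
Qed.

Lemma cover_measure0 : cover_measure h set0 = 0.
Proof. by rewrite cover_measureE; apply: (@mu_ext0 _ D); [exact: gauge0_set0|exact: gauge0_ge0]. Qed.

Lemma cover_measure_ge0 X : 0 <= cover_measure h X.
Proof. by rewrite cover_measureE; apply: (@mu_ext_ge0 _ D); exact: gauge0_ge0. Qed.

Lemma le_cover_measure : {homo cover_measure h : A B / A `<=` B >-> A <= B}.
Proof. by rewrite cover_measureE; exact: (@le_mu_ext _ D). Qed.

Lemma cover_measure_sigma_subadditive : sigma_subadditive (cover_measure h).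
Proof.
rewrite cover_measureE; apply: (@mu_ext_sigma_subadditive _ D).
exact: gauge0_ge0.
Qed.

End CoverMeasureTheory.

Definition box_gauge n (F : set 'rV[R]_n) : \bar R :=
  ereal_inf [set v | exists a b : 'rV[R]_n,
    [/\ forall i, (a 0%R i <= b 0%R i)%R,
        F `<=` [set x | forall i, (a 0%R i <= x 0%R i <= b 0%R i)%R] &
        v = (\prod_(i < n) (b 0%R i - a 0%R i))%:E]].

Definition lebesgue_outer n : set 'rV[R]_n -> \bar R :=
  cover_measure (@box_gauge n).

Lemma box_gauge_ge0 n (F : set 'rV[R]_n) : 0 <= box_gauge F.
Proof.
apply: le_ereal_inf_tmp => _ [a [b [ab _ ->]]].
by rewrite lee_fin; apply: prodr_ge0 => i _; rewrite subr_ge0.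
Qed.

HB.instance Definition _ n := isOuterMeasure.Build R 'rV[R]_n
  (@lebesgue_outer n)
  (cover_measure0 (@box_gauge_ge0 n))
  (cover_measure_ge0 (@box_gauge_ge0 n))
  (@le_cover_measure _ (@box_gauge n))
  (cover_measure_sigma_subadditive (@box_gauge_ge0 n)).

Definition diam n (F : set 'rV[R]_n) : \bar R :=
  ereal_sup [set (enorm (x - y))%:E | x in F & y in F].

Definition ball_volume d : R :=
  fine (lebesgue_outer (eball (0 : 'rV[R]_d)%R 1)).

Definition hausdorff_gauge d n (delta : R) (F : set 'rV[R]_n) : \bar R :=
  if diam F <= delta%:E
  then (ball_volume d * (fine (diam F) / 2) ^+ d)%:E else +oo.

(* d-dimensional Hausdorff measure on R^n, normalised so that it agrees with
   the Lebesgue measure when d = n. *)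
Definition hausdorff_outer d n : set 'rV[R]_n -> \bar R := fun X =>
  ereal_sup [set cover_measure (hausdorff_gauge d delta) X |
             delta in [set delta : R | (0 < delta)%R]].

Lemma hausdorff_gauge_ge0 d n delta (F : set 'rV[R]_n) :
  0 <= hausdorff_gauge d delta F.
Proof.
rewrite /hausdorff_gauge; case: ifP => // _; rewrite lee_fin mulr_ge0//.
  by rewrite fine_ge0// (outer_measure_ge0 (@lebesgue_outer d)).
rewrite exprn_ge0// divr_ge0// /diam.
have [[x Fx]|F0] := pselect (F !=set0).
  apply: fine_ge0; apply: ereal_sup_ubound; exists x => //; exists x => //.
  rewrite subrr /enorm big1 ?sqrtr0// => i _; rewrite big1// => j _.
  by rewrite mxE expr0n.
suff -> : [set (enorm (x - y))%:E | x in F & y in F] = set0.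
  by rewrite ereal_sup0.
by apply/seteqP; split => // z [x Fx]; case: F0; exists x.
Qed.

Section HausdorffOuter.
Variables (d n : nat).
Local Notation H := (@hausdorff_outer d n).

Let cover_le_hausdorff delta X : (0 < delta)%R ->
  cover_measure (hausdorff_gauge d delta) X <= H X.
Proof. by move=> d0; apply: ereal_sup_ubound; exists delta. Qed.

Lemma hausdorff_outer0 : H set0 = 0.
Proof.
apply/eqP; rewrite eq_le; apply/andP; split.
  apply: ge_ereal_sup => _ [delta _ <-].
  by rewrite cover_measure0//; exact: hausdorff_gauge_ge0.
apply: le_trans (cover_le_hausdorff _ ltr01).
by apply: cover_measure_ge0; exact: hausdorff_gauge_ge0.
Qed.

Lemma hausdorff_outer_ge0 X : 0 <= H X.
Proof.
apply: le_trans (cover_le_hausdorff _ ltr01).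
by apply: cover_measure_ge0; exact: hausdorff_gauge_ge0.
Qed.

Lemma le_hausdorff_outer : {homo H : A B / A `<=` B >-> A <= B}.
Proof.
move=> A B AB; apply: ge_ereal_sup => _ [delta d0 <-].
by apply: le_trans (cover_le_hausdorff _ d0); exact: le_cover_measure.
Qed.

Lemma hausdorff_outer_sigma_subadditive : sigma_subadditive H.
Proof.
move=> F; apply: ge_ereal_sup => _ [delta d0 <-].
have g0 := @hausdorff_gauge_ge0 d n delta.
apply: le_trans (cover_measure_sigma_subadditive g0 _) _.
apply: lee_nneseries => [k _ _|k _]; first exact: cover_measure_ge0.
exact: cover_le_hausdorff.
Qed.

HB.instance Definition _ := isOuterMeasure.Build R 'rV[R]_n H
  hausdorff_outer0 hausdorff_outer_ge0 le_hausdorff_outer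
  hausdorff_outer_sigma_subadditive.

End HausdorffOuter.
End OuterMeasures.

(* R^n with the Caratheodory sigma-algebras of the outer measures above (for
   lebesgue_outer, the Lebesgue-measurable sets) and with its Borel sets *)
Notation Leb_space R n := (caratheodory_type (@lebesgue_outer R n)).
Notation Haus_space R d n := (caratheodory_type (@hausdorff_outer R d n)).
Notation Borel_space R n := (g_sigma_algebraType (@open 'rV[R]_n)).

Definition leb {R : realType} n : {measure set (Leb_space R n) -> \bar R} :=
  (@lebesgue_outer R n : {outer_measure set 'rV[R]_n -> \bar R}).
Definition haus {R : realType} d n :
    {measure set (Haus_space R d n) -> \bar R} :=
  (@hausdorff_outer R d n : {outer_measure set 'rV[R]_n -> \bar R}).

Definition charge_Rintegral {R : realType} d (T : measurableType d)
    (mu : {charge set T -> \bar R}) (D : set T) (f : T -> R) : R :=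
  let hP := cid (Hahn_decomposition mu) in
  let hN := cid (projT2 hP) in
  \int[jordan_pos (projT2 hN)]_(x in D) f x -
  \int[jordan_neg (projT2 hN)]_(x in D) f x.

Section Lebesgue_spaces.
Context {R : realType}.

Definition mean n (A : set 'rV[R]_n) (f : 'rV[R]_n -> R) : \bar R :=
  ((fine (leb n A))^-1%:E * \int[leb n]_(x in A) (f x)%:E)%E.

Definition Lp n k l (Omega : set 'rV[R]_n) (p : R)
    (f : 'rV[R]_n -> 'M[R]_(k, l)) :=
  (forall i j, measurable_fun (Omega : set (Leb_space R n))
                 (fun x => f x i j)) /\
  (\int[leb n]_(x in Omega) (enorm (f x) `^ p)%:E < +oo)%E.

Definition Lp_cvg n k l (Omega : set 'rV[R]_n) (p : R)
    (f_ : nat -> 'rV[R]_n -> 'M[R]_(k, l)) (f : 'rV[R]_n -> 'M[R]_(k, l)) :=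
  [/\ forall j, Lp Omega p (f_ j), Lp Omega p f &
      (\int[leb n]_(x in Omega) (enorm (f_ j x - f x) `^ p)%:E
         @[j --> \oo] --> 0)%E].

Definition Linfty n k l (Omega : set 'rV[R]_n)
    (f : 'rV[R]_n -> 'M[R]_(k, l)) :=
  (forall i j, measurable_fun (Omega : set (Leb_space R n))
                 (fun x => f x i j)) /\
  exists M : R, {ae leb n, forall x, Omega x -> enorm (f x) <= M}.

(* functions of class C^1 with compact support in Omega *)
Definition test_function n (Omega : set 'rV[R]_n) (phi : 'rV[R]_n -> R) :=
  [/\ forall x, differentiable phi x,
      forall i, continuous (fun x => 'D_(delta_mx 0 i) phi x) &
      exists2 K, compact K /\ K `<=` Omega & forall x, ~ K x -> phi x = 0].

Definition is_weak_gradient n m (Omega : set 'rV[R]_n)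
    (u : 'rV[R]_n -> 'rV[R]_m) (G : 'rV[R]_n -> 'M[R]_(m, n)) :=
  forall phi, test_function Omega phi -> forall a i,
    \int[leb n]_(x in Omega) (u x 0 a * 'D_(delta_mx 0 i) phi x) =
    - \int[leb n]_(x in Omega) (G x a i * phi x).

Definition W1p n m (Omega : set 'rV[R]_n) (p : R)
    (u : 'rV[R]_n -> 'rV[R]_m) :=
  Lp Omega p u /\ exists2 G, Lp Omega p G & is_weak_gradient Omega u G.

End Lebesgue_spaces.

(* The ambient space is R^(n+1), whose (n+1)-1 dimensional Hausdorff measure is
   haus n n.+1.  Functions on Omega are total functions whose values outside
   Omega are irrelevant. *)
Section FineProperties.
Context {R : realType}.
Variables (n m : nat).
Implicit Types (Omega : set 'rV[R]_n.+1) (u : 'rV[R]_n.+1 -> 'rV[R]_m).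
Implicit Types (x : 'rV[R]_n.+1).

Definition is_approx_limit u x (z : 'rV[R]_m) :=
  mean (eball x r) (fun y => enorm (u y - z)) @[r --> 0^'+] --> 0%E.

Definition is_approx_gradient u x (L : 'M[R]_(m, n.+1)) :=
  exists2 z, is_approx_limit u x z &
    mean (eball x r) (fun y => enorm (u y - z - (y - x) *m L^T) / r)
      @[r --> 0^'+] --> 0%E.

(* equal to 0 at the points where u is not approximately differentiable *)
Definition agrad u x : 'M[R]_(m, n.+1) := xget 0 (is_approx_gradient u x).

Definition is_trace u x (nu : 'rV[R]_n.+1) (a : 'rV[R]_m) :=
  mean (half_ball x nu r) (fun y => enorm (u y - a)) @[r --> 0^'+] --> 0%E.

Definition is_jump_normal u x (nu : 'rV[R]_n.+1) :=
  enorm nu = 1 /\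
  exists a b, [/\ a <> b, is_trace u x nu a & is_trace u x (- nu) b].

Definition jump_set Omega u : set 'rV[R]_n.+1 :=
  [set x | Omega x /\ exists nu, is_jump_normal u x nu].

(* nu is a measurable choice of the unit normal to the jump set (which at each
   point is unique up to the sign), extended by 0 *)
Definition is_orientation Omega u (nu : 'rV[R]_n.+1 -> 'rV[R]_n.+1) :=
  [/\ forall i, measurable_fun [set: Haus_space R n n.+1] (fun x => nu x 0 i),
      forall x, jump_set Omega u x -> is_jump_normal u x (nu x) &
      forall x, ~ jump_set Omega u x -> nu x = 0].

Definition trace u x (nu : 'rV[R]_n.+1) : 'rV[R]_m := xget 0 (is_trace u x nu).

(* [u] = u^+ - u^-, where u^+ is the trace of u on the side of nu; it changes
   sign with nu *)
Definition jump Omega u (nu : 'rV[R]_n.+1 -> 'rV[R]_n.+1) x : 'rV[R]_m :=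
  if `[< jump_set Omega u x >] then trace u x (nu x) - trace u x (- nu x)
  else 0.

(* The distributional derivative of u on Omega is a (finite, matrix-valued)
   measure; only the values of Du on Borel subsets of Omega are relevant. *)
Definition is_derivative_measure Omega u
    (Du : 'I_m -> 'I_n.+1 -> {charge set (Borel_space R n.+1) -> \bar R}) :=
  forall phi, test_function Omega phi -> forall a i,
    \int[leb n.+1]_(x in Omega) (u x 0 a * 'D_(delta_mx 0 i) phi x) =
    - charge_Rintegral (Du a i) Omega phi.

Definition SBV Omega u :=
  Lp Omega 1 u /\
  exists2 Du, is_derivative_measure Omega u Du &
  exists2 nu, is_orientation Omega u nu &
  forall a i,
    [/\ (leb n.+1).-integrable Omega (fun x => (agrad u x a i)%:E),
        (haus n n.+1).-integrable (jump_set Omega u)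
          (fun x => (jump Omega u nu x 0 a * nu x 0 i)%:E) &
        forall B : set (Borel_space R n.+1), measurable B -> B `<=` Omega ->
          Du a i B =
          (\int[leb n.+1]_(x in B) (agrad u x a i)%:E +
           \int[haus n n.+1]_(x in jump_set Omega u `&` B)
             (jump Omega u nu x 0 a * nu x 0 i)%:E)%E].

Definition energy (Psi : 'M[R]_(m, n.+1) -> R)
    (g : 'rV[R]_m -> 'rV[R]_n.+1 -> R) Omega u (nu : 'rV[R]_n.+1 -> 'rV[R]_n.+1)
    (A : set 'rV[R]_n.+1) : \bar R :=
  (\int[leb n.+1]_(x in A) (Psi (agrad u x))%:E +
   \int[haus n n.+1]_(x in jump_set Omega u `&` A)
     (g (jump Omega u nu x) (nu x))%:E)%E.

End FineProperties.

Section Domains.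
Context {R : realType}.
Variable n : nat.
Local Notation Rn := 'rV[R]_n.+1.

Definition head_coords (y : Rn) : 'rV[R]_n :=
  \row_(i < n) y 0 (widen_ord (leqnSn n) i).

Definition is_lipschitz_set (Omega : set Rn) :=
  forall x : Rn, (closure Omega `\` Omega°) x ->
  exists eps (G : 'rV[R]_n -> R) (A : Rn -> Rn),
    [/\ 0 < eps,
        exists L : R, forall y z, `|G y - G z| <= L * enorm (y - z),
        is_isometry A, A 0 = x &
        eball x eps `&` Omega =
        eball x eps `&` A @` [set y : Rn | y 0 ord_max < G (head_coords y)]].

(* the n+1 dimensional closed simplex with vertices P 0, ..., P (n+1) *)
Definition simplex (P : 'I_n.+2 -> Rn) : set Rn :=
  [set x | exists w : 'I_n.+2 -> R,
    [/\ forall i, 0 <= w i, \sum_i w i = 1 & x = \sum_i w i *: P i]].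

Definition affinely_independent (P : 'I_n.+2 -> Rn) :=
  row_free (\matrix_(i < n.+1) (P (lift ord0 i) - P ord0)).

Definition is_simplicial_decomposition (P : nat -> 'I_n.+2 -> Rn) :=
  [/\ forall k, affinely_independent (P k),
      \bigcup_k simplex (P k) = setT,
      forall k l, k <> l -> (simplex (P k))° `&` (simplex (P l))° = set0 &
      forall x : Rn, exists2 V, nbhs x V &
        finite_set [set k | simplex (P k) `&` V !=set0]].

(* Equality holds almost everywhere because u stands for its class in L^1. *)
Definition is_piecewise_affine m (Omega : set Rn) (u : Rn -> 'rV[R]_m) :=
  exists2 P, is_simplicial_decomposition P &
  forall k, exists (A : 'M[R]_(n.+1, m)) (b : 'rV[R]_m),
    {ae leb n.+1, forall x, ((simplex (P k))° `&` Omega) x ->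
       u x = x *m A + b}.

End Domains.

Section ApproximatingSequence.
Context {R : realType}.
Variables (n m : nat).
Local Notation Rn := 'rV[R]_n.+1.
Local Notation H := (haus n n.+1).

(* By Rademacher's theorem D Phi is the classical differential, defined almost
   everywhere; 'J is its matrix in the row vector convention. *)
Definition is_deformation (Omega : set Rn) (Phi : nat -> Rn -> Rn) :=
  [/\ forall j, is_bilipschitz (Phi j),
      forall e : R, 0 < e -> \forall j \near \oo,
        {ae leb n.+1, forall x, enorm (Phi j x - x) <= e},
      forall e : R, 0 < e -> \forall j \near \oo,
        {ae leb n.+1, forall x, differentiable (Phi j) x /\
           enorm ('J (Phi j) x - 1%:M) <= e} &
      forall j x, ~ Omega x -> Phi j x = x].

Record approximating_sequence (Omega : set Rn) (p : R) (g0 : R -> R)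
    (u : Rn -> 'rV[R]_m) (nu : Rn -> Rn)
    (u_ : nat -> Rn -> 'rV[R]_m) (Phi : nat -> Rn -> Rn) : Prop := {
  apx_SBV : forall j, SBV Omega (u_ j) ;
  apx_Linfty : forall j, Linfty Omega (u_ j) ;
  apx_affine : forall j, is_piecewise_affine Omega (u_ j) ;
  apx_L1 : Lp_cvg Omega 1 u_ u ;
  apx_gradient : Lp_cvg Omega p (fun j => agrad (u_ j)) (agrad u) ;
  apx_deformation : is_deformation Omega Phi ;
  apx_jump : exists2 nu_ : nat -> Rn -> Rn,
    forall j, is_orientation Omega (u_ j) (nu_ j) &
    (\int[H]_(x in jump_set Omega u `|` Phi j @^-1` jump_set Omega (u_ j))
       (g0 (enorm (jump Omega u nu x - jump Omega (u_ j) (nu_ j) (Phi j x))))%:E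
       @[j --> \oo] --> 0)%E /\
    (\int[H]_(x in jump_set Omega u `|` Phi j @^-1` jump_set Omega (u_ j))
       (g0 (enorm (jump Omega u nu x) +
            enorm (jump Omega (u_ j) (nu_ j) (Phi j x))) *
        enorm (nu x - nu_ j (Phi j x)))%:E
       @[j --> \oo] --> 0)%E ;
  apx_measure : (H (jump_set Omega u) < +oo)%E ->
    H (jump_set Omega u `+` Phi j @^-1` jump_set Omega (u_ j))
      @[j --> \oo] --> 0%E ;
  apx_gradient0 :
    {ae leb n.+1, forall x, Omega x -> agrad u x = 0} ->
    forall j, {ae leb n.+1, forall x, Omega x -> agrad (u_ j) x = 0} ;
  apx_W1p : W1p Omega p u -> forall j, W1p Omega p (u_ j) }.

End ApproximatingSequence.

(* Main.v *)
From HB Require Import structures.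
Require Import Defs.
From mathcomp Require Import all_boot all_order all_algebra.
From mathcomp Require Import all_classical all_reals all_analysis.
From mathcomp Require Import measurable_realfun.
From mathcomp Require Import ring lra.
Import Order.TTheory GRing.Theory Num.Theory.
Import numFieldNormedType.Exports.
Local Open Scope classical_set_scope.
Local Open Scope ring_scope.

(** Both integrals are treated by one principle (dominated_cvg0): a nonnegative
    sequence Y_j has integrals tending to 0 if it is dominated by G + c Z_j, with G
    integrable and Z_j tending to 0 in L^1, and if, along any sequence of indices,
    Y_j tends to 0 at every point where Z_j does.

    For the bulk term, Y_j is |Psi(grad u_j) - Psi(grad u)| and the defect Z_j is
    |grad u_j - grad u|^p; the p-growth of Psi gives the domination, Omega having
    finite measure (Lp_continuous_integral).

    For the surface term everything is first pulled back to the jump set J of u.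
    Write w, eta for the jump and the normal of u, and w_j, eta_j for those of u_j
    composed with Phi_j, all extended by 0.  The defect is the sum of the two
    integrands that are assumed to vanish in the limit and of the indicator of the
    symmetric difference of J and of the pulled-back jump set.  At a point of J
    where the defect tends to 0 both w_j and eta_j converge, so g(w_j, eta_j)
    converges by continuity; the growth condition, the boundedness of g(0, .) on
    the sphere and the subadditivity of g0 give the domination
    (surface_energy_cvg).

    It remains to remove the deformations.  The bound on D Phi_j - Id holds only
    almost everywhere, but Phi_j is Lipschitz, so averaging increments over small
    balls shows that Phi_j - id has a small Lipschitz constant
    (ae_derivative_increment_le).  Such a Phi_j is onto and changes Hausdorff
    measure by factors close to 1, hence composing with it does not change the
    limit of the integrals (near_id_integral_cvg).

    For these integrals to mean what they should, the functions involved must be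
    measurable for the Caratheodory sigma-algebras.  Open sets are measurable by
    Caratheodory's criterion; preimages of Hausdorff measurable sets under
    bi-Lipschitz maps are measurable by a Borel hull argument
    (hausdorff_measurable_bilipschitz); and the jump is measurable for every
    orientation because the normal is unique up to its sign (jump_normal_unique).
    The uniqueness comes from the fact that half-balls with normals p and q, q
    different from -p, overlap in a fixed fraction of their volume
    (trace_overlap); it also makes the energy independent of the orientation, as g
    is even. *)

Set Implicit Arguments.
Unset Strict Implicit.
Unset Printing Implicit Defensive.

(** * The Euclidean norm of matrices *)

Section Euclidean_norm.
Context {R : realType}.

(** Lagrange's identity: twice the defect is the double sum of the squares
    of f i * g j - f j * g i. *)
Lemma sumr_cauchy_schwarz (I : finType) (f g : I -> R) :
  (\sum_i f i * g i) ^+ 2 <= (\sum_i f i ^+ 2) * (\sum_i g i ^+ 2).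
Proof.
rewrite -subr_ge0 -(pmulr_rge0 _ (ltr0n R 2)).
suff -> : 2%:R * ((\sum_i f i ^+ 2) * (\sum_i g i ^+ 2) - (\sum_i f i * g i) ^+ 2)
    = \sum_i \sum_j (f i * g j - f j * g i) ^+ 2.
  by apply: sumr_ge0 => i _; apply: sumr_ge0 => j _; exact: sqr_ge0.
have E1 : \sum_i \sum_j (f i * g j) ^+ 2 = (\sum_i f i ^+ 2) * (\sum_i g i ^+ 2).
  rewrite big_distrlr /=; apply: eq_bigr => i _; apply: eq_bigr => j _.
  by rewrite exprMn.
have E2 : \sum_i \sum_j (f j * g i) ^+ 2 = (\sum_i f i ^+ 2) * (\sum_i g i ^+ 2).
  by rewrite exchange_big /= E1.
have E3 : \sum_i \sum_j (f i * g j * (f j * g i)) *+ 2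
    = (\sum_i f i * g i) ^+ 2 *+ 2.
  rewrite [in RHS]expr2 big_distrlr /= -sumrMnl; apply: eq_bigr => i _.
  by rewrite -[RHS]sumrMnl; apply: eq_bigr => j _; ring.
rewrite [RHS](eq_bigr (fun i => \sum_j (f i * g j) ^+ 2 -
    \sum_j (f i * g j * (f j * g i)) *+ 2 + \sum_j (f j * g i) ^+ 2)).
  by rewrite big_split sumrB /= E1 E2 E3; ring.
by move=> i _; rewrite -sumrB -big_split; apply: eq_bigr => j _; rewrite sqrrB.
Qed.

Lemma enorm_ge0 m n (A : 'M[R]_(m, n)) : 0 <= enorm A.
Proof. exact: sqrtr_ge0. Qed.

Let sumsq_ge0 m n (A : 'M[R]_(m, n)) : 0 <= \sum_i \sum_j A i j ^+ 2.
Proof. by apply: sumr_ge0 => i _; apply: sumr_ge0 => j _; exact: sqr_ge0. Qed.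

Lemma enorm_sqr m n (A : 'M[R]_(m, n)) :
  enorm A ^+ 2 = \sum_i \sum_j A i j ^+ 2.
Proof. by rewrite sqr_sqrtr. Qed.

Lemma entry_le_enorm m n (A : 'M[R]_(m, n)) i j : `|A i j| <= enorm A.
Proof.
rewrite -sqrtr_sqr; apply: ler_wsqrtr.
rewrite (bigD1 i)//= (bigD1 j)//= -addrA lerDl addr_ge0//.
  by apply: sumr_ge0 => k _; exact: sqr_ge0.
by apply: sumr_ge0 => k _; apply: sumr_ge0 => l _; exact: sqr_ge0.
Qed.

Lemma enorm0 m n : enorm (0 : 'M[R]_(m, n)) = 0.
Proof.
by rewrite /enorm big1 ?sqrtr0// => i _; rewrite big1// => j _; rewrite mxE expr0n.
Qed.

Lemma enorm_eq0 m n (A : 'M[R]_(m, n)) : enorm A = 0 -> A = 0.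
Proof.
move=> A0; apply/matrixP => i j; rewrite mxE; apply/eqP.
by rewrite -normr_eq0 eq_le normr_ge0 -A0 entry_le_enorm.
Qed.

Lemma enormN m n (A : 'M[R]_(m, n)) : enorm (- A) = enorm A.
Proof.
by congr Num.sqrt; apply: eq_bigr => i _; apply: eq_bigr => j _; rewrite mxE sqrrN.
Qed.

Lemma enormB_sym m n (A B : 'M[R]_(m, n)) : enorm (A - B) = enorm (B - A).
Proof. by rewrite -enormN opprB. Qed.

Lemma enormZ m n c (A : 'M[R]_(m, n)) : enorm (c *: A) = `|c| * enorm A.
Proof.
apply/eqP; rewrite -(@eqrXn2 _ 2) ?enorm_ge0 ?mulr_ge0 ?enorm_ge0//.
rewrite exprMn !enorm_sqr real_normK ?num_real// mulr_sumr; apply/eqP.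
apply: eq_bigr => i _; rewrite mulr_sumr; apply: eq_bigr => j _.
by rewrite mxE exprMn.
Qed.

Lemma enormD m n (A B : 'M[R]_(m, n)) : enorm (A + B) <= enorm A + enorm B.
Proof.
rewrite -ler_sqr ?nnegrE ?enorm_ge0 ?addr_ge0 ?enorm_ge0//.
rewrite sqrrD !enorm_sqr.
have -> : \sum_i \sum_j (A + B) i j ^+ 2 = \sum_i \sum_j A i j ^+ 2 +
   (\sum_i \sum_j A i j * B i j) *+ 2 + \sum_i \sum_j B i j ^+ 2.
  rewrite -sumrMnl -!big_split; apply: eq_bigr => i _ /=.
  rewrite -sumrMnl -!big_split; apply: eq_bigr => j _ /=.
  by rewrite mxE sqrrD.
rewrite lerD2r lerD2l lerMn2r /=; apply: le_trans (ler_norm _) _.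
rewrite -ler_sqr ?nnegrE ?normr_ge0 ?mulr_ge0 ?enorm_ge0//.
rewrite real_normK ?num_real// exprMn !enorm_sqr !pair_big /=.
exact: (sumr_cauchy_schwarz (fun p => A p.1 p.2) (fun p => B p.1 p.2)).
Qed.

Lemma enormB_triangle m n (A B C : 'M[R]_(m, n)) :
  enorm (A - C) <= enorm (A - B) + enorm (B - C).
Proof. by rewrite -[A - C](subrKA B) enormD. Qed.

Lemma enorm_le_sum m n (A : 'M[R]_(m, n)) : enorm A <= \sum_i \sum_j `|A i j|.
Proof.
have s0 : 0 <= \sum_i \sum_j `|A i j|.
  by apply: sumr_ge0 => i _; exact: sumr_ge0.
rewrite -ler_sqr ?nnegrE ?enorm_ge0// enorm_sqr expr2 mulr_suml.
apply: ler_sum => i _; rewrite mulr_suml; apply: ler_sum => j _.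
rewrite -real_normK ?num_real// expr2 ler_wpM2l//.
rewrite (bigD1 i)//= (bigD1 j)//= -addrA lerDl addr_ge0//; first exact: sumr_ge0.
by apply: sumr_ge0 => k _; exact: sumr_ge0.
Qed.

Lemma enorm_mulmx n k (v : 'rV[R]_n) (A : 'M[R]_(n, k)) :
  enorm (v *m A) <= enorm v * enorm A.
Proof.
rewrite -ler_sqr ?nnegrE ?enorm_ge0 ?mulr_ge0 ?enorm_ge0//.
rewrite exprMn !enorm_sqr !big_ord1 exchange_big /= mulr_sumr.
apply: ler_sum => j _; rewrite mxE.
exact: (sumr_cauchy_schwarz (fun i => v 0 i) (fun i => A i j)).
Qed.

Lemma entry_le_norm m n (A : 'M[R]_(m, n)) i j : `|A i j| <= `|A|.
Proof.
rewrite [leRHS]/Num.norm /= mx_normrE.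
by rewrite (le_bigmax 0 (fun p : 'I_m * 'I_n => `|A p.1 p.2|) (i, j)).
Qed.

Lemma norm_le_enorm m n (A : 'M[R]_(m, n)) : `|A| <= enorm A.
Proof.
rewrite [leLHS]/Num.norm /= mx_normrE; apply/bigmax_leP; split.
  exact: enorm_ge0.
by move=> i _; exact: entry_le_enorm.
Qed.

Lemma enorm_le_norm m n (A : 'M[R]_(m, n)) : enorm A <= (m * n)%:R * `|A|.
Proof.
apply: le_trans (enorm_le_sum _) _.
apply: (@le_trans _ _ (\sum_(i < m) \sum_(j < n) `|A|)).
  by apply: ler_sum => i _; apply: ler_sum => j _; exact: entry_le_norm.
by rewrite !sumr_const !card_ord -mulrnA mulnC mulr_natl.
Qed.

Lemma dotC n (x y : 'rV[R]_n) : dot x y = dot y x.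
Proof. by apply: eq_bigr => i _; rewrite mulrC. Qed.

Lemma dotDl n (x y z : 'rV[R]_n) : dot (x + y) z = dot x z + dot y z.
Proof. by rewrite /dot -big_split; apply: eq_bigr => i _; rewrite mxE mulrDl. Qed.

Lemma dotZl n c (x z : 'rV[R]_n) : dot (c *: x) z = c * dot x z.
Proof. by rewrite /dot mulr_sumr; apply: eq_bigr => i _; rewrite mxE mulrA. Qed.

Lemma dot_self n (x : 'rV[R]_n) : dot x x = enorm x ^+ 2.
Proof. by rewrite enorm_sqr big_ord1; apply: eq_bigr => i _; rewrite expr2. Qed.

Lemma dot_le_enorm n (x y : 'rV[R]_n) : `|dot x y| <= enorm x * enorm y.
Proof.
rewrite -ler_sqr ?nnegrE ?normr_ge0 ?mulr_ge0 ?enorm_ge0//.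
rewrite real_normK ?num_real// exprMn !enorm_sqr !big_ord1.
exact: (sumr_cauchy_schwarz (fun i => x 0 i) (fun i => y 0 i)).
Qed.

End Euclidean_norm.

(** * Measurability of matrix-valued maps *)

Section Matrix_valued_measurability.
Context d (T : measurableType d) (R : realType).
Implicit Types (D : set T).

Lemma measurable_enorm D k l (X : T -> 'M[R]_(k, l)) :
  (forall i j, measurable_fun D (fun x => X x i j)) ->
  measurable_fun D (fun x => enorm (X x)).
Proof.
move=> mX; apply: (@measurableT_comp _ _ _ _ _ _ (@Num.sqrt R)).
  by apply: continuous_measurable_fun; exact: sqrt_continuous.
by apply: measurable_sum => i; apply: measurable_sum => j; exact: measurable_funX.
Qed.

Lemma measurable_dot D k (X Y : T -> 'rV[R]_k) :
  (forall i, measurable_fun D (fun x => X x 0 i)) ->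
  (forall i, measurable_fun D (fun x => Y x 0 i)) ->
  measurable_fun D (fun x => dot (X x) (Y x)).
Proof.
by move=> mX mY; apply: measurable_sum => i; exact: measurable_funM.
Qed.

(** Relative openness makes V, inside S, a union of boxes with rational centre
    and rational radius; there are countably many of these, and the preimage of
    each is cut out by finitely many measurable conditions on the entries. *)
Lemma measurable_relatively_open_preimage D k l (X : T -> 'M[R]_(k, l))
    (S V : set 'M[R]_(k, l)) :
  measurable D ->
  (forall i j, measurable_fun D (fun x => X x i j)) ->
  (forall x, D x -> S (X x)) ->
  (forall z, S z -> V z -> exists2 e : R, 0 < e &
    forall z', S z' -> (forall i j, `|z' i j - z i j| < e) -> V z') ->
  measurable (D `&` X @^-1` V).
Proof.
move=> mD mX DS SV.
pose box (p : 'M[rat]_(k, l) * rat) :=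
  [set z : 'M[R]_(k, l) | forall i j, `|z i j - ratr (p.1 i j)| < ratr p.2].
pose good p := forall z, S z -> box p z -> V z.
have -> : D `&` X @^-1` V = \bigcup_p
   (if `[< good p >] then D `&` X @^-1` (box p) else set0).
  apply/seteqP; split => [x [Dx VXx]|x [p _]]; last first.
    case: asboolP => // gp [Dx bx]; split=> //; apply: gp => //; exact: DS.
  have [e e0 He] := SV _ (DS _ Dx) VXx.
  (* The radius is below e / 2 because the box around X x is centred at a
     rational point that may itself be at distance r from X x. *)
  have [r /itvP r0e] : exists r : rat, ratr r \in `](0 : R), (e / 2)[.
    by apply: rat_in_itvoo; rewrite divr_gt0.
  have /choice[q qP] : forall p : 'I_k * 'I_l, exists q : rat,
      ratr q \in `](X x p.1 p.2 - ratr r), (X x p.1 p.2 + ratr r)[.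
    by move=> p; apply: rat_in_itvoo; rewrite ltrBlDr -addrA ltrDl addr_gt0 ?r0e.
 have bX : box (\matrix_(i, j) q (i, j), r) (X x).
    move=> i j /=; rewrite mxE distrC ltr_distl.
    by have := qP (i, j); rewrite in_itv.
  exists (\matrix_(i, j) q (i, j), r) => //; case: asboolP => //; case=> z Sz bz.
  apply: He => // i j; rewrite -(subrKA (ratr (q (i, j)))).
  have := bz i j; have := bX i j; rewrite /= mxE => h1 h2.
  apply: le_lt_trans (ler_normD _ _) _; rewrite [`|_ - X x i j|]distrC.
  have : ratr r < e / 2 by rewrite r0e.
  by move: h1 h2; lra.
apply: countable_bigcupT_measurable => [|p]; first exact: countableP.
case: asboolP => // _.
have -> : D `&` X @^-1` box p = \bigcap_(i in [set: 'I_k]) \bigcap_(j in [set: 'I_l])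
    (D `&` [set x | `|X x i j - ratr (p.1 i j)| < ratr p.2]) `&` D.
  apply/seteqP; split => [x [Dx bx]|x [h Dx]].
    by split=> // i _ j _; split=> //; exact: bx.
  by split => // i j; have [] := h i I j I.
apply: measurableI => //.
apply: fin_bigcap_measurable => // i _; apply: fin_bigcap_measurable => // j _.
have -> : [set x | `|X x i j - ratr (p.1 i j)| < ratr p.2] =
   (fun x => X x i j) @^-1` (ball (ratr (p.1 i j) : R) (ratr p.2)).
  by apply/seteqP; split => x /=; rewrite /ball /= distrC.
by apply: mX => //; exact: measurable_ball.
Qed.

Lemma measurable_continuous_comp D k l (F : 'M[R]_(k, l) -> R)
    (X : T -> 'M[R]_(k, l)) :
  continuous F ->
  (forall i j, measurable_fun D (fun x => X x i j)) ->
  measurable_fun D (F \o X).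
Proof.
move=> cF mX mD; apply: (measurability _ (RGenOInfty.measurableE R)) => //.
move=> _ [_ [c ->] <-].
rewrite set_itvE.
apply: (@measurable_relatively_open_preimage D k l X setT [set z | c < F z]) => //.
move=> z _ /= cz.
have /cF : nbhs (F z) [set t : R | c < t].
  by apply: open_nbhs_nbhs; split=> //; exact: open_gt.
move=> /nbhs_ballP[e e0 He]; exists e => // z' _ zz'; apply: He.
by split => // i j; rewrite /ball /= distrC.
Qed.

End Matrix_valued_measurability.

(** * Volume of boxes and Lebesgue outer measure *)

Section Box_volume.
Context {R : realType}.
Local Open Scope ereal_scope.

(** By induction on the dimension: the sections of the boxes at height t of the
    last coordinate cover a box of one dimension less, and integrating the
    resulting inequality over t turns each weight c k * 1_(I k)(t) into
    c k * |I k|.  The weights are there because a box contributes to the section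
    at height t only when t lies in its last side. *)
Lemma weighted_box_cover n (c : nat -> R) (a b : nat -> nat -> R)
    (a0 b0 : nat -> R) :
  (forall k, (0 <= c k)%R) -> (forall k i, (a k i <= b k i)%R) ->
  (forall i, (a0 i <= b0 i)%R) ->
  (forall x : nat -> R, (forall i, (i < n)%N -> (a0 i <= x i <= b0 i)%R) ->
    1 <= \sum_(k <oo)
      if `[< forall i, (i < n)%N -> (a k i <= x i <= b k i)%R >]
      then (c k)%:E else 0) ->
  (\prod_(i < n) (b0 i - a0 i))%:E <=
    \sum_(k <oo) (c k * \prod_(i < n) (b k i - a k i))%:E.
Proof.
move=> + ab ab0; elim: n c => [|n IH] c c0 H.
  rewrite big_ord0; apply: le_trans (H a0 _) _ => //.
  apply: lee_nneseries => [k _ _|k _]; first by case: asboolP; rewrite ?lee_fin.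
  by case: asboolP => [_|[]//]; rewrite big_ord0 mulr1.
pose I k : set R := `[a k n, b k n]%classic.
pose I0 : set R := `[a0 n, b0 n]%classic.
pose vol (v w : nat -> R) := (\prod_(i < n) (w i - v i))%R.
have vol_ge0 v w : (forall i, (v i <= w i)%R) -> (0 <= vol v w)%R.
  by move=> vw; apply: prodr_ge0 => i _; rewrite subr_ge0.
have length (v w : R) : (v <= w)%R ->
    lebesgue_measure (`[v, w]%classic : set R) = (w - v)%:E.
  move=> vw; rewrite lebesgue_measure_itv /= lte_fin.
  case: ltP => [//|wv]; have -> : v = w by apply/eqP; rewrite eq_le vw.
  by rewrite subrr.
have slice t : I0 t -> (vol a0 b0)%:E <=
    \sum_(k <oo) ((c k * vol (a k) (b k))%:E * (\1_(I k) t)%:E).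
  move=> I0t; apply: le_trans (IH (fun k => c k * \1_(I k) t)%R _ _) _.
  - by move=> k; rewrite mulr_ge0.
  - move=> x x0; pose y i := if i == n then t else x i.
    apply: le_trans (H y _) _.
      move=> i; rewrite ltnS leq_eqVlt /y; have [-> _|_ /=] := eqVneq i n; last exact: x0.
      by move: I0t; rewrite /I0 /= in_itv /=.
    apply: lee_nneseries => [k _ _|k _]; first by case: asboolP; rewrite ?lee_fin.
    case: asboolP => [yk|_]; last first.
      by case: asboolP => // _; rewrite lee_fin mulr_ge0.
    case: asboolP => [_|[]]; last first.
      by move=> i i_n; have := yk i (ltnW i_n); rewrite /y ltn_eqF.
    rewrite indicE mem_set ?mulr1//.
    by have := yk n (ltnSn n); rewrite /y eqxx /I /= in_itv /=.
  - apply: lee_nneseries => [k _ _|k _].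
      by rewrite lee_fin !mulr_ge0// vol_ge0.
    by rewrite -EFinM lee_fin mulrAC.
have mI0 : measurable (I0 : set (measurableTypeR R)) by exact: measurable_itv.
have mI k : measurable (I k : set (measurableTypeR R)) by exact: measurable_itv.
rewrite big_ord_recr /= EFinM -(length _ _ (ab0 n)).
rewrite -integral_cst//.
apply: (@le_trans _ _ (\int[lebesgue_measure]_(t in I0)
    \sum_(k <oo) ((c k * vol (a k) (b k))%:E * (\1_(I k) t)%:E))).
  apply: ge0_le_integral => //.
  - by move=> t _; rewrite lee_fin vol_ge0.
  - apply: ge0_emeasurable_sum => [k t _ _|k _].
      by rewrite mule_ge0// lee_fin mulr_ge0// vol_ge0.
    by apply: measurable_funeM; apply/measurable_EFinP; exact: measurable_indic.
rewrite integral_nneseries//; last 2 first.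
- move=> k.
  by apply: measurable_funeM; apply/measurable_EFinP; exact: measurable_indic.
- by move=> k t _; rewrite mule_ge0// lee_fin mulr_ge0// vol_ge0.
apply: lee_nneseries => [k _ _|k _].
  apply: integral_ge0 => t _.
  by rewrite mule_ge0// lee_fin mulr_ge0// vol_ge0.
rewrite ge0_integralZl//; last 2 first.
- by apply/measurable_EFinP; exact: measurable_indic.
- by rewrite lee_fin mulr_ge0// vol_ge0.
rewrite integral_indic// big_ord_recr /= mulrA [leRHS]EFinM; apply: lee_wpmul2l.
  by rewrite lee_fin mulr_ge0// vol_ge0.
rewrite -length//; apply: le_measure; rewrite ?inE//.
exact: measurableI.
Qed.
End Box_volume.

Section Lebesgue_outer_measure.
Context {R : realType}.
Local Open Scope ereal_scope.

Lemma gauge0_neq0 T (h : set T -> \bar R) F : F !=set0 -> gauge0 h F = h F.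
Proof.
move=> [x Fx]; rewrite /gauge0; case: asboolP => // F0.
by move: Fx; rewrite F0.
Qed.

Lemma lebesgue_outer_le_box n (X : set 'rV[R]_n) (a b : 'rV[R]_n) :
  (forall i, a ord0 i <= b ord0 i)%R ->
  X `<=` [set x : 'rV[R]_n | forall i, (a ord0 i <= x ord0 i <= b ord0 i)%R] ->
  lebesgue_outer X <= (\prod_(i < n) (b ord0 i - a ord0 i))%:E.
Proof.
move=> ab Xab; apply: le_trans (ereal_inf_lbound _) _.
  exists (fun k => if k == 0%N then X else set0) => //.
  by move=> x Xx; exists 0%N.
have g0 F : 0 <= gauge0 (@box_gauge R n) F.
  by apply: gauge0_ge0; exact: box_gauge_ge0.
rewrite (nneseriesD1 (n := 0%N))//= eseries0 ?adde0; last first.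
  by move=> k _ /negbTE ->; rewrite gauge0_set0.
rewrite /gauge0; case: asboolP => _.
  by rewrite lee_fin prodr_ge0// => i _; rewrite subr_ge0.
by apply: ereal_inf_lbound; exists a, b.
Qed.

Let entry n (v : 'rV[R]_n) (i : nat) : R :=
  if insub i is Some j then v ord0 j else 0.

Let entryE n (v : 'rV[R]_n) (i : 'I_n) : entry v i = v ord0 i.
Proof. by rewrite /entry valK. Qed.

(** Up to an error e / 2 ^ k.+1 the k-th covering set may be replaced by a box;
    the boxes then have total volume at least that of the box they cover.  The
    weight 0 disposes of the empty covering sets, whose gauge is 0 by
    convention. *)
Lemma lebesgue_outer_ge_box n (X : set 'rV[R]_n) (a b : 'rV[R]_n) :
  (forall i, a ord0 i <= b ord0 i)%R ->
  [set x : 'rV[R]_n | forall i, (a ord0 i <= x ord0 i <= b ord0 i)%R] `<=` X ->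
  (\prod_(i < n) (b ord0 i - a ord0 i))%:E <= lebesgue_outer X.
Proof.
move=> ab abX; apply: le_ereal_inf_tmp => _ [F XF <-].
have g0 k : 0 <= gauge0 (@box_gauge R n) (F k).
  by apply: gauge0_ge0; exact: box_gauge_ge0.
have [[k Fk]|Ffin] := pselect (exists k, gauge0 (@box_gauge R n) (F k) = +oo).
  suff -> : \sum_(k <oo) gauge0 (@box_gauge R n) (F k) = +oo by rewrite leey.
  apply/eqP; rewrite -leye_eq -Fk (nneseriesD1 (n := k))//.
  by rewrite leeDl// nneseries_ge0.
apply/lee_addgt0Pr => e e0; apply: le_trans (epsilon_trick _ g0 (ltW e0)).
have /choice[w wP] : forall k, exists w : R * ('rV[R]_n * 'rV[R]_n),
  [/\ (0 <= w.1)%R, (forall i, w.2.1 ord0 i <= w.2.2 ord0 i)%R,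
      forall x, F k x -> w.1 = 1%R /\
        forall i, (w.2.1 ord0 i <= x ord0 i <= w.2.2 ord0 i)%R &
      (w.1 * \prod_(i < n) (w.2.2 ord0 i - w.2.1 ord0 i))%:E <=
      gauge0 (@box_gauge R n) (F k) + (e / (2 ^ k.+1)%:R)%:E].
  move=> k; have [Fk0|/set0P Fk0] := eqVneq (F k) set0.
    exists (0%R, (0%R, 0%R)); split => //= [x|]; first by rewrite Fk0.
    by rewrite mul0r adde_ge0// lee_fin divr_ge0// ltW.
  have fin : box_gauge (F k) \is a fin_num.
    rewrite ge0_fin_numE ?box_gauge_ge0// ltey; apply/eqP => Fk.
    by apply: Ffin; exists k; rewrite gauge0_neq0.
  have ek : (0 < e / (2 ^ k.+1)%:R)%R by rewrite divr_gt0// ltr0n expn_gt0.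
  have [_ [v [z [vz Fvz ->]]] lev] := lb_ereal_inf_adherent ek fin.
  exists (1%R, (v, z)); split => //= [x Fx|].
    by split=> //; exact: Fvz.
  by rewrite mul1r gauge0_neq0// ltW.
rewrite (eq_bigr (fun i : 'I_n => entry b i - entry a i)%R); last first.
  by move=> i _; rewrite !entryE.
pose lo k := entry (w k).2.1; pose hi k := entry (w k).2.2.
apply: (@le_trans _ _ (\sum_(k <oo)
    ((w k).1 * \prod_(i < n) (hi k i - lo k i))%:E)).
  apply: weighted_box_cover.
  - by move=> k; have [] := wP k.
  - move=> k i; rewrite /lo /hi /entry; case: insubP => // j _ _.
    by have [_ + _ _] := wP k; exact.
  - by move=> i; rewrite /entry; case: insubP => // j _ _; exact: ab.
  move=> x xab; pose y : 'rV[R]_n := (\row_i x i)%R.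
  have /XF [k _ Fky] : X y.
    apply: abX => i /=; rewrite mxE; have := xab i (ltn_ord i).
    by rewrite !entryE.
  have [w0 _ /(_ _ Fky)[w1 yk] _] := wP k.
  rewrite (nneseriesD1 (n := k))//; last first.
    by move=> l _; case: asboolP => // _; rewrite lee_fin; have [] := wP l.
  case: asboolP => [_|[]].
    rewrite w1 leeDl// nneseries_ge0// => l _ _.
    by case: asboolP => // _; rewrite lee_fin; have [] := wP l.
  move=> i ilt; have := yk (Ordinal ilt); rewrite mxE /lo /hi.
  by rewrite -!entryE.
apply: lee_nneseries => [k _ _|k _].
  rewrite lee_fin mulr_ge0//; first by have [] := wP k.
  apply: prodr_ge0 => i _; rewrite subr_ge0 /lo /hi !entryE.
  by have [_ + _ _] := wP k; exact.
have [_ _ _ ] := wP k; congr (_%:E <= _); congr (_ * _)%R.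
by apply: eq_bigr => i _; rewrite /lo /hi !entryE.
Qed.

(** A cover of the union restricts to covers of A and of B, so superadditivity
    of the gauge on each covering set passes to the sums. *)
Lemma cover_measureU_ge (T : pointedType) (h : set T -> \bar R) (A B : set T) :
  (forall F, 0 <= h F) ->
  (forall F, gauge0 h (F `&` A) + gauge0 h (F `&` B) <= gauge0 h F) ->
  cover_measure h A + cover_measure h B <= cover_measure h (A `|` B).
Proof.
move=> h0 hAB; apply: le_ereal_inf_tmp => _ [F ABF <-].
apply: (@le_trans _ _ (\sum_(k <oo)
    (gauge0 h (F k `&` A) + gauge0 h (F k `&` B)))).
  rewrite nneseriesD; [|by move=> *; exact: gauge0_ge0..].
  apply: leeD; apply: ereal_inf_lbound.
    exists (fun k => F k `&` A) => // x Ax.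
    by have [|k _ Fkx] := ABF x; [left|exists k].
  exists (fun k => F k `&` B) => // x Bx.
  by have [|k _ Fkx] := ABF x; [right|exists k].
apply: lee_nneseries => [k _ _|k _]; last exact: hAB.
by rewrite adde_ge0// gauge0_ge0.
Qed.

(** A hyperplane orthogonal to an axis cuts a box into two boxes whose volumes
    add up.  This makes half-spaces Lebesgue measurable. *)
Lemma box_gauge_split n (i : 'I_n) (c : R) (F : set 'rV[R]_n) :
  gauge0 (@box_gauge R n) (F `&` [set x : 'rV[R]_n | x ord0 i <= c]%R) +
  gauge0 (@box_gauge R n) (F `&` ~` [set x : 'rV[R]_n | x ord0 i <= c]%R) <=
  gauge0 (@box_gauge R n) F.
Proof.
have le_gauge (G : set 'rV[R]_n) (a b : 'rV[R]_n) :
    (forall j, a ord0 j <= b ord0 j)%R ->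
    G `<=` [set x : 'rV[R]_n | forall j, (a ord0 j <= x ord0 j <= b ord0 j)%R] ->
    gauge0 (@box_gauge R n) G <= (\prod_(j < n) (b ord0 j - a ord0 j))%:E.
  move=> ab Gab; rewrite /gauge0; case: asboolP => _.
    by rewrite lee_fin prodr_ge0// => j _; rewrite subr_ge0.
  by apply: ereal_inf_lbound; exists a, b.
have [->|/set0P F0] := eqVneq F set0.
  by rewrite !set0I !gauge0_set0 adde0.
rewrite (gauge0_neq0 _ F0); apply: le_ereal_inf_tmp => _ [a [b [ab Fab ->]]].
(* c' is the projection of c on the i-th side, so that the two halves are
   boxes even if the hyperplane misses the box *)
pose c' := Num.min (b ord0 i) (Num.max (a ord0 i) c).
have ac : (a ord0 i <= c')%R by rewrite /c' le_min ab le_max lexx.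
have cb : (c' <= b ord0 i)%R by rewrite /c' ge_min lexx.
pose cut (v : 'rV[R]_n) : 'rV[R]_n := (\row_j if j == i then c' else v ord0 j)%R.
rewrite (bigD1 i)//=.
have -> : ((b ord0 i - a ord0 i) * \prod_(j < n | j != i) (b ord0 j - a ord0 j))%R
   = ((\prod_(j < n) (cut b ord0 j - a ord0 j)) +
      (\prod_(j < n) (b ord0 j - cut a ord0 j)))%R.
  have E1 : (\prod_(j < n) (cut b ord0 j - a ord0 j) =
      (c' - a ord0 i) * \prod_(j < n | j != i) (b ord0 j - a ord0 j))%R.
    rewrite (bigD1 i)//= mxE eqxx; congr (_ * _)%R.
    by apply: eq_bigr => j /negbTE ji; rewrite mxE ji.
  have E2 : (\prod_(j < n) (b ord0 j - cut a ord0 j) =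
      (b ord0 i - c') * \prod_(j < n | j != i) (b ord0 j - a ord0 j))%R.
    rewrite (bigD1 i)//= mxE eqxx; congr (_ * _)%R.
    by apply: eq_bigr => j /negbTE ji; rewrite mxE ji.
  by rewrite E1 E2; ring.
rewrite EFinD; apply: leeD; apply: le_gauge.
- by move=> j; rewrite mxE; case: eqP => [->|].
- move=> x [Fx xc] j; rewrite mxE; have /andP[ax xb] := Fab _ Fx j.
  rewrite ax; case: eqP => // ji; subst j.
  by rewrite /c' le_min xb le_max xc orbT.
- by move=> j; rewrite mxE; case: eqP => [->|].
- move=> x [Fx /negP xc] j; rewrite mxE; have /andP[ax xb] := Fab _ Fx j.
  rewrite xb andbT; case: eqP => // ji; subst j.
  have cx : (c <= x ord0 i)%R by rewrite ltW// ltNge.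
  by rewrite /c' ge_min ge_max ax cx orbT.
Qed.

Lemma le_box_gauge0 n (F G : set 'rV[R]_n) : F `<=` G ->
  gauge0 (@box_gauge R n) F <= gauge0 (@box_gauge R n) G.
Proof.
move=> FG; have [->|/set0P F0] := eqVneq F set0.
  by rewrite gauge0_set0 gauge0_ge0//; exact: box_gauge_ge0.
rewrite !gauge0_neq0//; last by case: F0 => x /FG; exists x.
apply: le_ereal_inf_tmp => _ [a [b [ab Gab ->]]].
by apply: ereal_inf_lbound; exists a, b; split => // x /FG /Gab.
Qed.

Lemma lebesgue_measurable_coord n (i : 'I_n) D :
  measurable_fun (D : set (Leb_space R n)) (fun x => x ord0 i).
Proof.
apply: measurable_funTS => _.
apply: (measurability _ (RGenOInfty.measurableE R)) => //.
move=> _ [_ [c ->] <-]; rewrite setTI.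
rewrite [X in measurable X](_ : _ = ~` [set x : 'rV[R]_n | x ord0 i <= c]%R); last first.
  apply/seteqP; split => x; rewrite /= in_itv /= andbT ltNge; first by move/negP.
  by move=> h; apply/negP.
apply: measurableC; apply: le_caratheodory_measurable => X.
rewrite -[in leRHS](setIT X) -(setUv [set x : 'rV[R]_n | x ord0 i <= c]%R) setIUr.
apply: cover_measureU_ge => [|F]; first exact: box_gauge_ge0.
rewrite !setIA; apply: le_trans (box_gauge_split i c _) _.
by apply: le_box_gauge0 => x [].
Qed.

End Lebesgue_outer_measure.

(** * Open sets are Lebesgue and Hausdorff measurable *)

Section Caratheodory_criterion.
Context (R : realType) (T : Type) (mu : {outer_measure set T -> \bar R}).
Variable phi : T -> R.
Local Open Scope ereal_scope.
Hypothesis mu_separated : forall s t A B, (s < t)%R ->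
  A `<=` [set x | phi x <= s]%R -> B `<=` [set x | t <= phi x]%R ->
  mu A + mu B <= mu (A `|` B).

Variable c : R.
Let r k : R := (c + k.+1%:R^-1)%R.

Let r_decr k l : (k <= l)%N -> (r l <= r k)%R.
Proof. by move=> kl; rewrite lerD2l lef_pV2 ?posrE ?ltr0n// ler_nat. Qed.

Let r_sdecr k l : (k < l)%N -> (r l < r k)%R.
Proof. by move=> kl; rewrite ltrD2l ltf_pV2 ?posrE ?ltr0n// ltr_nat. Qed.

Variable X : set T.
Hypothesis muX : mu X < +oo.
Let ring k := X `&` [set x | r k.+1 <= phi x < r k]%R.

(** Rings of equal parity are separated from one another, hence their measures
    add up to at most that of X. *)
Let sum_rings (b : nat) N : \sum_(0 <= i < N) mu (ring (i.*2 + b)) <= mu X.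
Proof.
case: N => [|N]; first by rewrite big_nil outer_measure_ge0.
apply: (@le_trans _ _ (mu (X `&` [set x | r (N.*2 + b).+1 <= phi x]%R))); last first.
  by apply: le_outer_measure => x [].
elim: N => [|N IH].
  rewrite big_nat1; apply: le_outer_measure => x [Xx /= /andP[rx _]].
  by split.
rewrite big_nat_recr//=; apply: le_trans (leeD IH (lexx _)) _.
rewrite addeC; apply: le_trans (@mu_separated (r (N.*2 + b).+2) (r (N.*2 + b).+1) _ _ _ _ _) _.
- exact: r_sdecr.
- by move=> x [_ /= /andP[_ /ltW]]; rewrite doubleS.
- by move=> x [].
apply: le_outer_measure => x [[Xx /= /andP[rx _]]|[Xx /= rx]]; split=> //=.
by apply: le_trans rx; apply: r_decr; rewrite doubleS !ltnS; exact: leqW.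
Qed.

Let pair_rings i := ring i.*2 `|` ring i.*2.+1.

Let sum_pair_rings : \sum_(i <oo) (mu (ring i.*2) + mu (ring i.*2.+1)) < +oo.
Proof.
rewrite nneseriesD; [|by move=> *; exact: outer_measure_ge0..].
have H b : \sum_(i <oo) mu (ring (i.*2 + b)) <= mu X.
  apply: lime_le; first by apply: is_cvg_nneseries => *; exact: outer_measure_ge0.
  by apply: nearW => N; exact: sum_rings.
apply: lte_add_pinfty; apply: le_lt_trans muX.
  by have := H 0%N; under eq_eseriesr do rewrite addn0.
by have := H 1%N; under eq_eseriesr do rewrite addn1.
Qed.

Let above_sub j : X `&` ~` [set x | phi x <= c]%R `<=`
  (X `&` [set x | r j.*2 <= phi x]%R) `|` \bigcup_(i in ~` `I_j) pair_rings i.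
Proof.
move=> x [Xx /= /negP]; rewrite -ltNge => cx.
have [rx|xr] := leP (r j.*2) (phi x); [by left|right].
have ex : exists k, (r k.+1 <= phi x)%R.
  have d0 : (0 < phi x - c)%R by rewrite subr_gt0.
  exists (Num.truncn (phi x - c)^-1); rewrite /r -lerBrDl.
  rewrite -[leRHS]invrK lef_pV2 ?posrE ?invr_gt0 ?ltr0n//.
  by apply: ltW; apply: lt_trans (truncnS_gt _) _; rewrite ltr_nat.
pose k := ex_minn ex; have kx : (r k.+1 <= phi x)%R by rewrite /k; case: ex_minnP.
have xk : (phi x < r k)%R.
  rewrite ltNge; apply/negP; rewrite /k; case: ex_minnP => [[_ _|m _ min]].
    move=> h; suff : (phi x < phi x)%R by rewrite ltxx.
    by apply: lt_le_trans xr _; apply: le_trans h; exact: r_decr.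
  by move/min; rewrite ltnn.
have jk : (j.*2 <= k)%N.
  rewrite leqNgt; apply/negP => kj; move: xr; rewrite ltNge => /negP; apply.
  by apply: le_trans kx; exact: r_decr.
exists k./2 => /=.
  by apply/negP; rewrite -leqNgt -(doubleK j) half_leq.
have := odd_double_half k; case: (odd k); rewrite ?add0n ?add1n => kE.
  by right; rewrite kE; split=> //=; rewrite kx.
by left; rewrite kE; split=> //=; rewrite kx.
Qed.

Lemma outer_measure_separated_split :
  mu (X `&` [set x | phi x <= c]%R) + mu (X `&` ~` [set x | phi x <= c]%R) <= mu X.
Proof.
pose tail j := \sum_(j <= i <oo) (mu (ring i.*2) + mu (ring i.*2.+1)).
have bound j : mu (X `&` [set x | phi x <= c]%R) +
    mu (X `&` ~` [set x | phi x <= c]%R) <= mu X + tail j.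
  apply: (@le_trans _ _ (mu (X `&` [set x | phi x <= c]%R) +
      (mu (X `&` [set x | r j.*2 <= phi x]%R) + tail j))).
    apply: leeD2l; apply: le_trans (le_outer_measure mu _ _ (@above_sub j)) _.
    apply: le_trans (outer_measureU2 _ _ _) _; apply: leeD2l.
    apply: le_trans (outer_measure_sigma_subadditive_tail _ _ _) _.
    apply: lee_nneseries => [i _ _|i _]; first exact: outer_measure_ge0.
    exact: outer_measureU2.
  rewrite addeA; apply: leeD2r.
  apply: le_trans (@mu_separated c (r j.*2) _ _ _ _ _) _.
  - by rewrite ltrDl invr_gt0.
  - by move=> x [].
  - by move=> x [].
  - by apply: le_outer_measure => x [[]|[]].
have tail0 : tail j @[j --> \oo] --> 0.
  apply: nneseries_tail_cvg sum_pair_rings _ => i _.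
  by rewrite adde_ge0// outer_measure_ge0.
have muXf : mu X \is a fin_num by rewrite ge0_fin_numE ?outer_measure_ge0.
have : (mu X + tail j) @[j --> \oo] --> mu X + 0.
  by apply: cvgeD => //; [exact: fin_num_adde_defr|exact: cvg_cst].
rewrite adde0 => /cvg_lim <- //; apply: lime_ge.
  by apply/cvg_ex; exists (mu X + 0); apply: cvgeD => //;
    [exact: fin_num_adde_defr|exact: cvg_cst].
by apply: nearW => j; exact: bound.
Qed.

End Caratheodory_criterion.

(** Caratheodory's criterion.  The part of X above the level c is exhausted by
    the sets where phi >= c + 1 / k.+1, each separated from the sublevel set; what
    is left over consists of rings between consecutive levels, and the measures
    of the rings are summable. *)
Lemma caratheodory_criterion (R : realType) (T : Type)
    (mu : {outer_measure set T -> \bar R}) (phi : T -> R) :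
  (forall s t A B, s < t -> A `<=` [set x | phi x <= s] ->
    B `<=` [set x | t <= phi x] -> (mu A + mu B <= mu (A `|` B))%E) ->
  forall c, mu.-caratheodory [set x | phi x <= c].
Proof.
move=> sep c; apply: le_caratheodory_measurable => X.
have [muX|] := boolP (mu X < +oo)%E; first exact: outer_measure_separated_split.
by rewrite -leNgt leye_eq => /eqP ->; rewrite leey.
Qed.

Section Hausdorff_measure.
Context {R : realType}.
Variables d n : nat.
Local Open Scope ereal_scope.
Local Notation H := (@hausdorff_outer R d n).
Implicit Types F G : set 'rV[R]_n.

Lemma enorm_le_diam F x y : F x -> F y -> (enorm (x - y))%:E <= diam F.
Proof.
by move=> Fx Fy; apply: ereal_sup_ubound; exists x => //; exists y.
Qed.

Lemma diam_ge0 F : F !=set0 -> 0 <= diam F.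
Proof.
move=> [x Fx]; apply: le_trans (enorm_le_diam Fx Fx).
by rewrite lee_fin enorm_ge0.
Qed.

Lemma ball_volume_ge0 : (0 <= @ball_volume R d)%R.
Proof. by rewrite fine_ge0// (outer_measure_ge0 (@lebesgue_outer R d)). Qed.

(** Homogeneity of degree d of the gauge; delta is scaled as well, so that the
    test diam <= delta passes from G to F. *)
Lemma hausdorff_gauge0_scale (K delta : R) F G : (0 < K)%R ->
  (F !=set0 -> G !=set0) -> (F !=set0 -> diam F <= K%:E * diam G) ->
  gauge0 (hausdorff_gauge d (K * delta)) F <=
  (K ^+ d)%:E * gauge0 (hausdorff_gauge d delta) G.
Proof.
move=> K0 FG0 FG.
have Kd : (0 < K ^+ d)%R by rewrite exprn_gt0.
have [->|/set0P F0] := eqVneq F set0.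
  rewrite gauge0_set0; apply: mule_ge0; first by rewrite lee_fin ltW.
  by apply: gauge0_ge0; exact: hausdorff_gauge_ge0.
have G0 := FG0 F0; have {}FG := FG F0.
rewrite !gauge0_neq0// /hausdorff_gauge.
have [Gd|_] := leP (diam G) delta%:E; last by rewrite gt0_muley// leey.
have -> : diam F <= (K * delta)%:E.
  by apply: le_trans FG _; rewrite EFinM lee_wpmul2l// lee_fin ltW.
have Gf : diam G \is a fin_num.
  by rewrite ge0_fin_numE ?diam_ge0// (le_lt_trans Gd)// ltry.
have Ff : diam F \is a fin_num.
  rewrite ge0_fin_numE ?diam_ge0// (le_lt_trans FG)//.
  by rewrite -(fineK Gf) -EFinM ltry.
rewrite -EFinM lee_fin mulrCA; apply: ler_wpM2l; first exact: ball_volume_ge0.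
rewrite -exprMn; apply: lerXn2r.
- by rewrite nnegrE divr_ge0// fine_ge0// diam_ge0.
- by rewrite nnegrE mulr_ge0 ?(ltW K0)// divr_ge0// fine_ge0// diam_ge0.
rewrite mulrA ler_pM2r ?invr_gt0//.
by move: FG; rewrite -{1}(fineK Gf) -{1}(fineK Ff) -EFinM lee_fin.
Qed.

Lemma le_diam F G : F `<=` G -> diam F <= diam G.
Proof.
move=> FG; apply: ge_ereal_sup => _ [x Fx [y Fy <-]].
by apply: enorm_le_diam; exact: FG.
Qed.

Lemma le_hausdorff_gauge0 (delta : R) F G : F `<=` G ->
  gauge0 (hausdorff_gauge d delta) F <= gauge0 (hausdorff_gauge d delta) G.
Proof.
move=> FG; have := @hausdorff_gauge0_scale 1 delta F G ltr01.
rewrite mul1r expr1n !mul1e; apply.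
  by move=> [x /FG]; exists x.
by move=> _; exact: le_diam.
Qed.

Lemma le_cover_measure_gauge (h1 h2 : set 'rV[R]_n -> \bar R) X :
  (forall G, gauge0 h1 G <= gauge0 h2 G) -> (forall G, 0 <= h1 G) ->
  cover_measure h1 X <= cover_measure h2 X.
Proof.
move=> h12 h0; apply: le_ereal_inf_tmp => _ [S XS <-].
apply: le_trans (ereal_inf_lbound _) _; first by exists S.
by apply: lee_nneseries => [k _ _|k _]; [exact: gauge0_ge0|exact: h12].
Qed.

Lemma hausdorff_cover_le (delta delta' : R) X : (delta <= delta')%R ->
  cover_measure (hausdorff_gauge d delta') X <=
  cover_measure (@hausdorff_gauge R d n delta) X.
Proof.
move=> dd'; apply: le_cover_measure_gauge => G; last exact: hausdorff_gauge_ge0.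
rewrite /gauge0; case: asboolP => // _; rewrite /hausdorff_gauge.
have [Gd|_] := leP (diam G) delta%:E; last exact: leey.
by rewrite (le_trans Gd).
Qed.

Lemma hausdorff_cover_le_outer (delta : R) X : (0 < delta)%R ->
  cover_measure (@hausdorff_gauge R d n delta) X <= H X.
Proof. by move=> d0; apply: ereal_sup_ubound; exists delta. Qed.

(** Covering sets whose diameter is smaller than the gap between two slabs meet
    at most one of them. *)
Lemma hausdorff_separated (i : 'I_n) s t (A B : set 'rV[R]_n) : (s < t)%R ->
  A `<=` [set x : 'rV[R]_n | x ord0 i <= s]%R ->
  B `<=` [set x : 'rV[R]_n | t <= x ord0 i]%R ->
  H A + H B <= H (A `|` B).
Proof.
move=> st As Bt.
have HAB : H A <= H (A `|` B) by apply: le_hausdorff_outer => x; left.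
have HBB : H B <= H (A `|` B) by apply: le_hausdorff_outer => x; right.
have [/eqP ->|] := boolP (H (A `|` B) == +oo); first by rewrite leey.
rewrite -ltey => HABf.
have fin X : 0 <= X -> X <= H (A `|` B) -> X \is a fin_num.
  by move=> X0 XH; rewrite ge0_fin_numE// (le_lt_trans XH).
rewrite -leeBrDr ?(fin (H B)) ?hausdorff_outer_ge0//.
apply: ge_ereal_sup => _ [d1 /= d10 <-].
have cover_ge0 := cover_measure_ge0 (@hausdorff_gauge_ge0 R d n d1).
have d1f : cover_measure (hausdorff_gauge d d1) A \is a fin_num.
  by apply: fin => //; apply: le_trans HAB; exact: hausdorff_cover_le_outer.
rewrite leeBrDl ?(fin (H B)) ?hausdorff_outer_ge0// -leeBrDr//.
apply: ge_ereal_sup => _ [d2 /= d20 <-]; rewrite leeBrDr// addeC.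
pose d3 := (Num.min (Num.min d1 d2) ((t - s) / 2))%R.
have d30 : (0 < d3)%R by rewrite !lt_min d10 d20 divr_gt0// subr_gt0.
apply: le_trans (hausdorff_cover_le_outer _ d30).
apply: (@le_trans _ _ (cover_measure (hausdorff_gauge d d3) A +
                       cover_measure (hausdorff_gauge d d3) B)).
  by apply: leeD; apply: hausdorff_cover_le; rewrite /d3 !ge_min lexx ?orbT.
apply: cover_measureU_ge; first exact: hausdorff_gauge_ge0.
move=> F; have [->|/set0P[x [Fx Ax]]] := eqVneq (F `&` A) set0.
  by rewrite gauge0_set0 add0e le_hausdorff_gauge0.
have [->|/set0P[y [Fy By]]] := eqVneq (F `&` B) set0.
  by rewrite gauge0_set0 adde0 le_hausdorff_gauge0.
rewrite [leRHS]gauge0_neq0 /hausdorff_gauge; last by exists x.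
case: ifPn => [Fd|_]; last exact: leey.
suff : (t - s <= (t - s) / 2)%R by move=> h; exfalso; move: st h; lra.
have : (enorm (y - x)%R)%:E <= ((t - s) / 2)%:E.
  apply: le_trans (enorm_le_diam Fy Fx) _; apply: le_trans Fd _.
  by rewrite lee_fin /d3 ge_min lexx orbT.
rewrite lee_fin; apply: le_trans; apply: le_trans (entry_le_enorm _ 0%R i).
rewrite !mxE; apply: le_trans (ler_norm _); apply: lerB; first exact: Bt.
exact: As.
Qed.

Lemma hausdorff_measurable_coord (i : 'I_n) D :
  measurable_fun (D : set (Haus_space R d n)) (fun x => x ord0 i).
Proof.
apply: measurable_funTS => _.
apply: (measurability _ (RGenOInfty.measurableE R)) => //.
move=> _ [_ [c ->] <-]; rewrite setTI.
rewrite [X in measurable X](_ : _ = ~` [set x : 'rV[R]_n | x ord0 i <= c]%R); last first.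
  apply/seteqP; split => x; rewrite /= in_itv /= andbT ltNge; first by move/negP.
  by move=> h; apply/negP.
apply: measurableC; apply: caratheodory_criterion => s t A B.
exact: hausdorff_separated.
Qed.

End Hausdorff_measure.

Lemma open_entrywise (R : realType) k l (U S : set 'M[R]_(k, l)) : open U ->
  forall z, S z -> U z -> exists2 e : R, 0 < e &
    forall z', S z' -> (forall i j, `|z' i j - z i j| < e) -> U z'.
Proof.
move=> oU z _ Uz; have /nbhs_ballP[e e0 zU] := open_nbhs_nbhs (conj oU Uz).
by exists e => // z' _ zz'; apply: zU; split => // i j; rewrite /ball /= distrC.
Qed.

(** The coordinates are measurable for the two outer measures, hence so are open
    sets, as preimages of themselves under the identity. *)
Lemma lebesgue_measurable_open (R : realType) n (U : set 'rV[R]_n) :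
  open U -> measurable (U : set (Leb_space R n)).
Proof.
move=> oU; rewrite -[U]setTI.
have := @measurable_relatively_open_preimage _ (Leb_space R n) R setT 1 n (fun x => x)
  setT U measurableT; apply.
- by move=> i j; rewrite ord1; exact: lebesgue_measurable_coord.
- by [].
- exact: open_entrywise.
Qed.

Lemma hausdorff_measurable_open (R : realType) d n (U : set 'rV[R]_n) :
  open U -> measurable (U : set (Haus_space R d n)).
Proof.
move=> oU; rewrite -[U]setTI.
have := @measurable_relatively_open_preimage _ (Haus_space R d n) R setT 1 n (fun x => x)
  setT U measurableT; apply.
- by move=> i j; rewrite ord1; exact: hausdorff_measurable_coord.
- by [].
- exact: open_entrywise.
Qed.

(** * Traces, jump normals and jumps *)

Lemma le_cst_integral_overlap d (T : measurableType d) (R : realType)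
    (mu : {measure set T -> \bar R}) (S A B : set T) (c : R) (f g : T -> R) :
  measurable S -> measurable A -> measurable B -> S `<=` A -> S `<=` B ->
  (forall x, 0 <= f x) -> (forall x, 0 <= g x) ->
  measurable_fun A f -> measurable_fun B g -> 0 <= c ->
  (forall x, S x -> c <= f x + g x) ->
  (c%:E * mu S <= \int[mu]_(x in A) (f x)%:E + \int[mu]_(x in B) (g x)%:E)%E.
Proof.
move=> mS mA mB SA SB f0 g0 mf mg c0 cfg.
have mfS : measurable_fun S (EFin \o f).
  by apply/measurable_EFinP; exact: measurable_funS mf.
have mgS : measurable_fun S (EFin \o g).
  by apply/measurable_EFinP; exact: measurable_funS mg.
rewrite -integral_cst//.
apply: (@le_trans _ _ (\int[mu]_(x in S) ((f x)%:E + (g x)%:E))%E).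
  apply: ge0_le_integral => //; first exact: emeasurable_funD.
rewrite ge0_integralD//; do ?by move=> x _; rewrite lee_fin.
apply: leeD; apply: ge0_subset_integral => //; do ?by move=> x _; rewrite lee_fin.
  exact/measurable_EFinP.
exact/measurable_EFinP.
Qed.

Section Traces.
Context {R : realType}.
Variables n m : nat.
Local Notation Rn := 'rV[R]_n.+1.
Local Notation mu := (@leb R n.+1).
Implicit Types (Omega : set Rn) (u : Rn -> 'rV[R]_m) (x p q : Rn).

Let measurable_coordB x i :
  measurable_fun [set: Leb_space R n.+1] (fun y : Rn => (y - x) ord0 i).
Proof.
rewrite (_ : (fun y : Rn => (y - x) ord0 i) =
    (fun y : Leb_space R n.+1 => (y : Rn) ord0 i) \- cst (x ord0 i)).
  exact: (measurable_funB (@lebesgue_measurable_coord R n.+1 i setT)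
    (@measurable_cst _ _ _ _ _ _)).
by apply/funext => y; rewrite !mxE.
Qed.

Lemma measurable_eball x (r : R) : measurable (eball x r : set (Leb_space R n.+1)).
Proof.
rewrite -[eball x r]setTI.
have : measurable_fun [set: Leb_space R n.+1] (fun y : Rn => enorm (y - x)).
  by apply: measurable_enorm => i j; rewrite ord1; exact: measurable_coordB.
move=> /(_ measurableT `]-oo, r[%classic); rewrite preimage_itvNyo; apply.
exact: measurable_itv.
Qed.

Lemma measurable_half_ball x p (r : R) :
  measurable (half_ball x p r : set (Leb_space R n.+1)).
Proof.
apply: measurableI; first exact: measurable_eball.
rewrite -[X in measurable X]setTI.
have : measurable_fun [set: Leb_space R n.+1] (fun y : Rn => dot (y - x) p).
  apply: measurable_dot => i; first exact: measurable_coordB.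
  exact: (@measurable_cst _ _ _ _ _ (p ord0 i)).
move=> /(_ measurableT `]0, +oo[%classic); rewrite preimage_itvoy; apply.
exact: measurable_itv.
Qed.

Lemma eball_volume_le x (r : R) : 0 < r ->
  (mu (eball x r) <= ((2 * r) ^+ n.+1)%:E)%E.
Proof.
move=> r0.
have -> : (2 * r) ^+ n.+1 = \prod_(i < n.+1)
    ((x + const_mx r) ord0 i - (x - const_mx r) ord0 i).
  rewrite (eq_bigr (fun=> 2 * r)) ?prodr_const ?card_ord// => i _.
  by rewrite !mxE; ring.
apply: lebesgue_outer_le_box => [i|y yr i]; first by rewrite !mxE; move: r0; lra.
have := le_lt_trans (entry_le_enorm (y - x) ord0 i) yr.
by rewrite !mxE ltr_norml => /andP[h1 h2]; apply/andP; split; move: h1 h2; lra.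
Qed.

Lemma cube_sub_volume (X : set Rn) x (h : R) : 0 <= h ->
  (forall y, (forall i, `|(y - x) ord0 i| <= h) -> X y) ->
  (((2 * h) ^+ n.+1)%:E <= mu X)%E.
Proof.
move=> h0 cube.
have -> : (2 * h) ^+ n.+1 = \prod_(i < n.+1)
    ((x + const_mx h) ord0 i - (x - const_mx h) ord0 i).
  rewrite (eq_bigr (fun=> 2 * h)) ?prodr_const ?card_ord// => i _.
  by rewrite !mxE; ring.
apply: lebesgue_outer_ge_box => [i|y yh]; first by rewrite !mxE; move: h0; lra.
apply: cube => i; have := yh i; rewrite !mxE ler_norml => /andP[h1 h2].
by apply/andP; split; move: h1 h2; lra.
Qed.

(** Unless q = -p, the two half-balls contain a cube of size comparable to r,
    centred on the bisector p + q. *)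
Lemma half_ballI_volume p q : enorm p = 1 -> enorm q = 1 -> p + q <> 0 ->
  exists2 k : R, 0 < k & forall x r, 0 < r ->
    (((k * r) ^+ n.+1)%:E <= mu (half_ball x p r `&` half_ball x q r))%E.
Proof.
move=> p1 q1 pq0; pose tau : R := 1 + dot p q.
have pqE : enorm (p + q) ^+ 2 = 2 * tau.
  rewrite -dot_self dotDl ![dot _ (p + q)]dotC !dotDl !dot_self p1 q1 dotC.
  by rewrite /tau; ring.
have tau0 : 0 < tau.
  have : 0 < enorm (p + q) ^+ 2.
    rewrite exprn_gt0// lt_neqAle enorm_ge0 andbT eq_sym; apply/eqP => /enorm_eq0.
    exact: pq0.
  by rewrite pqE; lra.
pose s := Num.min (1 / 2) (tau / 4); pose N : R := (1 * n.+1)%:R.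
have N0 : 0 < N by rewrite ltr0n mul1n.
have s0 : 0 < s by rewrite lt_min; apply/andP; split; move: tau0; lra.
have s1 : s <= 1 / 2 by rewrite ge_min lexx.
have s2 : s <= tau / 4 by rewrite ge_min lexx orbT.
exists (s / N); first by rewrite divr_gt0.
move=> x r r0; pose h := r * s / (2 * N).
have -> : s / N * r = 2 * h.
  have Nn : N != 0 by rewrite gt_eqF.
  by rewrite /h; field.
pose c : Rn := x + (r / 4) *: (p + q).
have in_half v : enorm v = 1 -> dot (p + q) v = tau ->
    forall y : Rn, (forall i, `|(y - c) ord0 i| <= h) -> half_ball x v r y.
  move=> v1 pqv y yc.
  have ycE : enorm (y - c) <= r * s / 2.
    apply: le_trans (enorm_le_norm _) _.
    have -> : r * s / 2 = N * h.
      by rewrite /h; field.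
    rewrite ler_wpM2l ?(ltW N0)// [leLHS]/Num.norm /= mx_normrE.
    apply/bigmax_leP; split => [|[i j] _ /=]; last by rewrite ord1.
    by rewrite /h !mulr_ge0 ?(ltW r0) ?(ltW s0)// invr_ge0 mulr_ge0 ?(ltW N0).
  have -> : half_ball x v r y =
      (enorm ((y - c) + (r / 4) *: (p + q)) < r /\
       0 < dot ((y - c) + (r / 4) *: (p + q)) v).
    by rewrite /half_ball /eball /= /c opprD addrA subrK.
  split.
    apply: le_lt_trans (enormD _ _) _; rewrite enormZ ger0_norm; last by move: r0; lra.
    have pq2 : enorm (p + q) <= 2 by apply: le_trans (enormD _ _) _; rewrite p1 q1; lra.
    have h1 : r * s <= r * (1 / 2) by rewrite ler_pM2l.
    have h2 : r / 4 * enorm (p + q) <= r / 4 * 2 by rewrite ler_wpM2l//; move: r0; lra.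
    by move: h1 h2 ycE r0; lra.
  rewrite dotDl dotZl pqv.
  have h1 : - enorm (y - c) <= dot (y - c) v.
    have := dot_le_enorm (y - c) v.
    by rewrite v1 mulr1 ler_norml => /andP[].
  have h2 : r * s <= r * (tau / 4) by rewrite ler_pM2l.
  have h3 : 0 < r * tau by rewrite mulr_gt0.
  by move: h1 h2 h3 ycE; lra.
apply: (@cube_sub_volume _ c).
  by rewrite /h divr_ge0// ?mulr_ge0// ltW.
move=> y yc; split; apply: in_half => //.
  by rewrite dotDl dot_self p1 (dotC q) /tau; ring.
by rewrite dotDl dot_self q1 /tau; ring.
Qed.

Lemma enorm1_double p : enorm p = 1 -> p + p <> 0.
Proof.
move=> p1 /(congr1 (fun v : Rn => enorm v)); rewrite enorm0 -mulr2n -scaler_nat enormZ p1.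
by rewrite mulr1 ger0_norm// => /eqP; rewrite pnatr_eq0.
Qed.

(** Both volumes that occur below are comparable to a power of the radius, so the
    mean is turned back into an integral. *)
Lemma mean_lt (X : set Rn) (f : Rn -> R) (e v : R) : 0 < e ->
  measurable (X : set (Leb_space R n.+1)) ->
  (forall y, 0 <= f y) -> (0 < mu X)%E -> (mu X <= v%:E)%E ->
  (mean X f < e%:E)%E -> (\int[mu]_(y in X) (f y)%:E <= (e * v)%:E)%E.
Proof.
move=> e0 mX f0 X0 Xv; rewrite /mean.
have Xf : mu X \is a fin_num.
  by rewrite ge0_fin_numE ?measure_ge0// (le_lt_trans Xv) ?ltry.
have X0' : 0 < fine (mu X) by rewrite -lte_fin fineK.
have I0 : (0 <= \int[mu]_(y in X) (f y)%:E)%E.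
  by apply: integral_ge0 => y _; rewrite lee_fin.
have [If|] := boolP (\int[mu]_(y in X) (f y)%:E \is a fin_num)%E; last first.
  rewrite ge0_fin_numE// -leNgt leye_eq => /eqP ->.
  by rewrite gt0_muley// lte_fin invr_gt0.
rewrite -(fineK If) -EFinM lte_fin lee_fin mulrC ltr_pdivrMr// => /ltW h.
apply: le_trans h _; rewrite ler_pM2l//.
by rewrite -lee_fin fineK.
Qed.

(** The overlap of the two half-balls occupies a fixed fraction of each.  Hence
    the mean of |a - b| over the overlap is at most a constant times the sum of the
    means of |u - a| and |u - b| over the half-balls, which tend to 0. *)
Lemma trace_overlap Omega u x p q a b : open Omega -> Omega x ->
  (forall i j, measurable_fun (Omega : set (Leb_space R n.+1)) (fun y => u y i j)) ->
  enorm p = 1 -> enorm q = 1 -> p + q <> 0 ->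
  is_trace u x p a -> is_trace u x q b -> a = b.
Proof.
move=> oO Ox mu_ p1 q1 pq0 ta tb.
have [k k0 Hk] := half_ballI_volume p1 q1 pq0.
apply/eqP; rewrite -subr_eq0; apply/negPn/negP => ab.
have D0 : 0 < enorm (a - b).
  rewrite lt_neqAle enorm_ge0 andbT eq_sym; apply: contra ab => /eqP.
  by move/enorm_eq0 ->.
(* With this e the two integrals add up to at most half of the lower bound for
   the integral of |a - b| over the overlap. *)
pose e := enorm (a - b) * (k / 2) ^+ n.+1 / 4.
have e0 : 0 < e by rewrite /e !mulr_gt0// exprn_gt0// divr_gt0.
have ev v z : is_trace u x v z -> \forall r \near 0^'+,
    (mean (half_ball x v r) (fun y => enorm (u y - z)) < e%:E)%E.
  move=> /(_ [set w | (w < e%:E)%E]); apply.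
  by apply: open_ereal_lt'; rewrite lte_fin.
have evO : \forall r \near 0^'+, eball x r `<=` Omega.
  have /nbhs_ballP[d d0 dO] := open_nbhs_nbhs (conj oO Ox).
  near=> r => y yr; apply: dO; rewrite -ball_normE /= distrC.
  apply: le_lt_trans (norm_le_enorm _) _; apply: lt_trans yr _.
  by near: r; exact: nbhs_right_lt.
suff : \forall r \near (0:R)^'+, False by move=> /filter_ex[].
near=> r.
have r0 : 0 < r by near: r; exact: nbhs_right_gt.
have rO : eball x r `<=` Omega by near: r.
have half_pos v : enorm v = 1 -> (0 < mu (half_ball x v r))%E.
  move=> v1; have vv := enorm1_double v1.
  have [k' k'0 /(_ x r r0)] := half_ballI_volume v1 v1 vv.
  by rewrite setIid; apply: lt_le_trans; rewrite lte_fin exprn_gt0// mulr_gt0.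
have bound v z : enorm v = 1 ->
    (mean (half_ball x v r) (fun y => enorm (u y - z)) < e%:E)%E ->
    (\int[mu]_(y in half_ball x v r) (enorm (u y - z))%:E <= (e * (2 * r) ^+ n.+1)%:E)%E.
  move=> v1; apply: mean_lt => //.
  - exact: measurable_half_ball.
  - by move=> y; exact: enorm_ge0.
  - exact: half_pos.
  - apply: le_trans (eball_volume_le x r0).
    by apply: (le_outer_measure (@lebesgue_outer R n.+1)) => y [].
have Ia : (\int[mu]_(y in half_ball x p r) (enorm (u y - a))%:E <= (e * (2 * r) ^+ n.+1)%:E)%E.
  by apply: bound => //; near: r; exact: ev.
have Ib : (\int[mu]_(y in half_ball x q r) (enorm (u y - b))%:E <= (e * (2 * r) ^+ n.+1)%:E)%E.
  by apply: bound => //; near: r; exact: ev.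
pose S := half_ball x p r `&` half_ball x q r.
have mS : measurable (S : set (Leb_space R n.+1)).
  by apply: measurableI; exact: measurable_half_ball.
have mdist z (X : set (Leb_space R n.+1)) : X `<=` Omega ->
    measurable_fun X (fun y => enorm (u y - z)).
  move=> XO.
  apply: (measurable_funS (lebesgue_measurable_open oO) XO).
  apply: measurable_enorm => i j; under eq_fun do rewrite !mxE.
  by apply: measurable_funB => //; exact: mu_.
have : ((enorm (a - b) * (k * r) ^+ n.+1)%:E <= (2 * (e * (2 * r) ^+ n.+1))%:E)%E.
  apply: (@le_trans _ _ ((enorm (a - b))%:E * mu S)%E).
    by rewrite EFinM lee_wpmul2l ?lee_fin ?enorm_ge0//; exact: Hk.
  rewrite mulr_natl mulr2n EFinD; apply: le_trans (leeD Ia Ib).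
  apply: (@le_cst_integral_overlap _ _ R mu S _ _ _
    (fun y => enorm (u y - a)) (fun y => enorm (u y - b))).
  - exact: mS.
  - exact: measurable_half_ball.
  - exact: measurable_half_ball.
  - by move=> y [].
  - by move=> y [].
  - by move=> y; exact: enorm_ge0.
  - by move=> y; exact: enorm_ge0.
  - by apply: mdist; move=> y [/rO].
  - by apply: mdist; move=> y [/rO].
  - exact: enorm_ge0.
  - by move=> y _; rewrite -(enormN (u y - a)) opprB; exact: enormB_triangle.
rewrite lee_fin /e.
have -> : 2 * (enorm (a - b) * (k / 2) ^+ n.+1 / 4 * (2 * r) ^+ n.+1) =
    enorm (a - b) * (k * r) ^+ n.+1 / 2.
  have -> : k * r = (k / 2) * (2 * r) by field.
  by rewrite [in RHS]exprMn; field.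
have : 0 < enorm (a - b) * (k * r) ^+ n.+1.
  by rewrite mulr_gt0// exprn_gt0// mulr_gt0.
by lra.
Unshelve. all: by end_near. Qed.

Section Jump_normals.
Variables (Omega : set Rn) (u : Rn -> 'rV[R]_m) (x : Rn).
Hypotheses (oO : open Omega) (Ox : Omega x).
Hypothesis mu_meas :
  forall i j, measurable_fun (Omega : set (Leb_space R n.+1)) (fun y => u y i j).

Lemma is_trace_unique p a b : enorm p = 1 ->
  is_trace u x p a -> is_trace u x p b -> a = b.
Proof.
by move=> p1; exact: (trace_overlap oO Ox mu_meas p1 p1 (enorm1_double p1)).
Qed.

Lemma traceE p a : enorm p = 1 -> is_trace u x p a -> trace u x p = a.
Proof.
move=> p1 ta; apply: xget_unique => //= b tb.
exact: is_trace_unique tb ta.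
Qed.

(** If q were neither p nor -p, its half-ball would overlap those of both p and
    -p, and the trace on the side of q would equal both traces along p. *)
Lemma jump_normal_unique p q :
  is_jump_normal u x p -> is_jump_normal u x q -> q = p \/ q = - p.
Proof.
move=> [p1 [a [b [ab ta tb]]]] [q1 [a' [b' [_ ta' _]]]].
have [pq|/eqP pq] := eqVneq q p; [by left|right].
have [//|/eqP pq'] := eqVneq q (- p).
have np1 : enorm (- p) = 1 by rewrite enormN.
case: ab; have -> : a = a'.
  apply: (trace_overlap oO Ox mu_meas p1 q1 _ ta ta') => pq0.
  by apply: pq'; apply/eqP; rewrite -addr_eq0 addrC pq0.
apply: (trace_overlap oO Ox mu_meas q1 np1 _ ta' tb) => pq0.
by apply: pq; apply/eqP; rewrite -subr_eq0 pq0.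
Qed.

End Jump_normals.
End Traces.

Lemma measurable_support d (T : measurableType d) (R : realType) k
    (v : T -> 'rV[R]_k) :
  (forall i, measurable_fun [set: T] (fun x => v x ord0 i)) ->
  measurable [set x | v x <> 0].
Proof.
move=> mv.
have mn : measurable_fun [set: T] (fun x => enorm (v x)).
  by apply: measurable_enorm => i j; rewrite ord1.
have -> : [set x | v x <> 0] = setT `&` (fun x => enorm (v x)) @^-1` (~` [set 0]).
  rewrite setTI; apply/seteqP; split => x /= vx; apply: contra_not vx.
    exact: enorm_eq0.
  by move=> ->; rewrite enorm0.
by apply: mn => //; apply: measurableC.
Qed.

(** As |v| = 1 on J, the function f is the sum over i of (f * v_i) * v_i. *)
Lemma measurable_unit_factor d (T : measurableType d) (R : realType) k
    (J : set T) (f : T -> R) (v : T -> 'rV[R]_k) :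
  measurable J -> (forall i, measurable_fun J (fun x => f x * v x ord0 i)) ->
  (forall i, measurable_fun [set: T] (fun x => v x ord0 i)) ->
  (forall x, J x -> enorm (v x) = 1) -> (forall x, ~ J x -> f x = 0) ->
  measurable_fun [set: T] f.
Proof.
move=> mJ mfv mv v1 f0.
have -> : f = (fun x => \sum_i (f x * v x ord0 i) * v x ord0 i) \_ J.
  apply/funext => x; rewrite patchE; case: ifPn => [|/negP]; rewrite inE => Jx.
    transitivity (f x * enorm (v x) ^+ 2); first by rewrite v1// expr1n mulr1.
    rewrite -dot_self mulr_sumr; apply: eq_bigr => i _.
    by rewrite mulrA.
  exact: f0.
apply/(measurable_restrictT _ _).1 => //.
apply: measurable_sum => i; apply: measurable_funM => //.
exact: measurable_funTS.
Qed.

Section Jumps.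
Context {R : realType}.
Variables n m : nat.
Local Notation Rn := 'rV[R]_n.+1.
Local Notation Hs := (Haus_space R n n.+1).
Variables (Omega : set Rn) (u : Rn -> 'rV[R]_m).
Hypotheses (oO : open Omega) (uL1 : Lp Omega 1 u).

Lemma jump_set_orientation nu : is_orientation Omega u nu ->
  jump_set Omega u = [set x | nu x <> 0].
Proof.
move=> [_ nuJ nu0]; apply/seteqP; split => x /=.
  move=> /nuJ [nu1 _] nux; move: nu1; rewrite nux enorm0 => /eqP.
  by rewrite eq_sym oner_eq0.
by move=> nux; apply: contrapT => /nu0.
Qed.

Lemma measurable_jump_set nu : is_orientation Omega u nu ->
  measurable (jump_set Omega u : set Hs).
Proof.
move=> onu; rewrite (jump_set_orientation onu).
by case: onu => mnu _ _; exact: (@measurable_support _ Hs R n.+1 nu mnu).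
Qed.

Lemma jump_neq0 nu x : is_orientation Omega u nu -> jump_set Omega u x ->
  jump Omega u nu x <> 0.
Proof.
move=> [_ nuJ _] Jx; have [nu1 [a [b [ab ta tb]]]] := nuJ x Jx.
rewrite /jump asboolT//; have Ox := Jx.1.
rewrite (traceE oO Ox uL1.1 nu1 ta) (traceE oO Ox uL1.1 _ tb) ?enormN//.
by move/eqP; rewrite subr_eq0 => /eqP.
Qed.

(** The two normals at x agree or are opposite, and in the second case the two
    traces are exchanged. *)
Lemma jump_orientation nu nu' x :
  is_orientation Omega u nu -> is_orientation Omega u nu' ->
  (nu' x = nu x /\ jump Omega u nu' x = jump Omega u nu x) \/
  (nu' x = - nu x /\ jump Omega u nu' x = - jump Omega u nu x).
Proof.
move=> [_ nuJ nu0] [_ nuJ' nu0']; rewrite /jump.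
have [Jx|Jx] := pselect (jump_set Omega u x); last first.
  by left; rewrite (nu0 x Jx) (nu0' x Jx) asboolF.
have [E|E] := jump_normal_unique oO Jx.1 uL1.1 (nuJ x Jx) (nuJ' x Jx).
  by left; rewrite E.
by right; rewrite asboolT// E !opprK opprB.
Qed.

Lemma jump_off nu x : ~ jump_set Omega u x -> jump Omega u nu x = 0.
Proof. by move=> Jx; rewrite /jump asboolF. Qed.

End Jumps.

(** The integrability that SBV requires makes the products of the components of
    the jump and of the normal measurable for one orientation.  These products do
    not depend on the orientation, and they determine the jump since the normal
    has unit length. *)
Lemma measurable_jump {R : realType} n m (Omega : set 'rV[R]_n.+1)
    (u : 'rV[R]_n.+1 -> 'rV[R]_m) nu a :
  open Omega -> SBV Omega u -> is_orientation Omega u nu ->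
  measurable_fun [set: Haus_space R n n.+1] (fun x => jump Omega u nu x ord0 a).
Proof.
move=> oO [uL1 [Du _ [nu' onu' H]]] onu.
have mJ := measurable_jump_set onu.
apply: (@measurable_unit_factor _ (Haus_space R n n.+1) R n.+1
  (jump_set Omega u) (fun x => jump Omega u nu x ord0 a) nu mJ).
- move=> i; have [_ /integrableP[mji _] _] := H a i.
  have -> : (fun x => jump Omega u nu x ord0 a * nu x ord0 i) =
      (fun x => jump Omega u nu' x ord0 a * nu' x ord0 i).
    apply/funext => x; have [[-> ->]//|[-> ->]] := jump_orientation oO uL1 x onu onu'.
    by rewrite !mxE mulrNN.
  by apply/measurable_EFinP; exact: mji.
- by case: onu.
- by move=> x Jx; have [_ /(_ x Jx)[]] := onu.
- by move=> x Jx; rewrite jump_off// mxE.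
Qed.

(** * Change of variables and translations *)

(** The image measure of mu under phi is compared with a multiple of nu; the
    inequality between measures passes to integrals. *)
Section Change_of_variables.
Context d1 d2 (X : measurableType d1) (Y : measurableType d2) (R : realType).
Variables (phi : X -> Y) (mphi : measurable_fun [set: X] phi).
Variables (mu : {measure set X -> \bar R}) (nu : {measure set Y -> \bar R}).
Variables (c : R) (c0 : 0 <= c).
Variables (f : Y -> \bar R) (f0 : forall y, (0 <= f y)%E).
Hypothesis mf : measurable_fun [set: Y] f.
Let mphi_mixin := isMeasurableFun.Build _ _ _ _ _ mphi.
Let mphi_pack : {mfun _ >-> _} := HB.pack phi mphi_mixin.

Let pushforwardE D : measurable D ->
  (\int[pushforward mu mphi_pack]_(y in D) f y =
   \int[mu]_(x in phi @^-1` D) (f (phi x)))%E.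
Proof.
move=> mD; apply: (ge0_integral_pushforward mphi) => //.
exact: measurable_funTS.
Qed.

Let mscaleE D : measurable D ->
  (\int[mscale (NngNum c0) nu]_(y in D) f y = c%:E * \int[nu]_(y in D) f y)%E.
Proof.
move=> mD; rewrite (ge0_integral_mscale nu mD (NngNum c0))//.
exact: measurable_funTS.
Qed.

Lemma le_integral_preimage D : measurable D ->
  (forall E, measurable E -> (mu (phi @^-1` E) <= c%:E * nu E)%E) ->
  (\int[mu]_(x in phi @^-1` D) f (phi x) <= c%:E * \int[nu]_(y in D) f y)%E.
Proof.
by move=> mD le; rewrite -pushforwardE// -mscaleE//; exact: ge0_le_measure_integral.
Qed.

Lemma ge_integral_preimage D : measurable D ->
  (forall E, measurable E -> (c%:E * nu E <= mu (phi @^-1` E))%E) ->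
  (c%:E * \int[nu]_(y in D) f y <= \int[mu]_(x in phi @^-1` D) f (phi x))%E.
Proof.
by move=> mD le; rewrite -pushforwardE// -mscaleE//; exact: ge0_le_measure_integral.
Qed.

End Change_of_variables.

Lemma integral_bounded_cvg0 d (T : measurableType d) (R : realType)
    (mu : {measure set T -> \bar R}) D (Q : nat -> T -> R) (K : R) :
  measurable D -> (mu D < +oo)%E ->
  (forall k, measurable_fun D (Q k)) -> (forall k x, 0 <= Q k x <= K) ->
  {ae mu, forall x, D x -> Q k x @[k --> \oo] --> 0} ->
  (\int[mu]_(x in D) (Q k x)%:E @[k --> \oo] --> 0)%E.
Proof.
move=> mD Dfin mQ Q0 Qcvg.
have K0 : 0 <= K by have /andP[h /(le_trans h)] := Q0 0%N point.
have [] := @dominated_convergence _ T R mu D mD (fun k x => (Q k x)%:E) (cst 0%E)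
  (cst K%:E) _ _ _ _ _.
- by move=> k; exact/measurable_EFinP.
- exact: measurable_cst.
- apply: filterS Qcvg => x h Dx; apply: cvg_EFin; first exact: nearW.
  exact: h.
- apply/integrableP; split; first exact: measurable_cst.
  rewrite (eq_integral (cst K%:E)); last by move=> x _; rewrite /= ger0_norm.
  by rewrite integral_cst// lte_mul_pinfty// lee_fin.
- apply/aeW => x k _ /=; have /andP[h1 h2] := Q0 k x.
  by rewrite lee_fin ger0_norm.
by move=> _ _; rewrite integral0.
Qed.

Section Translations.
Context {R : realType}.
Variable n : nat.
Local Notation Rn := 'rV[R]_n.
Local Open Scope ereal_scope.

Let shift (v x : Rn) := (x + v)%R.

Let lebesgue_outer_shift_le (v : Rn) (X : set Rn) :
  lebesgue_outer (shift v @^-1` X) <= lebesgue_outer X.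
Proof.
apply: le_ereal_inf_tmp => _ [F XF <-].
apply: le_trans (ereal_inf_lbound _) _.
  by exists (fun k => shift v @^-1` (F k)) => // x /XF[k _ Fk]; exists k.
apply: lee_nneseries => [k _ _|k _].
  by apply: gauge0_ge0; exact: box_gauge_ge0.
have [->|/set0P F0] := eqVneq (F k) set0.
  by rewrite preimage_set0.
rewrite !gauge0_neq0//; last first.
  by case: F0 => x Fx; exists (x - v)%R; rewrite /shift /= subrK.
apply: le_ereal_inf_tmp => _ [a [b [ab Fab ->]]].
apply: ereal_inf_lbound; exists (a - v)%R, (b - v)%R; split.
- by move=> i; rewrite !mxE lerD2r.
- by move=> x /Fab xab i; have := xab i; rewrite !mxE lerBlDr lerBrDr.
- by congr (_%:E); apply: eq_bigr => i _; rewrite !mxE; ring.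
Qed.

Lemma lebesgue_outer_shift (v : Rn) (X : set Rn) :
  lebesgue_outer ((fun x => x + v)%R @^-1` X) = lebesgue_outer X.
Proof.
apply/eqP; rewrite eq_le lebesgue_outer_shift_le /=.
have := lebesgue_outer_shift_le (- v)%R ((fun x => x + v)%R @^-1` X).
suff -> : shift (- v)%R @^-1` ((fun x => x + v)%R @^-1` X) = X by [].
by apply/seteqP; split => x /=; rewrite /shift subrK.
Qed.

Lemma lebesgue_measurable_shift (v : Rn) :
  measurable_fun [set: Leb_space R n] (fun x => (x + v)%R : Leb_space R n).
Proof.
move=> _ E mE; rewrite setTI.
change ((@lebesgue_outer R n).-caratheodory ((fun x : Rn => x + v)%R @^-1` E)).
have {}mE : (@lebesgue_outer R n).-caratheodory E := mE.
move=> X.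
have -> : X = (fun x => x + v)%R @^-1` ((fun x => x - v)%R @^-1` X).
  by apply/seteqP; split => x /=; rewrite addrK.
set Y := (fun x => x - v)%R @^-1` X.
have := mE Y; rewrite -(lebesgue_outer_shift v Y).
rewrite -(lebesgue_outer_shift v (Y `&` E)).
by rewrite -(lebesgue_outer_shift v (Y `&` ~` E)).
Qed.

Lemma integral_shift_le (v : Rn) (A B : set (Leb_space R n)) (Q : Leb_space R n -> R) :
  measurable A -> measurable B -> (forall x, 0 <= Q x)%R ->
  measurable_fun [set: Leb_space R n] Q ->
  (forall x : Rn, A x -> B (x + v)%R) ->
  \int[leb n]_(x in A) (Q (x + v)%R)%:E <= \int[leb n]_(x in B) (Q x)%:E.
Proof.
move=> mA mB Q0 mQ AB.
have mv := lebesgue_measurable_shift v.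
have mQE : measurable_fun [set: Leb_space R n] (EFin \o Q) by exact/measurable_EFinP.
have mvB : measurable ((fun x : Leb_space R n => (x + v)%R : Leb_space R n) @^-1` B).
  by have := mv measurableT B mB; rewrite setTI.
apply: (@le_trans _ _ (\int[leb n]_(x in
    (fun x : Leb_space R n => (x + v)%R : Leb_space R n) @^-1` B) (Q (x + v)%R)%:E)).
  have mQv := measurableT_comp mQE mv.
  refine (@ge0_subset_integral _ _ _ (leb n) A _ mA mvB
    (fun x => (Q (x + v)%R)%:E) (measurable_funTS mQv) _ AB).
  by move=> x _; rewrite lee_fin Q0.
rewrite -[leRHS]mul1e.
apply: (le_integral_preimage mv (@ler01 R) _ mQE mB).
  by move=> x; rewrite lee_fin Q0.
by move=> E mE; rewrite mul1e; exact: lebesgue_outer_shift_le.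
Qed.

End Translations.

(** * Maps with a small derivative almost everywhere *)

Lemma le_integral_average d (T : measurableType d) (R : realType)
    (mu : {measure set T -> \bar R}) (N : nat) (s c : R) (B : set T)
    (f : 'I_N -> T -> R) (I : \bar R) :
  measurable B -> N%:R * s = 1 -> 0 <= c -> (forall i x, 0 <= f i x) ->
  (forall i, measurable_fun B (f i)) ->
  (forall i, (\int[mu]_(x in B) (f i x)%:E <= I)%E) ->
  (forall x, B x -> c <= s * \sum_(i < N) f i x) ->
  (c%:E * mu B <= I)%E.
Proof.
move=> mB Ns c0 f0 mf fI cf.
have s0 : 0 <= s.
  rewrite -(pmulr_rge0 _ (_ : 0 < N%:R)) ?Ns//.
  by rewrite ltr0n lt0n; apply/eqP => N0; move: Ns; rewrite N0 mul0r => /eqP;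
    rewrite eq_sym oner_eq0.
have mfE i : measurable_fun B (EFin \o f i) by exact/measurable_EFinP.
rewrite -integral_cst//.
apply: (@le_trans _ _ (\int[mu]_(x in B) (s%:E * \sum_(i < N) (f i x)%:E))%E).
  apply: ge0_le_integral => //.
  - by apply: measurable_funeM; exact: emeasurable_sum.
  - by move=> x Bx; rewrite sumEFin -EFinM lee_fin cf.
rewrite ge0_integralZl//; last 2 first.
- exact: emeasurable_sum.
- by move=> x _; apply: sume_ge0 => i _; rewrite lee_fin.
rewrite ge0_integral_sum//; last by move=> i x _; rewrite lee_fin.
apply: (@le_trans _ _ (s%:E * \sum_(i < N) I)%E).
  by apply: lee_wpmul2l; [rewrite lee_fin|apply: lee_sum].
have -> : (\sum_(i < N) I = N%:R%:E * I)%E.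
  elim: (N) => [|k IH]; first by rewrite big_ord0 mul0e.
  rewrite big_ord_recr /= IH -natr1 EFinD ge0_muleDl ?mul1e// lee_fin//.
by rewrite muleA -EFinM mulrC Ns mul1e.
Qed.

Section Almost_everywhere_derivative.
Context {R : realType}.
Variable n : nat.
Local Notation Rn := 'rV[R]_n.+1.
Local Notation mu := (@leb R n.+1).

Lemma lipschitz_continuous (V : normedModType R) (F : Rn -> V) (K : R) :
  (forall x y, `|F x - F y| <= K * enorm (x - y)) -> continuous F.
Proof.
move=> FK x B /nbhs_ballP[e /= e0 Be].
pose K' := `|K| + 1; pose N : R := (1 * n.+1)%:R.
have K'0 : 0 < K' by rewrite ltr_wpDl.
have N0 : 0 < N by rewrite ltr0n.
apply/nbhs_ballP; exists (e / (K' * N)); first by rewrite /= divr_gt0// mulr_gt0.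
move=> y; rewrite -ball_normE /= => xy; apply: Be; rewrite -ball_normE /=.
apply: le_lt_trans (FK _ _) _.
apply: (@le_lt_trans _ _ (K' * (N * `|x - y|))).
  apply: (@le_trans _ _ (K' * enorm (x - y))).
    by rewrite ler_wpM2r ?enorm_ge0// (le_trans (ler_norm K))// lerDl.
  by rewrite ler_wpM2l ?(ltW K'0)// enorm_le_norm.
by rewrite mulrA mulrC -ltr_pdivlMr// mulr_gt0.
Qed.

Variables (Phi : Rn -> Rn) (C e : R).
Hypotheses (C0 : 0 <= C) (e0 : 0 <= e).
Hypothesis PhiC : forall x y, enorm (Phi x - Phi y) <= C * enorm (x - y).
Hypothesis dPhi : {ae mu, forall x,
  differentiable Phi x /\ enorm ('J Phi x - 1%:M) <= e}.

Let h x := Phi x - x.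
Let C1 := C + 1.

Let C1_ge0 : 0 <= C1. Proof. by rewrite addr_ge0. Qed.

Let h_lip x y : enorm (h x - h y) <= C1 * enorm (x - y).
Proof.
have -> : h x - h y = (Phi x - Phi y) + (y - x).
  by apply/matrixP => i j; rewrite !mxE; ring.
apply: le_trans (enormD _ _) _; rewrite (enormB_sym y x) mulrDl mul1r lerD2r.
exact: PhiC.
Qed.

Variable v : Rn.
Let s (k : nat) : R := k.+1%:R^-1.
Let s_gt0 k : 0 < s k. Proof. by rewrite invr_gt0. Qed.

(** Excess of the difference quotient of h in the direction v over e |v|, the
    bound that the derivative satisfies almost everywhere. *)
Let Q k (x : Rn) : R :=
  Num.max 0 (enorm (h (x + s k *: v) - h x) / s k - e * enorm v).

Let Q_ge0 k x : 0 <= Q k x. Proof. by rewrite le_max lexx. Qed.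

Let Q_le k x : Q k x <= C1 * enorm v.
Proof.
rewrite ge_max mulr_ge0 ?enorm_ge0//=.
rewrite lerBlDr; apply: (@le_trans _ _ (C1 * enorm v)); last first.
  by rewrite lerDl mulr_ge0 ?enorm_ge0.
rewrite ler_pdivrMr//; apply: le_trans (h_lip _ _) _.
by rewrite addrC addKr enormZ gtr0_norm// mulrCA mulrC.
Qed.

Let Q_cont k : continuous (Q k).
Proof.
have max_lip (a b : R) : `|Num.max 0 a - Num.max 0 b| <= `|a - b|.
  have := ler_norm (a - b); have := ler_norm (b - a); rewrite (distrC b a).
  by case: (leP 0 a); case: (leP 0 b) => ? ? ? ?; rewrite ler_norml;
    apply/andP; split; lra.
apply: (@lipschitz_continuous _ _ (2 * C1 / s k)) => x y.
apply: le_trans (max_lip _ _) _.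
  have -> : enorm (h (x + s k *: v) - h x) / s k - e * enorm v -
      (enorm (h (y + s k *: v) - h y) / s k - e * enorm v) =
      (enorm (h (x + s k *: v) - h x) - enorm (h (y + s k *: v) - h y)) / s k by ring.
  rewrite normrM [`|(s k)^-1|]gtr0_norm ?invr_gt0// mulrAC ler_pM2r ?invr_gt0//.
  have tri (a b c d : Rn) : `|enorm (a - b) - enorm (c - d)| <= enorm (a - c) + enorm (b - d).
    have aux (a' b' c' d' : Rn) : enorm (a' - b') - enorm (c' - d') <= enorm (a' - c') + enorm (b' - d').
      rewrite lerBlDr; apply: le_trans (enormB_triangle _ c' _) _.
      rewrite -addrA lerD2l; apply: le_trans (enormB_triangle _ d' _) _.
      by rewrite (enormB_sym d' b') [leLHS]addrC.
    rewrite ler_norml; apply/andP; split; last exact: aux.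
    by rewrite lerNl opprB (enormB_sym a c) (enormB_sym b d); exact: aux.
  apply: le_trans (tri _ _ _ _) _.
  rewrite mulrDl mul1r mulrDl; apply: lerD; last exact: h_lip.
  apply: le_trans (h_lip _ _) _.
  suff -> : x + s k *: v - (y + s k *: v) = x - y by [].
  by apply/matrixP => i j; rewrite !mxE; ring.
Qed.

Let Q_meas k : measurable_fun [set: Leb_space R n.+1] (Q k).
Proof.
apply: (@measurable_continuous_comp _ (Leb_space R n.+1) R setT 1 n.+1 (Q k)
  (fun x => x) (@Q_cont k)).
by move=> i j; rewrite ord1; exact: lebesgue_measurable_coord.
Qed.

Let s_cvg : s k @[k --> \oo] --> (0 : R)^'.
Proof.
move=> A A0.
have near_s : \forall k \near \oo, s k != 0 -> A (s k) := @cvg_harmonic R _ A0.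
suff : \forall k \near \oo, A (s k) by [].
by apply: filterS near_s => k; apply; exact: lt0r_neq0.
Qed.

(** Phi - id has derivative v *m ('J Phi x - 1) in the direction v. *)
Let Q_cvg0 x : differentiable Phi x -> enorm ('J Phi x - 1%:M) <= e ->
  Q k x @[k --> \oo] --> 0.
Proof.
move=> dx Je; apply/cvgrPdist_le => eps eps0.
have : (s k)^-1 *: (Phi (s k *: v + x) - Phi x) @[k --> \oo] --> 'D_v Phi x.
  have dv : derivable Phi x v by exact: diff_derivable.
  exact: (cvg_comp _ _ s_cvg dv).
rewrite deriveEjacobian// => /cvgrPdist_le.
pose N : R := (1 * n.+1)%:R; have N0 : 0 < N by rewrite ltr0n.
move=> /(_ (eps / N)) /(_ (divr_gt0 eps0 N0)) near_lim.
near=> k.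
rewrite sub0r normrN ger0_norm// /Q ge_max (ltW eps0) lerBlDr /=.
have -> : enorm (h (x + s k *: v) - h x) / s k =
    enorm ((s k)^-1 *: (Phi (s k *: v + x) - Phi x) - v *m 'J Phi x +
           v *m ('J Phi x - 1%:M)).
  rewrite mulmxBr mulmx1 addrA subrK.
  transitivity (`|(s k)^-1| * enorm (h (x + s k *: v) - h x)).
    by rewrite gtr0_norm ?invr_gt0// mulrC.
  rewrite -enormZ; congr enorm.
  by apply/matrixP => i j; rewrite /h [s k *: v + x]addrC !mxE; field; rewrite gt_eqF.
apply: le_trans (enormD _ _) _; apply: lerD.
  apply: le_trans (enorm_le_norm _) _.
  rewrite -ler_pdivlMl// mulrC distrC.
  by near: k.
by apply: le_trans (enorm_mulmx _ _) _; rewrite mulrC ler_wpM2r ?enorm_ge0.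
Unshelve. all: by end_near. Qed.

(** Telescoping along the k.+1 equal parts of the segment from x to x + v. *)
Let increment_le k x : enorm (h (x + v) - h x) - e * enorm v <=
  s k * \sum_(i < k.+1) Q k (x + (i%:R * s k) *: v).
Proof.
have ks : k.+1%:R * s k = 1 by rewrite mulfV ?pnatr_eq0.
have path N : enorm (h (x + (N%:R * s k) *: v) - h x) <=
    s k * \sum_(i < N) (e * enorm v + Q k (x + (i%:R * s k) *: v)).
  elim: N => [|N IH].
    by rewrite mul0r scale0r addr0 subrr enorm0 big_ord0 mulr0.
  rewrite big_ord_recr /= mulrDr.
  apply: le_trans (enormB_triangle _ (h (x + (N%:R * s k) *: v)) _) _.
  rewrite addrC; apply: lerD => //.
  rewrite -ler_pdivrMl// mulrC -lerBlDl.
  have -> : x + (N.+1%:R * s k) *: v = x + (N%:R * s k) *: v + s k *: v.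
    by rewrite -natr1 mulrDl mul1r scalerDl addrA.
  by rewrite /Q le_max lexx orbT.
have := path k.+1; rewrite ks scale1r big_split /= sumr_const card_ord mulrDr.
by rewrite -mulr_natl mulrA (mulrC (s k)) ks mul1r -lerBlDl.
Qed.

Let integral_Q_cvg0 (D : set (Leb_space R n.+1)) : measurable D ->
  (mu D < +oo)%E -> (\int[mu]_(x in D) (Q k x)%:E @[k --> \oo] --> 0)%E.
Proof.
move=> mD Dfin.
apply: (@integral_bounded_cvg0 _ (Leb_space R n.+1) R mu D Q (C1 * enorm v) mD Dfin).
- by move=> k; exact: (measurable_funTS (@Q_meas k)).
- by move=> k x; rewrite Q_ge0 Q_le.
- case: dPhi => N [mN N0 subN]; exists N; split=> // x nx; apply: subN => dJx.
  by apply: nx => _; case: dJx; exact: Q_cvg0.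
Qed.

(** The derivative is controlled only almost everywhere, and a given segment may
    lie in the exceptional set.  The increment is therefore averaged over the
    base points y of a small ball.  The telescoped excesses are translates of Q k,
    so by translation invariance their average is at most the integral of Q k over
    a larger ball, which tends to 0 by dominated convergence: Q k is bounded by
    the Lipschitz constant and tends to 0 almost everywhere. *)
Lemma ae_derivative_increment_le x : enorm (h (x + v) - h x) <= e * enorm v.
Proof.
apply/ler_addgt0Pr => eta eta0.
(* Moving the base point by at most r changes the increment by at most
   eta / 2. *)
pose r := eta / (4 * (C1 + 1)).
have C10 : 0 < C1 + 1 by rewrite ltr_wpDl.
have r0 : 0 < r by rewrite divr_gt0// mulr_gt0.
have r_eta : 2 * (C1 * r) <= eta / 2.
  rewrite /r; apply: (@le_trans _ _ (2 * ((C1 + 1) * (eta / (4 * (C1 + 1)))))).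
    rewrite ler_pM2l// ler_wpM2r ?lerDl// ltW// divr_gt0// mulr_gt0//.
  by rewrite le_eqVlt; apply/orP; left; apply/eqP; field; rewrite gt_eqF.
rewrite leNgt; apply/negP => big.
pose B := eball x r; pose B' := eball x (r + enorm v).
have mB : measurable (B : set (Leb_space R n.+1)) by exact: measurable_eball.
have mB' : measurable (B' : set (Leb_space R n.+1)) by exact: measurable_eball.
have B'fin : (mu B' < +oo)%E.
  apply: le_lt_trans (@eball_volume_le R n x (r + enorm v) _) _; last exact: ltry.
  by rewrite ltr_wpDr ?enorm_ge0.
have Bpos : (0 < mu B)%E.
  have h0 : 0 < r / (2 * (1 * n.+1)%:R) by rewrite divr_gt0// mulr_gt0// ltr0n.
  apply: lt_le_trans (@cube_sub_volume R n B x _ (ltW h0) _).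
    by rewrite lte_fin exprn_gt0// mulr_gt0.
  move=> y yh; rewrite /B /eball /=; apply: le_lt_trans (enorm_le_norm _) _.
  rewrite mulrC -ltr_pdivlMr ?ltr0n//.
  apply: (@le_lt_trans _ _ (r / (2 * (1 * n.+1)%:R))).
    rewrite [leLHS]/Num.norm /= mx_normrE; apply/bigmax_leP; split; first exact: ltW.
    by move=> [i j] _ /=; rewrite ord1.
  rewrite ltr_pM2l// ltf_pV2 ?posrE ?mulr_gt0 ?ltr0n//.
  by rewrite ltr_pMl ?ltr0n// ltr1n.
have Bfin : (mu B < +oo)%E.
  apply: le_lt_trans (@eball_volume_le R n x r r0) _; exact: ltry.
(* Near x the increment stays above its bound by at least eta / 2. *)
have lower k y : B y ->
    eta / 2 <= s k * \sum_(i < k.+1) Q k (y + (i%:R * s k) *: v).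
  move=> By; apply: le_trans (increment_le k y).
  have yx : enorm (y - x) <= r by exact: ltW.
  have : enorm (h (x + v) - h x) <= enorm (h (y + v) - h y) + 2 * (C1 * r).
    apply: le_trans (enormB_triangle _ (h (y + v)) _) _.
    apply: (@le_trans _ _ (C1 * r + (enorm (h (y + v) - h y) + C1 * r))); last by lra.
    have hyx a b : enorm (a - b) <= r -> enorm (h a - h b) <= C1 * r.
      by move=> ab; apply: le_trans (h_lip _ _) _; rewrite ler_wpM2l.
    apply: lerD.
      rewrite enormB_sym; apply: hyx.
      suff -> : y + v - (x + v) = y - x by [].
      by apply/matrixP => i j; rewrite !mxE; ring.
    apply: le_trans (enormB_triangle _ (h y) _) _; rewrite lerD2l.
    exact: hyx.
  by move: big r_eta; lra.
have upper k : ((eta / 2)%:E * mu B <= \int[mu]_(y in B') (Q k y)%:E)%E.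
  have shift_le (i : 'I_k.+1) :
      (\int[mu]_(y in B) (Q k (y + (i%:R * s k) *: v))%:E <=
       \int[mu]_(y in B') (Q k y)%:E)%E.
    apply: (integral_shift_le mB mB' (Q_ge0 k) (Q_meas k)) => y By.
    rewrite /B' /eball /= addrAC; apply: le_lt_trans (enormD _ _) _.
    apply: ltr_leD => //; rewrite enormZ ger0_norm ?mulr_ge0 ?(ltW (s_gt0 k))//.
    rewrite -[leRHS]mul1r ler_wpM2r ?enorm_ge0// ler_pdivrMr ?ltr0n// mul1r ler_nat.
    exact: ltnW (ltn_ord i).
  apply: (@le_integral_average _ (Leb_space R n.+1) R mu k.+1 (s k) (eta / 2) B
    (fun i y => Q k (y + (i%:R * s k) *: v)) _ mB _ _ _ _ shift_le).
  - by rewrite mulfV ?pnatr_eq0.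
  - by rewrite divr_ge0// ltW.
  - by move=> i y; exact: Q_ge0.
  - move=> i; have := measurableT_comp (@Q_meas k)
      (lebesgue_measurable_shift ((i%:R * s k) *: v)).
    exact: measurable_funTS.
  - exact: lower.
have cvgQ := integral_Q_cvg0 mB' B'fin.
have : ((eta / 2)%:E * mu B <= 0)%E.
  apply: (cvge_ge _ cvgQ); exact: nearW.
by apply/negP; rewrite -ltNge mule_gt0// lte_fin divr_gt0.
Qed.

End Almost_everywhere_derivative.

(** * Hausdorff measure under bi-Lipschitz maps *)

Section Hausdorff_bilipschitz.
Context {R : realType}.
Variables d n : nat.
Local Open Scope ereal_scope.
Local Notation Rn := 'rV[R]_n.
Local Notation H := (@hausdorff_outer R d n).
Local Notation Hs := (Haus_space R d n).

(** A cover of Y is pulled back by f to a cover of X, and diameters grow at most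
    by the factor K.  With a right inverse in place of f this also bounds the
    measure of images. *)
Lemma hausdorff_scale (f : Rn -> Rn) (K : R) (X Y : set Rn) : (0 < K)%R ->
  (forall x, X x -> Y (f x)) ->
  (forall x y, X x -> X y -> enorm (x - y) <= K * enorm (f x - f y))%R ->
  H X <= (K ^+ d)%:E * H Y.
Proof.
move=> K0 XY Kf; apply: ge_ereal_sup => _ [delta /= delta0 <-].
have dK0 : (0 < delta / K)%R by rewrite divr_gt0.
have Kd : (0 < K ^+ d)%R by rewrite exprn_gt0.
apply: (@le_trans _ _ ((K ^+ d)%:E * cover_measure (hausdorff_gauge d (delta / K)) Y)).
  rewrite -lee_pdivrMl//; apply: le_ereal_inf_tmp => _ [F YF <-].
  rewrite lee_pdivrMl//.
  rewrite -nneseriesZl; last first.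
    by move=> k _; apply: gauge0_ge0; exact: hausdorff_gauge_ge0.
  apply: le_trans (ereal_inf_lbound _) _.
    exists (fun k => X `&` f @^-1` (F k)) => // x Xx.
    by have [k _ Fk] := YF _ (XY _ Xx); exists k.
  apply: lee_nneseries => [k _ _|k _].
    by apply: gauge0_ge0; exact: hausdorff_gauge_ge0.
  have {1}-> : delta = (K * (delta / K))%R by rewrite mulrC divfK// gt_eqF.
  apply: hausdorff_gauge0_scale => // [[x [_ Fx]]|_]; first by exists (f x).
  apply: ge_ereal_sup => _ [x [Xx Fx] [y [Xy Fy] <-]].
  apply: (@le_trans _ _ (K%:E * (enorm (f x - f y)%R)%:E)).
    by rewrite -EFinM lee_fin Kf.
  by apply: lee_wpmul2l; [rewrite lee_fin ltW|exact: enorm_le_diam].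
apply: lee_wpmul2l; first by rewrite lee_fin ltW.
exact: hausdorff_cover_le_outer.
Qed.

Lemma diam_closure (F : set Rn) : diam (closure F) <= diam F.
Proof.
apply: ge_ereal_sup => _ [x Fx [y Fy <-]]; apply/lee_addgt0Pr => e e0.
pose N : R := (1 * n + 1)%:R.
have N0 : (0 < N)%R by rewrite ltr0n addn1.
have eN : (0 < e / (2 * N))%R by rewrite divr_gt0// mulr_gt0.
have approx z : closure F z -> exists2 w, F w & (enorm (z - w) <= e / 2)%R.
  move=> /(_ (ball z (e / (2 * N))%R) (nbhsx_ballx z _ eN)) [w [Fw]].
  rewrite -ball_normE /= => zw; exists w => //.
  apply: le_trans (enorm_le_norm _) _.
  apply: (@le_trans _ _ (N * (e / (2 * N)))%R).
    by apply: ler_pM; rewrite ?ler0n// ?ler_nat ?leq_addr// ltW.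
  by rewrite le_eqVlt; apply/orP; left; apply/eqP; field; rewrite gt_eqF.
have [x' Fx' xx'] := approx x Fx; have [y' Fy' yy'] := approx y Fy.
apply: (@le_trans _ _ ((enorm (x' - y')%R)%:E + e%:E)); last first.
  by apply: leeD2r; exact: enorm_le_diam.
rewrite -EFinD lee_fin.
apply: le_trans (enormB_triangle _ x' _) _.
apply: (@le_trans _ _ (e / 2 + (enorm (x' - y') + e / 2))%R); last by lra.
apply: lerD => //; apply: le_trans (enormB_triangle _ y' _) _.
by rewrite lerD2l enormB_sym.
Qed.

Lemma continuous_borel_measurable (f : Rn -> Rn) : continuous f ->
  measurable_fun [set: Hs] (f : Hs -> Borel_space R n).
Proof.
move=> cf; apply: (@measurability _ _ Hs (Borel_space R n) setT f open) => //.
move=> _ [U oU <-]; rewrite setTI; apply: hausdorff_measurable_open.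
by apply: open_comp => // x _; exact: cf.
Qed.

(** Replacing covering sets by their closures changes no diameter.  The hull is a
    countable intersection, over scales r k tending to 0, of countable unions of
    closed sets. *)
Lemma hausdorff_borel_hull (A : set Rn) : H A < +oo ->
  exists D : set (Borel_space R n), [/\ measurable D, A `<=` D & H D <= H A].
Proof.
move=> Afin; pose r (k : nat) : R := (k.+1%:R^-1)%R.
have r0 k : (0 < r k)%R by rewrite invr_gt0.
have /choice[F FP] : forall k, exists F : (set Rn)^nat, A `<=` \bigcup_i F i /\
    \sum_(i <oo) gauge0 (hausdorff_gauge d (r k)) (F i) <= H A + (r k)%:E.
  move=> k; have le_k := @hausdorff_cover_le_outer R d n (r k) A (r0 k).
  have fin : cover_measure (hausdorff_gauge d (r k)) A \is a fin_num.
    rewrite ge0_fin_numE ?(le_lt_trans le_k)//.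
    by apply: cover_measure_ge0; exact: hausdorff_gauge_ge0.
  have [_ [F AF <-] /ltW leF] := lb_ereal_inf_adherent (r0 k) fin.
  by exists F; split=> //; apply: le_trans leF _; exact: leeD2r.
pose D := \bigcap_k \bigcup_i closure (F k i); exists D; split.
- apply: bigcapT_measurable => k; apply: bigcupT_measurable => i.
  rewrite -[closure _]setCK; apply: measurableC; apply: sub_gen_smallest.
  by apply: closed_openC; exact: closed_closure.
- move=> x Ax k _; have [/(_ x Ax)[i _ Fx] _] := FP k.
  by exists i => //; exact: subset_closure.
apply: ge_ereal_sup => _ [delta /= delta0 <-].
apply/lee_addgt0Pr => e e0.
have [k rk] : exists k, (r k <= Num.min delta e)%R.
  have m0 : (0 < Num.min delta e)%R by rewrite lt_min delta0.
  exists (Num.truncn (Num.min delta e)^-1); rewrite /r.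
  rewrite -[leRHS]invrK lef_pV2 ?posrE ?invr_gt0 ?ltr0n//.
  exact: ltW (truncnS_gt _).
move: rk; rewrite le_min => /andP[rdelta re].
have [AF Fle] := FP k.
apply: le_trans (hausdorff_cover_le _ _ rdelta) _.
apply: (@le_trans _ _ (H A + (r k)%:E)); last first.
  by apply: leeD2l; rewrite lee_fin.
apply: le_trans Fle; apply: le_trans (ereal_inf_lbound _) _.
  by exists (fun i => closure (F k i)) => // x Dx; exact: (Dx k I).
apply: lee_nneseries => [i _ _|i _].
  by apply: gauge0_ge0; exact: hausdorff_gauge_ge0.
have := @hausdorff_gauge0_scale R d n 1 (r k) (closure (F k i)) (F k i) ltr01.
rewrite mul1r expr1n !mul1e; apply.
  by move=> [x /(_ setT filterT)[y [Fy _]]]; exists y.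
by move=> _; exact: diam_closure.
Qed.

(** Let P be the preimage of E.  By passing to a Borel hull it is enough to split
    Borel sets A of finite measure along P.  A Borel hull D0 of f(A & P) exceeds
    it by a null set inside the complement of E, because E is Caratheodory
    measurable.  Hence the Borel set D of points of A that f maps into D0 contains
    A & P and differs from it by a null set, f being bi-Lipschitz; and Borel sets
    split A. *)
Lemma hausdorff_measurable_bilipschitz (f : Rn -> Rn) (K L : R) :
  (0 < K)%R -> (0 < L)%R ->
  (forall x y, enorm (x - y) <= K * enorm (f x - f y))%R ->
  (forall x y, enorm (f x - f y) <= L * enorm (x - y))%R ->
  continuous f ->
  measurable_fun [set: Hs] (f : Hs -> Hs).
Proof.
move=> K0 L0 fK fL cf _ E mE; rewrite setTI.
set P := f @^-1` E.
suff : H.-caratheodory P by [].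
have {}mE : H.-caratheodory E := mE.
apply: le_caratheodory_measurable => X.
change (H (X `&` P) + H (X `&` ~` P) <= H X).
have [Xfin|] := boolP (H X < +oo); last first.
  by rewrite -leNgt leye_eq => /eqP ->; rewrite leey.
have [A [mA XA HA]] := hausdorff_borel_hull Xfin.
have Afin : H A < +oo by exact: le_lt_trans HA Xfin.
have {mA} mA : measurable (A : set Hs).
  have := continuous_borel_measurable (fun x => @cvg_id _ (nbhs x)) measurableT mA.
  by rewrite setTI.
apply: (@le_trans _ _ (H (A `&` P) + H (A `&` ~` P))).
  by apply: leeD; apply: le_hausdorff_outer => x [/XA].
have imfin : H (f @` (A `&` P)) < +oo.
  have /choice[g gP] : forall y, exists x, (f @` (A `&` P)) y -> (A `&` P) x /\ f x = y.
    move=> y; have [[x Px <-]|ny] := pselect ((f @` (A `&` P)) y); first by exists x.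
    by exists y.
  apply: le_lt_trans (@hausdorff_scale g L (f @` (A `&` P)) A L0 _ _) _.
  - by move=> y /gP [[]].
  - move=> y z fy fz; have [_ {1}<-] := gP _ fy; have [_ {1}<-] := gP _ fz.
    exact: fL.
  - by rewrite lte_mul_pinfty// lee_fin exprn_ge0// ltW.
have [D0 [mD0 PD0 HD0]] := hausdorff_borel_hull imfin.
pose D := A `&` f @^-1` D0.
have mD : measurable (D : set Hs).
  apply: measurableI => //.
  by have := continuous_borel_measurable cf measurableT mD0; rewrite setTI.
have APD : A `&` P `<=` D.
  by move=> x [Ax Px]; split => //; apply: PD0; exists x.
have null0 : H (D0 `&` ~` E) = 0.
  have D0fin : H D0 < +oo by exact: le_lt_trans HD0 imfin.
  have := mE D0; have le1 : H D0 <= H (D0 `&` E).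
    apply: le_trans HD0 _; apply: le_hausdorff_outer => _ [x [Ax Px] <-].
    by split => //; apply: PD0; exists x.
  move=> HE; apply/eqP; rewrite eq_le hausdorff_outer_ge0 andbT.
  have fin1 : H (D0 `&` E) \is a fin_num.
    rewrite ge0_fin_numE ?hausdorff_outer_ge0//; apply: le_lt_trans D0fin.
    by apply: le_hausdorff_outer => x [].
  rewrite -(@leeD2lE _ (H (D0 `&` E)))// adde0.
  by apply: le_trans le1; rewrite [leRHS]HE.
have null : H (D `&` ~` P) = 0.
  apply/eqP; rewrite eq_le hausdorff_outer_ge0 andbT.
  apply: le_trans (@hausdorff_scale f K _ (D0 `&` ~` E) K0 _ _) _.
  - by move=> x [[_ D0x] Px].
  - by move=> x y _ _; exact: fK.
  - by rewrite null0 mule0.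
apply: (@le_trans _ _ (H (A `&` D) + (H (A `&` ~` D) + H (D `&` ~` P)))).
  apply: leeD; first by apply: le_hausdorff_outer => x [Ax Px]; split => //; exact: APD.
  apply: le_trans (outer_measureU2 _ _ _); apply: le_hausdorff_outer => x [Ax Px].
  by have [Dx|Dx] := pselect (D x); [right|left].
have {}mD : H.-caratheodory D := mD.
by rewrite null adde0 -mD.
Qed.

End Hausdorff_bilipschitz.

(** * Dominated convergence with a vanishing defect *)

(** If the integrals of Y_j do not tend to 0, they stay above some e > 0 along a
    subsequence on which the integrals of Z_j are summable.  On it Z_j, hence Y_j,
    tends to 0 almost everywhere; min(Y_j, G) is dominated by G, and Y_j exceeds it
    by at most c Z_j, so the integrals of Y_j tend to 0 after all. *)
Section Dominated_convergence.
Context d (T : measurableType d) (R : realType) (mu : {measure set T -> \bar R}).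
Variables (D : set T) (Y Z : nat -> T -> R) (G : T -> R) (c : R).
Hypotheses (mD : measurable D) (c0 : 0 <= c).
Hypotheses (mY : forall j, measurable_fun D (Y j)) (mZ : forall j, measurable_fun D (Z j)).
Hypotheses (Y0 : forall j x, 0 <= Y j x) (Z0 : forall j x, 0 <= Z j x).
Hypotheses (iG : mu.-integrable D (EFin \o G)) (G0 : forall x, 0 <= G x).
Hypothesis YGZ : forall j x, D x -> Y j x <= G x + c * Z j x.
Hypothesis pointwise : forall x (s : nat -> nat), D x ->
  Z (s k) x @[k --> \oo] --> 0 -> Y (s k) x @[k --> \oo] --> 0.
Local Open Scope ereal_scope.

Let mYE j : measurable_fun D (EFin \o Y j). Proof. exact/measurable_EFinP. Qed.
Let mZE j : measurable_fun D (EFin \o Z j). Proof. exact/measurable_EFinP. Qed.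
Let mG : measurable_fun D G.
Proof. by apply/measurable_EFinP; case/integrableP: iG. Qed.

Let fast_cvg0 (s : nat -> nat) :
  (forall k, \int[mu]_(x in D) (Z (s k) x)%:E <= (1 / (2 ^ k.+1)%:R)%:E) ->
  \int[mu]_(x in D) (Y (s k) x)%:E @[k --> \oo] --> 0.
Proof.
move=> sZ.
have Zint_cvg : \int[mu]_(x in D) (Z (s k) x)%:E @[k --> \oo] --> 0.
  have upper : (1 / (2 ^ k.+1)%:R)%:E @[k --> \oo] --> (0 : \bar R).
    apply: cvg_EFin; first exact: nearW.
    have h12 : (`|1 / 2| < 1 :> R)%R by rewrite ger0_norm ?divr_ge0//; lra.
    apply: cvg_trans (cvg_geometric (1 / 2)%R h12); apply: near_eq_cvg; apply: nearW => k /=.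
    by rewrite /geometric /= natrX exprS expr_div_n expr1n invfM !mul1r.
  apply: (squeeze_cvge _ (@cvg_cst _ _ _ _ _) upper).
  by apply: nearW => k; rewrite sZ andbT integral_ge0// => x _; rewrite lee_fin.
have sum_fin : \int[mu]_(x in D) (\sum_(k <oo) (Z (s k) x)%:E) < +oo.
  rewrite integral_nneseries//; last 2 first.
  - by move=> k; exact: mZE.
  - by move=> k x _; rewrite lee_fin.
  apply: le_lt_trans (ltry 1); apply: le_trans (epsilon_trick0 xpredT (@ler01 R)).
  by apply: lee_nneseries => // k _ _; apply: integral_ge0 => x _; rewrite lee_fin.
have msum : measurable_fun D (fun x => \sum_(k <oo) (Z (s k) x)%:E).
  by apply: ge0_emeasurable_sum => [k x _ _|k _]; [rewrite lee_fin|exact: mZE].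
have sum_ge0 x : 0 <= \sum_(k <oo) (Z (s k) x)%:E.
  by apply: nneseries_ge0 => k _ _; rewrite lee_fin.
have isum : mu.-integrable D (fun x => \sum_(k <oo) (Z (s k) x)%:E).
  apply/integrableP; split => //.
  rewrite (eq_integral (fun x => \sum_(k <oo) (Z (s k) x)%:E)).
    exact: sum_fin.
  by move=> x _; rewrite gee0_abs.
have aeZ : {ae mu, forall x, D x -> (Z (s k) x @[k --> \oo] --> 0)%R}.
  apply: filterS (integrable_ae mD isum) => x h Dx.
  have {}h := h Dx; rewrite ge0_fin_numE// in h.
  have tail := nneseries_tail_cvg h (fun k _ => Z0 (s k) x : 0 <= (Z (s k) x)%:E).
  have : (Z (s k) x)%:E @[k --> \oo] --> 0%R%:E.
    apply: (squeeze_cvge _ (@cvg_cst _ _ _ _ _) tail).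
    apply: nearW => k; rewrite lee_fin Z0/= (@nneseries_split _ _ k 1); last first.
      by move=> i _; rewrite lee_fin.
    by rewrite addn1 big_nat1 leeDl// nneseries_ge0// => i _ _; rewrite lee_fin.
  by move=> Zx; have [_] := (fine_cvgP _ _).1 Zx; exact.
pose M k x := Num.min (Y (s k) x) (G x).
have M0 k x : (0 <= M k x)%R by rewrite le_min Y0 G0.
have mM k : measurable_fun D (M k) by exact: measurable_minr.
have Mcvg : \int[mu]_(x in D) (M k x)%:E @[k --> \oo] --> 0.
  have [] := @dominated_convergence _ T R mu D mD (fun k x => (M k x)%:E) (cst 0)
    (EFin \o G) _ _ _ iG _.
  - by move=> k; exact/measurable_EFinP.
  - exact: measurable_cst.
  - apply: filterS aeZ => x h Dx; apply: cvg_EFin; first exact: nearW.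
    apply: (squeeze_cvgr _ (@cvg_cst _ _ _ _ _) (pointwise Dx (h Dx))).
    by apply: nearW => k; rewrite M0/= ge_min lexx.
  - by apply/aeW => x k _ /=; rewrite lee_fin ger0_norm// ge_min lexx orbT.
  by move=> _ _; rewrite integral0.
have bound_cvg : (\int[mu]_(x in D) (M k x)%:E +
    c%:E * \int[mu]_(x in D) (Z (s k) x)%:E) @[k --> \oo] --> 0.
  rewrite -[X in _ --> X]adde0 -[X in _ --> _ + X](mule0 c%:E).
  by apply: cvgeD => //; [exact: cvgeZl].
apply: (squeeze_cvge _ (@cvg_cst _ _ _ _ _) bound_cvg).
apply: nearW => k; rewrite integral_ge0/=; last by move=> x _; rewrite lee_fin.
rewrite -ge0_integralZl//; last 2 first.
- exact: mZE.
- by move=> x _; rewrite lee_fin.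
have mME k' : measurable_fun D (fun x => (M k' x)%:E) by exact/measurable_EFinP.
have mcZ : measurable_fun D (fun x => c%:E * (Z (s k) x)%:E).
  by apply: measurable_funeM; exact: mZE.
have cZ0 x : 0 <= c%:E * (Z (s k) x)%:E by rewrite -EFinM lee_fin mulr_ge0.
rewrite -(ge0_integralD mu mD _ (mME k) _ mcZ); last 2 first.
- by move=> x _; rewrite lee_fin.
- by move=> x _.
apply: ge0_le_integral => //.
- by move=> x _; rewrite lee_fin.
- exact: mYE.
- exact: emeasurable_funD.
- move=> x Dx; rewrite -EFinM -EFinD lee_fin /M.
  case: (leP (Y (s k) x) (G x)) => _; last exact: YGZ.
  by rewrite lerDl mulr_ge0.
Qed.

Lemma dominated_cvg0 :
  \int[mu]_(x in D) (Z j x)%:E @[j --> \oo] --> 0 ->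
  \int[mu]_(x in D) (Y j x)%:E @[j --> \oo] --> 0.
Proof.
move=> Zcvg; apply: contrapT => nY.
have [e e0 He] : exists2 e : R, (0 < e)%R & forall N, exists2 j, (N <= j)%N &
    e%:E < \int[mu]_(x in D) (Y j x)%:E.
  apply: contrapT => nex; apply: nY.
  have Yge0 j : 0 <= \int[mu]_(x in D) (Y j x)%:E.
    by apply: integral_ge0 => x _; rewrite lee_fin.
  have small (e : R) : (0 < e)%R -> \forall j \near \oo,
      \int[mu]_(x in D) (Y j x)%:E <= e%:E.
    move=> e0; apply: contrapT => nnear; apply: nex; exists e => // N.
    apply: contrapT => nj; apply: nnear; exists N => // j /= Nj.
    by rewrite leNgt; apply/negP => ej; apply: nj; exists j.
  apply/(fine_cvgP _ 0%R).2; split.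
    apply: filterS (small 1%R ltr01) => j j1.
    by rewrite ge0_fin_numE// (le_lt_trans j1) ?ltry.
  apply/cvgrPdist_le => e e0; apply: filterS (small e e0) => j je.
  rewrite sub0r normrN ger0_norm ?fine_ge0// -lee_fin fineK//.
  by rewrite ge0_fin_numE// (le_lt_trans je) ?ltry.
have /choice[s sP] : forall k, exists j,
    \int[mu]_(x in D) (Z j x)%:E <= (1 / (2 ^ k.+1)%:R)%:E /\
    e%:E < \int[mu]_(x in D) (Y j x)%:E.
  move=> k; have e'0 : (0 < 1 / (2 ^ k.+1)%:R :> R)%R.
    by rewrite divr_gt0// ltr0n expn_gt0.
  have [N _ HN] : \forall j \near \oo,
      \int[mu]_(x in D) (Z j x)%:E < (1 / (2 ^ k.+1)%:R)%:E.
    apply: (Zcvg [set w | w < (1 / (2 ^ k.+1)%:R)%:E]).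
    by apply: open_ereal_lt'; rewrite lte_fin.
  have [j Nj ej] := He N; exists j; split => //.
  by apply: ltW; exact: HN.
have := fast_cvg0 (fun k => (sP k).1).
have e0' : 0 < e%:E by rewrite lte_fin.
move=> /(_ [set w | w < e%:E] (open_ereal_lt' e0')) [N _ /(_ N (leqnn N))] /=.
by rewrite ltNge (ltW (sP N).2).
Qed.

End Dominated_convergence.

(** * Deformations close to the identity *)

(** Matrices are both complete and normed; Banach's fixed point theorem needs the
    two structures to be joined. *)
HB.instance Definition _ (R : realType) m n := Complete.on 'M[R]_(m, n).

Section Near_identity.
Context {R : realType}.
Variable n : nat.
Local Notation Rn := 'rV[R]_n.+1.
Variables (Phi : Rn -> Rn) (e : R).
Hypotheses (e0 : 0 <= e) (e1 : e < 1) (en1 : e * (1 * n.+1)%:R < 1).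
Hypothesis near_id : forall x y,
  enorm ((Phi y - y) - (Phi x - x)) <= e * enorm (y - x).

Lemma near_id_upper x y : enorm (Phi x - Phi y) <= (1 + e) * enorm (x - y).
Proof.
have -> : Phi x - Phi y = (x - y) + ((Phi x - x) - (Phi y - y)).
  by apply/matrixP => i j; rewrite !mxE; ring.
by apply: le_trans (enormD _ _) _; rewrite mulrDl mul1r lerD2l.
Qed.

Lemma near_id_lower x y : enorm (x - y) <= (1 - e)^-1 * enorm (Phi x - Phi y).
Proof.
rewrite mulrC ler_pdivlMr ?subr_gt0// mulrBr mulr1 lerBlDr mulrC.
have {1}-> : x - y = (Phi x - Phi y) - ((Phi x - x) - (Phi y - y)).
  by apply/matrixP => i j; rewrite !mxE; ring.
by apply: le_trans (enormD _ _) _; rewrite lerD2l enormN.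
Qed.

(** A preimage of y is a fixed point of x |-> y - (Phi x - x), which contracts the
    sup norm; the dimension enters in comparing it with the Euclidean norm. *)
Lemma near_id_surjective y : exists x, Phi x = y.
Proof.
pose F (x : Rn) : Rn := y - (Phi x - x).
have FT : {homo F : x / setT x >-> setT x} by [].
pose q : {nonneg R} := NngNum (mulr_ge0 e0 (ler0n R (1 * n.+1))).
have lipF a b : `|F a - F b| <= q%:num * `|a - b|.
  have -> : F a - F b = (Phi b - b) - (Phi a - a).
    by apply/matrixP => i j; rewrite /F !mxE; ring.
  apply: le_trans (norm_le_enorm _) _; apply: le_trans (near_id _ _) _.
  by rewrite enormB_sym -mulrA ler_wpM2l// enorm_le_norm.
have ctr : is_contraction (mkfun FT : {fun setT >-> setT}).
  by exists q; split => // -[a b] _; exact: lipF.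
have [x _ xE] := banach_fixed_point ctr closedT (ex_intro _ y I).
exists x; have := congr1 (fun z => z + (Phi x - x)) (xE : x = y - (Phi x - x)).
by rewrite subrK addrC subrK.
Qed.

Variable d : nat.
Local Notation H := (@hausdorff_outer R d n.+1).
Local Notation Hs := (Haus_space R d n.+1).
Local Open Scope ereal_scope.

Let lo_gt0 : (0 < (1 - e)^-1)%R. Proof. by rewrite invr_gt0 subr_gt0. Qed.
Let up_gt0 : (0 < 1 + e)%R. Proof. by rewrite ltr_wpDr. Qed.

Lemma near_id_measurable : measurable_fun [set: Hs] (Phi : Hs -> Hs).
Proof.
apply: (hausdorff_measurable_bilipschitz lo_gt0 up_gt0).
- exact: near_id_lower.
- exact: near_id_upper.
apply: (@lipschitz_continuous R n _ Phi (1 + e)) => x y.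
exact: le_trans (norm_le_enorm _) (near_id_upper x y).
Qed.

Lemma near_id_preimage_le E :
  H (Phi @^-1` E) <= ((1 - e)^-1 ^+ d)%:E * H E.
Proof. by apply: (@hausdorff_scale _ _ _ Phi) => // x y _ _; exact: near_id_lower. Qed.

Lemma near_id_preimage_ge E :
  ((1 + e)^-1 ^+ d)%:E * H E <= H (Phi @^-1` E).
Proof.
have /choice[g gP] : forall y, exists x, Phi x = y := near_id_surjective.
rewrite exprVn lee_pdivrMl ?exprn_gt0//.
apply: (@hausdorff_scale _ _ _ g) => // [y Ey|x y _ _]; first by rewrite /= gP.
by have := near_id_upper (g x) (g y); rewrite !gP.
Qed.

Lemma near_id_integral (f : Hs -> \bar R) : (forall y, 0 <= f y) ->
  measurable_fun [set: Hs] f ->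
  ((1 - e) ^+ d)%:E * \int[haus d n.+1]_x f (Phi x) <= \int[haus d n.+1]_y f y /\
  \int[haus d n.+1]_y f y <= ((1 + e) ^+ d)%:E * \int[haus d n.+1]_x f (Phi x).
Proof.
move=> f0 mf; have lo0 : (0 < 1 - e)%R by rewrite subr_gt0.
split.
  rewrite -lee_pdivlMl ?exprn_gt0// -exprVn.
  have := le_integral_preimage (mu := haus d n.+1) (nu := haus d n.+1) near_id_measurable
    (exprn_ge0 d (ltW lo_gt0)) f0 mf (@measurableT _ Hs).
  by rewrite preimage_setT; apply => E _; exact: near_id_preimage_le.
rewrite -lee_pdivrMl ?exprn_gt0// -exprVn.
have up_inv : (0 <= (1 + e)^-1)%R by rewrite invr_ge0 ltW.
have := ge_integral_preimage (mu := haus d n.+1) (nu := haus d n.+1) near_id_measurable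
  (exprn_ge0 d up_inv) f0 mf (@measurableT _ Hs).
by rewrite preimage_setT; apply => E _; exact: near_id_preimage_ge.
Qed.

End Near_identity.

(** The factors (1 - e)^d and (1 + e)^d are close to 1 for small e, and a_j is
    eventually bounded by l + 1. *)
Lemma squeeze_scale_cvg (R : realType) (d : nat) (a b : nat -> \bar R) (l : R) :
  (a j @[j --> \oo] --> l%:E)%E -> (forall j, 0 <= a j)%E ->
  (forall e : R, 0 < e -> e < 1 -> \forall j \near \oo,
    ((((1 - e) ^+ d)%:E * a j <= b j) /\ (b j <= ((1 + e) ^+ d)%:E * a j))%E) ->
  (b j @[j --> \oo] --> l%:E)%E.
Proof.
move=> al a0 ab; have [afin al'] := (fine_cvgP _ _).1 al.
have l0 : 0 <= l by rewrite -lee_fin; apply: (cvge_ge _ al); exact: nearW.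
have half : (0 : R) < 1 / 2 /\ (1 / 2 : R) < 1 by split; lra.
apply/(fine_cvgP _ _).2; split.
  near=> j.
  have aj : a j \is a fin_num by near: j.
  have : ((((1 - 1 / 2) ^+ d)%:E * a j <= b j) /\
          (b j <= ((1 + 1 / 2) ^+ d)%:E * a j))%E by near: j; apply: ab; case: half.
  rewrite -(fineK aj) -!EFinM => -[h1 h2].
  by rewrite fin_numElt (lt_le_trans _ h1) ?ltNyr// (le_lt_trans h2) ?ltry.
apply/cvgrPdist_le => eps eps0.
have cont (c : R) : (1 + c * e) ^+ d @[e --> (0:R)^'+] --> (1 : R).
  rewrite -[X in _ --> X](_ : (1 + c * 0) ^+ d = 1); last first.
    by rewrite mulr0 addr0 expr1n.
  apply: cvg_at_right_filter.
  have cd : continuous (fun e : R => (1 + c * e) ^+ d).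
    move=> z; apply: (@continuous_comp _ _ _ (fun e : R => 1 + c * e) (fun x => x ^+ d)).
      by apply: cvgD; [exact: cvg_cst|apply: cvgM; [exact: cvg_cst|exact: cvg_id]].
    exact: exprn_continuous.
  exact: cd.
pose delta := eps / (2 * (l + 1)).
have l10 : 0 < l + 1 by rewrite ltr_wpDl.
have delta0 : 0 < delta by rewrite divr_gt0// mulr_gt0.
have deltaE : delta * (l + 1) = eps / 2.
  by rewrite /delta; field; rewrite gt_eqF.
have [e [e0 e1 lo up]] : exists e : R, [/\ 0 < e, e < 1,
    `|1 - (1 - e) ^+ d| <= delta & `|1 - (1 + e) ^+ d| <= delta].
  have near_e : \forall e \near (0:R)^'+, [/\ 0 < e, e < 1,
      `|1 - (1 - e) ^+ d| <= delta & `|1 - (1 + e) ^+ d| <= delta].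
    near=> e; split.
    - by near: e; exact: nbhs_right_gt.
    - by near: e; exact: nbhs_right_lt.
    - have : `|1 - (1 + -1 * e) ^+ d| <= delta.
        by near: e; move/cvgrPdist_le : (cont (-1)); exact.
      by rewrite mulN1r.
    - have : `|1 - (1 + 1 * e) ^+ d| <= delta.
        by near: e; move/cvgrPdist_le : (cont 1); exact.
      by rewrite mul1r.
  by have [e] := filter_ex near_e; exists e.
near=> j.
have aj : a j \is a fin_num by near: j.
have r0 : 0 <= fine (a j) by rewrite fine_ge0.
have al1 : `|l - fine (a j)| <= Num.min 1 (eps / 2).
  near: j; move/cvgrPdist_le : al'; apply.
  by rewrite lt_min ltr01 divr_gt0.
have [h1 h2] : ((((1 - e) ^+ d)%:E * a j <= b j) /\
    (b j <= ((1 + e) ^+ d)%:E * a j))%E by near: j; exact: ab.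
move: h1 h2; rewrite -(fineK aj) -!EFinM => h1 h2.
have bj : b j \is a fin_num.
  by rewrite fin_numElt (lt_le_trans _ h1) ?ltNyr// (le_lt_trans h2) ?ltry.
move: h1 h2; rewrite -(fineK bj) !lee_fin /= => h1 h2.
move: al1; rewrite le_min !ler_norml => /andP[/andP[h3 h4] /andP[h5 h6]].
move: lo up; rewrite !ler_norml => /andP[_ h7] /andP[h8 _].
have h9 : (1 - (1 - e) ^+ d) * fine (a j) <= delta * (l + 1).
  apply: (@le_trans _ _ (delta * fine (a j))); first by rewrite ler_wpM2r.
  by rewrite ler_pM2l//; move: h3; lra.
have h10 : ((1 + e) ^+ d - 1) * fine (a j) <= delta * (l + 1).
  apply: (@le_trans _ _ (delta * fine (a j))).
    by rewrite ler_wpM2r//; move: h8; lra.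
  by rewrite ler_pM2l//; move: h3; lra.
by apply/andP; split; move: h1 h2 h5 h6 h9 h10; rewrite deltaE; lra.
Unshelve. all: by end_near. Qed.

(** A map within Lipschitz distance e of the identity changes the d-dimensional
    Hausdorff measure, hence integrals, by factors between (1 - e)^d and
    (1 + e)^d. *)
Lemma near_id_integral_cvg (R : realType) (n d : nat)
    (Phi : nat -> 'rV[R]_n.+1 -> 'rV[R]_n.+1)
    (f : nat -> Haus_space R d n.+1 -> \bar R) (l : R) :
  (forall e, 0 < e -> \forall j \near \oo, forall x y,
    enorm ((Phi j y - y) - (Phi j x - x)) <= e * enorm (y - x)) ->
  (forall j y, (0 <= f j y)%E) -> (forall j, measurable_fun setT (f j)) ->
  (\int[haus d n.+1]_x f j (Phi j x) @[j --> \oo] --> l%:E)%E ->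
  (\int[haus d n.+1]_y f j y @[j --> \oo] --> l%:E)%E.
Proof.
move=> near_id f0 mf lim; apply: (squeeze_scale_cvg (d := d) lim).
  by move=> j; apply: integral_ge0 => x _; exact: f0.
move=> e e0 e1; pose N : R := (1 * n.+1)%:R.
have N0 : 0 < N by rewrite ltr0n.
(* e' N < 1 is what makes the maps onto *)
pose e' := Num.min e (1 / (2 * N)).
have e'0 : 0 < e' by rewrite lt_min e0 divr_gt0// mulr_gt0.
have e'e : e' <= e by rewrite ge_min lexx.
have e'1 : e' < 1 by exact: le_lt_trans e1.
have e'N : e' * N < 1.
  apply: (@le_lt_trans _ _ (1 / (2 * N) * N)).
    by rewrite ler_pM2r// ge_min lexx orbT.
  have -> : 1 / (2 * N) * N = 1 / 2 by field; rewrite gt_eqF.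
  by lra.
apply: filterS (near_id e' e'0) => j nj.
have I0 : (0 <= \int[haus d n.+1]_x f j (Phi j x))%E.
  by apply: integral_ge0 => x _; exact: f0.
have [h1 h2] := near_id_integral (ltW e'0) e'1 e'N nj (f0 j) (mf j).
split.
  apply: le_trans h1; apply: lee_wpmul2r => //; rewrite lee_fin.
  by apply: lerXn2r; rewrite ?nnegrE; move: e1 e'1 e'e; lra.
apply: le_trans h2 _; apply: lee_wpmul2r => //; rewrite lee_fin.
by apply: lerXn2r; rewrite ?nnegrE; move: e0 e'0 e'e; lra.
Qed.

(** * Convergence of the bulk term *)

Section L1_convergence.
Context d (T : measurableType d) (R : realType) (mu : {measure set T -> \bar R}).
Local Open Scope ereal_scope.

(** The integrals of f_ j are finite only eventually, once f_ j - f is integrable;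
    this is why they are compared for large j. *)
Lemma integral_cvg_L1 (D : set T) (f_ : nat -> T -> R) (f : T -> R) :
  measurable D -> (forall j, measurable_fun D (f_ j)) ->
  mu.-integrable D (EFin \o f) ->
  \int[mu]_(x in D) (`|f_ j x - f x|)%:E @[j --> \oo] --> 0 ->
  \int[mu]_(x in D) (f_ j x)%:E @[j --> \oo] --> \int[mu]_(x in D) (f x)%:E.
Proof.
move=> mD mf_ intf lim.
have mf : measurable_fun D f by apply/measurable_EFinP; case/integrableP: intf.
have md j : measurable_fun D (fun x => (f_ j x - f x)%:E).
  by apply/measurable_EFinP; exact: measurable_funB.
have near_int : \forall j \near \oo,
    mu.-integrable D (fun x => (f_ j x - f x)%:E).
  have : \forall j \near \oo, \int[mu]_(x in D) (`|f_ j x - f x|)%:E < 1%:E.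
    by apply: (lim [set w | w < 1%:E]); apply: open_ereal_lt'; rewrite lte_fin.
  apply: filterS => j j1; apply/integrableP; split; first exact: md.
  by apply: lt_trans (ltry 1); exact: j1.
have lim0 : \int[mu]_(x in D) (f_ j x - f x)%:E @[j --> \oo] --> 0.
  apply: (cvg_abse0P _).1.
  apply: (squeeze_cvge _ (@cvg_cst _ _ _ _ _) lim).
  apply: nearW => j; rewrite abse_ge0 /=; exact: le_abse_integral.
have : (\int[mu]_(x in D) (f_ j x - f x)%:E + \int[mu]_(x in D) (f x)%:E)
    @[j --> \oo] --> 0 + \int[mu]_(x in D) (f x)%:E.
  by apply: cvgeD => //; exact: cvg_cst.
rewrite add0e; apply: cvg_trans; apply: near_eq_cvg.
apply: filterS near_int => j ij /=; rewrite -integralD//.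
by apply: eq_integral => x _; rewrite -EFinD subrK.
Qed.

End L1_convergence.

Lemma powR_cvg0 (R : realType) (p : R) (t : nat -> R) : 0 < p ->
  (forall k, 0 <= t k) -> t k `^ p @[k --> \oo] --> (0 : R) ->
  t k @[k --> \oo] --> (0 : R).
Proof.
move=> p0 t0 lim; apply/cvgrPdist_lt => e e0.
have ep : 0 < e `^ p by rewrite powR_gt0.
move/cvgrPdist_lt : lim => /(_ _ ep); apply: filterS => k.
rewrite !sub0r !normrN !ger0_norm ?powR_ge0// => tk.
rewrite ltNge; apply/negP => etk; move: tk; rewrite ltNge => /negP; apply.
by apply: ge0_ler_powR => //; rewrite ?nnegrE// ltW.
Qed.

Lemma powR_add_le (R : realType) (p a b : R) : 0 <= p -> 0 <= a -> 0 <= b ->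
  (a + b) `^ p <= 2 `^ p * (a `^ p + b `^ p).
Proof.
move=> p0 a0 b0; wlog ab : a b a0 b0 / a <= b.
  move=> H; have [/H|/ltW/H] := leP a b; first exact.
  by rewrite addrC (addrC (b `^ p)); exact.
apply: (@le_trans _ _ ((2 * b) `^ p)).
  by apply: ge0_ler_powR; rewrite ?nnegrE ?addr_ge0 ?mulr_ge0//; move: ab; lra.
by rewrite powRM// ler_wpM2l ?powR_ge0// lerDr powR_ge0.
Qed.

Section Lp_continuity.
Context d (T : measurableType d) (R : realType) (mu : {measure set T -> \bar R}).
Variables (k l : nat) (D : set T) (p : R).
Variables (X_ : nat -> T -> 'M[R]_(k, l)) (X : T -> 'M[R]_(k, l)).
Variables (Psi : 'M[R]_(k, l) -> R) (C : R).
Hypotheses (mD : measurable D) (Dfin : (mu D < +oo)%E) (p1 : 1 <= p) (C0 : 0 < C).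
Hypothesis mX_ : forall j a b, measurable_fun D (fun x => X_ j x a b).
Hypothesis mX : forall a b, measurable_fun D (fun x => X x a b).
Hypothesis Xfin : (\int[mu]_(x in D) (enorm (X x) `^ p)%:E < +oo)%E.
Hypothesis lim :
  (\int[mu]_(x in D) (enorm (X_ j x - X x) `^ p)%:E @[j --> \oo] --> 0)%E.
Hypothesis cPsi : continuous Psi.
Hypothesis growth : forall xi, `|Psi xi| <= C * (enorm xi `^ p + 1).

Let p0 : 0 < p. Proof. exact: lt_le_trans p1. Qed.

Let mpow (Y : T -> 'M[R]_(k, l)) :
  (forall a b, measurable_fun D (fun x => Y x a b)) ->
  measurable_fun D (fun x => enorm (Y x) `^ p).
Proof.
move=> mY; apply: (@measurableT_comp _ _ _ _ _ _ (fun t : R => t `^ p)).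
  exact: measurable_powR.
exact: measurable_enorm.
Qed.

Let int_pow (a b : R) : 0 <= a -> 0 <= b ->
  mu.-integrable D (fun x => (a * enorm (X x) `^ p + b)%:E).
Proof.
move=> a0 b0; have mp := mpow mX.
have -> : (fun x => (a * enorm (X x) `^ p + b)%:E) =
    (fun x => a%:E * (enorm (X x) `^ p)%:E)%E \+ cst b%:E.
  by apply/funext => x; rewrite /= EFinD EFinM.
apply: integrableD => //.
  apply: integrableZl => //; apply/integrableP; split; first exact/measurable_EFinP.
  rewrite (eq_integral (fun x => (enorm (X x) `^ p)%:E))// => x _.
  by rewrite gee0_abs// lee_fin powR_ge0.
apply/integrableP; split; first exact: measurable_cst.
rewrite (eq_integral (cst b%:E)); last by move=> x _; rewrite /= ger0_norm.
by rewrite integral_cst// lte_mul_pinfty// lee_fin.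
Qed.

Lemma integrable_growth : mu.-integrable D (fun x => (Psi (X x))%:E).
Proof.
apply: (le_integrable mD _ _ (int_pow (ltW C0) (ltW C0))).
  by apply/measurable_EFinP; exact: measurable_continuous_comp.
move=> x _; rewrite /= lee_fin; apply: le_trans (growth _) _.
by rewrite mulrDr mulr1 ler_norm.
Qed.

(** Continuity of the Nemytskii operator of Psi from L^p to L^1: the defect is
    |X_j - X|^p, which controls |Psi(X_j)| through |X_j|^p <= 2^p (|X|^p + |X_j - X|^p)
    and whose vanishing at a point forces X_j to converge there. *)
Lemma Lp_continuous_integral :
  (\int[mu]_(x in D) (Psi (X_ j x))%:E @[j --> \oo] -->
   \int[mu]_(x in D) (Psi (X x))%:E)%E.
Proof.
have mPX_ j : measurable_fun D (fun x => Psi (X_ j x)) by exact: measurable_continuous_comp.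
have mPX : measurable_fun D (fun x => Psi (X x)) by exact: measurable_continuous_comp.
apply: integral_cvg_L1 => //; first exact: integrable_growth.
pose q := 2 `^ p : R; have q0 : 0 <= q by exact: powR_ge0.
apply: (@dominated_cvg0 _ T R mu D _ (fun j x => enorm (X_ j x - X x) `^ p)
  (fun x => C * (q + 1) * enorm (X x) `^ p + C * 2) (C * q) mD).
- by rewrite mulr_ge0// ltW.
- by move=> j; apply: measurableT_comp => //; exact: measurable_funB.
- move=> j; apply: mpow => a b; under eq_fun do rewrite !mxE.
  exact: measurable_funB.
- by move=> j x; exact: normr_ge0.
- by move=> j x; exact: powR_ge0.
- by apply: int_pow; rewrite !mulr_ge0 ?addr_ge0// ltW.
- by move=> x; rewrite addr_ge0// !mulr_ge0 ?addr_ge0 ?powR_ge0// ltW.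
- move=> j x _; apply: le_trans (ler_normB _ _) _.
  apply: le_trans (lerD (growth _) (growth _)) _.
  have h : enorm (X_ j x) `^ p <=
      q * (enorm (X x) `^ p + enorm (X_ j x - X x) `^ p).
    apply: le_trans (powR_add_le (ltW p0) (enorm_ge0 _) (enorm_ge0 _)).
    apply: ge0_ler_powR; rewrite ?nnegrE ?addr_ge0 ?enorm_ge0// ?(ltW p0)//.
    by rewrite -{1}(subrK (X x) (X_ j x)) addrC enormD.
  move: (enorm (X_ j x) `^ p) (enorm (X x) `^ p) (enorm (X_ j x - X x) `^ p) h.
  by move=> a b z h; have := ler_wpM2l (ltW C0) h; lra.
- move=> x s _ Z0.
  have n0 : enorm (X_ (s i) x - X x) @[i --> \oo] --> (0:R).
    by apply: powR_cvg0 Z0 => // i; exact: enorm_ge0.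
  have Xlim : X_ (s i) x @[i --> \oo] --> X x.
    apply/cvgrPdist_lt => e e0; move/cvgrPdist_lt : n0 => /(_ e e0).
    apply: filterS => i; rewrite sub0r normrN ger0_norm ?enorm_ge0// distrC.
    exact: le_lt_trans (norm_le_enorm _).
  have := cvg_comp _ _ Xlim (@cPsi (X x)).
  move=> /cvgrPdist_lt PX; apply/cvgrPdist_lt => e e0; apply: filterS (PX e e0) => i.
  by rewrite sub0r normrN normr_id distrC.
- exact: lim.
Qed.

End Lp_continuity.

(** * Convergence of the surface term *)

(** Normals are 0 exactly off the jump set, so with this extension of g the energy
    of any jump set is an integral over the whole space. *)
Definition density0 {R : realType} m n (g : 'rV[R]_m -> 'rV[R]_n -> R)
  (s : 'rV[R]_m) (v : 'rV[R]_n) : R := if v == 0 then 0 else g s v.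

Section Surface_density.
Context {R : realType}.
Variables (m n : nat) (g : 'rV[R]_m.+1 -> 'rV[R]_n.+1 -> R).
Hypothesis g_continuous :
  {within [set z : 'rV[R]_m.+1 * 'rV[R]_n.+1 | enorm z.2 = 1],
       continuous (fun z => g z.1 z.2)}.

Lemma density_local s v eps : enorm v = 1 -> 0 < eps -> exists2 delta : R, 0 < delta &
  forall s' v', enorm v' = 1 -> `|s' - s| < delta -> `|v' - v| < delta ->
    `|g s' v' - g s v| < eps.
Proof.
move=> v1 eps0; have := (subspace_continuousP _ _).1 g_continuous (s, v) v1.
move=> /(_ (ball (g s v) eps) (nbhsx_ballx _ _ eps0)).
move=> /nbhs_ballP[delta /= delta0 sub]; exists delta => // s' v' v'1 ss vv.
have near_sv : ball (s, v) delta (s', v').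
  by split; rewrite -ball_normE /= distrC.
by have := sub _ near_sv v'1; rewrite -ball_normE /= distrC.
Qed.

Lemma density_bounded : exists2 M : R, 0 <= M & forall v, enorm v = 1 -> g 0 v <= M.
Proof.
pose S := [set v : 'rV[R]_n.+1 | enorm v = 1].
have cS : compact S.
  apply: bounded_closed_compact.
    exists 1; split; first exact: num_real.
    move=> M M1 v v1; apply: le_trans (norm_le_enorm v) _.
    by rewrite v1 ltW.
  have -> : S = (fun v => enorm v) @^-1` [set 1] by [].
  apply: closed_comp => [v _|]; last exact: closed_eq.
  apply: (@lipschitz_continuous R n _ _ 1) => x y; rewrite mul1r.
  rewrite ler_norml lerNl opprB !lerBlDr; apply/andP; split.
    by rewrite -[y in leLHS](subrK x) (enormB_sym x); exact: enormD.
  by rewrite -[x in leLHS](subrK y); exact: enormD.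
have cg : {within S, continuous (g 0)}.
  apply: (subspace_continuousP _ _).2 => v v1.
  apply/cvgrPdist_lt => eps eps0.
  have [delta delta0 H] := density_local 0 v1 eps0.
  apply/nbhs_ballP; exists delta => // v' vv' v'1.
  rewrite distrC; apply: H => //; first by rewrite subrr normr0.
  by move: vv'; rewrite -ball_normE /= distrC.
have [M0 [_ HM]] := compact_bounded (continuous_compact cg cS).
exists (`|M0| + 1); first by rewrite addr_ge0.
move=> v v1; apply: le_trans (ler_norm _) _.
apply: HM; last by exists v.
by apply: le_lt_trans (ler_norm M0) _; rewrite ltrDl.
Qed.

(** The pair (w, eta) is regarded as one row vector, on which g is continuous
    relative to the vectors whose second block has unit length. *)
Lemma measurable_density0 d (T : measurableType d) (w : T -> 'rV[R]_m.+1)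
    (eta : T -> 'rV[R]_n.+1) :
  (forall i, measurable_fun [set: T] (fun x => w x ord0 i)) ->
  (forall i, measurable_fun [set: T] (fun x => eta x ord0 i)) ->
  (forall x, eta x <> 0 -> enorm (eta x) = 1) ->
  measurable_fun [set: T] (fun x => density0 g (w x) (eta x)).
Proof.
move=> mw meta eta1.
pose D := [set x | eta x <> 0].
have mD : measurable D by exact: measurable_support.
have -> : (fun x => density0 g (w x) (eta x)) = (fun x => g (w x) (eta x)) \_ D.
  apply/funext => x; rewrite patchE /density0; case: eqP => [e0|e0].
    by rewrite memNset.
  by rewrite mem_set.
apply/(measurable_restrictT _ _).1 => //.
move=> _; apply: (measurability _ (RGenOInfty.measurableE R)) => //.
move=> _ [_ [c ->] <-]; rewrite set_itvE.
pose X x : 'rV[R]_(m.+1 + n.+1) := row_mx (w x) (eta x).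
have -> : D `&` (fun x => g (w x) (eta x)) @^-1` [set t | c < t] =
    D `&` X @^-1` [set z | c < g (lsubmx z) (rsubmx z)].
  by apply/seteqP; split => x /= [Dx]; rewrite row_mxKl row_mxKr.
apply: (@measurable_relatively_open_preimage _ T R D 1 _ X
  [set z | enorm (rsubmx z) = 1]) => //.
- move=> i j; rewrite ord1; case: (split_ordP j) => k ->.
    by under eq_fun do rewrite row_mxEl; exact: measurable_funTS.
  by under eq_fun do rewrite row_mxEr; exact: measurable_funTS.
- by move=> x Dx; rewrite /= row_mxKr eta1.
move=> z z1 /= cz.
have cz0 : 0 < g (lsubmx z) (rsubmx z) - c by rewrite subr_gt0.
have [delta delta0 H] := density_local (lsubmx z) z1 cz0.
exists delta => // z' z'1 zz'.
have small k (A : 'rV[R]_k) : (forall i, `|A ord0 i| < delta) -> `|A| < delta.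
  move=> Ad; rewrite [ltLHS]/Num.norm /= mx_normrE; apply/bigmax_ltP; split => //.
  by move=> [i j] _ /=; rewrite ord1.
have := H (lsubmx z') (rsubmx z') z'1.
have l1 : `|lsubmx z' - lsubmx z| < delta.
  by apply: small => i; have := zz' ord0 (lshift _ i); rewrite !mxE.
have r1 : `|rsubmx z' - rsubmx z| < delta.
  by apply: small => i; have := zz' ord0 (rshift _ i); rewrite !mxE.
by move=> /(_ l1 r1); rewrite ltr_distl => /andP[+ _]; lra.
Qed.

End Surface_density.

Section Surface_energy.
Context d (T : measurableType d) (R : realType) (mu : {measure set T -> \bar R}).
Variables (m n : nat).
Variables (g : 'rV[R]_m.+1 -> 'rV[R]_n.+1 -> R) (g0 : R -> R) (C : R).
Hypotheses (g0_ge0 : forall t, 0 <= t -> 0 <= g0 t)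
  (g0_nondecreasing : forall s t, 0 <= s -> s <= t -> g0 s <= g0 t)
  (g0_subadditive : forall s t, 0 <= s -> 0 <= t -> g0 (s + t) <= g0 s + g0 t)
  (g0_eq0 : forall t, 0 <= t -> (g0 t = 0 <-> t = 0))
  (g_ge0 : forall s v, enorm v = 1 -> 0 <= g s v)
  (g_continuous : {within [set z : 'rV[R]_m.+1 * 'rV[R]_n.+1 | enorm z.2 = 1],
       continuous (fun z => g z.1 z.2)})
  (C0 : 0 < C)
  (g_growth : forall s s' v, enorm v = 1 -> g (s + s') v <= g s v + C * g0 (enorm s')).
Variables (w : T -> 'rV[R]_m.+1) (eta : T -> 'rV[R]_n.+1).
Variables (w_ : nat -> T -> 'rV[R]_m.+1) (eta_ : nat -> T -> 'rV[R]_n.+1).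
Variables (J : set T) (J_ : nat -> set T).
Hypotheses (mw : forall i, measurable_fun [set: T] (fun x => w x ord0 i))
  (meta : forall i, measurable_fun [set: T] (fun x => eta x ord0 i))
  (mw_ : forall j i, measurable_fun [set: T] (fun x => w_ j x ord0 i))
  (meta_ : forall j i, measurable_fun [set: T] (fun x => eta_ j x ord0 i))
  (mJ : measurable J) (mJ_ : forall j, measurable (J_ j)).
Hypotheses (etaJ : forall x, J x -> enorm (eta x) = 1)
  (eta0 : forall x, ~ J x -> eta x = 0)
  (wJ : forall x, J x -> w x <> 0) (w0 : forall x, ~ J x -> w x = 0)
  (etaJ_ : forall j x, J_ j x -> enorm (eta_ j x) = 1)
  (eta0_ : forall j x, ~ J_ j x -> eta_ j x = 0)
  (w0_ : forall j x, ~ J_ j x -> w_ j x = 0).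
Hypothesis Jfin : (mu J < +oo)%E.
Hypothesis w_int : mu.-integrable J (fun x => (g0 (enorm (w x)))%:E).
Hypothesis lim_w : (\int[mu]_(x in J `|` J_ j) (g0 (enorm (w x - w_ j x)))%:E
  @[j --> \oo] --> 0)%E.
Hypothesis lim_eta : (\int[mu]_(x in J `|` J_ j)
  (g0 (enorm (w x) + enorm (w_ j x)) * enorm (eta x - eta_ j x))%:E
  @[j --> \oo] --> 0)%E.
Hypothesis lim_J : (mu (J `+` J_ j) @[j --> \oo] --> 0)%E.

Let g00 : g0 0 = 0. Proof. exact: (g0_eq0 (lexx 0)).2. Qed.

Let g0_gt0 t : 0 < t -> 0 < g0 t.
Proof.
move=> t0; rewrite lt_neqAle g0_ge0 ?ltW// andbT eq_sym; apply/eqP.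
by move=> /(g0_eq0 (ltW t0)).1 tE; move: t0; rewrite tE ltxx.
Qed.

(** Monotone functions are measurable; g0 is extended to the negative half-line by
    its value at 0, which keeps it monotone. *)
Let measurable_g0 (f : T -> R) : (forall x, 0 <= f x) ->
  measurable_fun [set: T] f -> measurable_fun [set: T] (fun x => g0 (f x)).
Proof.
move=> f0 mf.
have -> : (fun x => g0 (f x)) = (fun t => g0 (Num.max 0 t)) \o f.
  by apply/funext => x /=; rewrite max_r.
apply: (measurable_comp measurableT) => //.
apply: nondecreasing_measurable => // s t st.
apply: g0_nondecreasing; first by rewrite le_max lexx.
by rewrite ge_max !le_max lexx st orbT.
Qed.

Let g0_cvg0 (t : nat -> R) : (forall k, 0 <= t k) ->
  g0 (t k) @[k --> \oo] --> (0:R) -> t k @[k --> \oo] --> (0:R).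
Proof.
move=> t0 lim; apply/cvgrPdist_lt => e e0.
move/cvgrPdist_lt : lim => /(_ _ (g0_gt0 e0)); apply: filterS => k.
rewrite !sub0r !normrN !ger0_norm ?g0_ge0// => tk.
rewrite ltNge; apply/negP => etk; move: tk; rewrite ltNge => /negP; apply.
by apply: g0_nondecreasing => //; exact: ltW.
Qed.

Let a x := density0 g (w x) (eta x).
Let a_ j x := density0 g (w_ j x) (eta_ j x).

Let eta_neq0 (A : set T) (v : T -> 'rV[R]_n.+1) x :
  (forall x, A x -> enorm (v x) = 1) -> A x -> v x == 0 = false.
Proof.
move=> v1 Ax; apply/eqP => vx; move: (v1 x Ax); rewrite vx enorm0 => /eqP.
by rewrite eq_sym oner_eq0.
Qed.

Let aJ x : J x -> a x = g (w x) (eta x).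
Proof. by move=> Jx; rewrite /a /density0 (eta_neq0 etaJ Jx). Qed.

Let aJ_ j x : J_ j x -> a_ j x = g (w_ j x) (eta_ j x).
Proof. by move=> Jx; rewrite /a_ /density0 (eta_neq0 (@etaJ_ j) Jx). Qed.

Let a0 x : ~ J x -> a x = 0.
Proof. by move=> Jx; rewrite /a /density0 eta0// eqxx. Qed.

Let a0_ j x : ~ J_ j x -> a_ j x = 0.
Proof. by move=> Jx; rewrite /a_ /density0 eta0_// eqxx. Qed.

Let ma : measurable_fun [set: T] a.
Proof.
apply: measurable_density0 => // x ex; apply: etaJ.
by apply: contrapT => /eta0.
Qed.

Let ma_ j : measurable_fun [set: T] (a_ j).
Proof.
apply: measurable_density0 => // x ex; apply: etaJ_.
by apply: contrapT => /(@eta0_ j).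
Qed.

Let density_le M s v : (forall v, enorm v = 1 -> g 0 v <= M) -> enorm v = 1 ->
  g s v <= M + C * g0 (enorm s).
Proof.
move=> HM v1; rewrite -[s in leLHS]add0r; apply: le_trans (g_growth _ _ v1) _.
by rewrite lerD2r HM.
Qed.

(** The three defects of the approximation; all of them vanish off J `|` J_ j. *)
Let Z1 j x := g0 (enorm (w x - w_ j x)).
Let Z2 j x := g0 (enorm (w x) + enorm (w_ j x)) * enorm (eta x - eta_ j x).
Let Z3 j : T -> R := \1_(J `+` J_ j).
Let Z j x := Z1 j x + Z2 j x + Z3 j x.

Let mwn : measurable_fun [set: T] (fun x => enorm (w x)).
Proof. by apply: measurable_enorm => i j; rewrite ord1. Qed.

Let mwn_ j : measurable_fun [set: T] (fun x => enorm (w_ j x)).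
Proof. by apply: measurable_enorm => i k; rewrite ord1. Qed.

Let mZ1 j : measurable_fun [set: T] (Z1 j).
Proof.
apply: measurable_g0 => [x|]; first exact: enorm_ge0.
apply: measurable_enorm => i k; rewrite ord1; under eq_fun do rewrite !mxE.
exact: measurable_funB.
Qed.

Let mZ2 j : measurable_fun [set: T] (Z2 j).
Proof.
apply: measurable_funM.
  apply: measurable_g0 => [x|]; first by rewrite addr_ge0// enorm_ge0.
  exact: measurable_funD.
apply: measurable_enorm => i k; rewrite ord1; under eq_fun do rewrite !mxE.
exact: measurable_funB.
Qed.

Let mJJ j : measurable (J `+` J_ j).
Proof. by apply: measurableU; apply: measurableD. Qed.

Let Z1_ge0 j x : 0 <= Z1 j x.
Proof. by rewrite /Z1 g0_ge0 ?enorm_ge0. Qed.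

Let Z2_ge0 j x : 0 <= Z2 j x.
Proof. by rewrite mulr_ge0 ?enorm_ge0// g0_ge0// addr_ge0 ?enorm_ge0. Qed.

Let Z3_ge0 j x : 0 <= Z3 j x. Proof. by rewrite /Z3 indicE. Qed.

Let mZ3 j : measurable_fun [set: T] (Z3 j).
Proof. exact: measurable_indic. Qed.

Let Z_ge0 j x : 0 <= Z j x.
Proof. by rewrite /Z !addr_ge0. Qed.

Let mZ j : measurable_fun [set: T] (Z j).
Proof.
by apply: measurable_funD; [exact: measurable_funD|exact: mZ3].
Qed.

Let integral_support (A : set T) (f : T -> R) : (forall x, ~ A x -> f x = 0) ->
  (\int[mu]_(x in A) (f x)%:E = \int[mu]_x (f x)%:E)%E.
Proof.
move=> f0; rewrite integral_mkcond; apply: eq_integral => x _.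
rewrite patchE; case: ifPn => [//|/negP]; rewrite inE => Ax.
by rewrite f0.
Qed.

Let Z_lim : (\int[mu]_x (Z j x)%:E @[j --> \oo] --> 0)%E.
Proof.
have ZE j : (\int[mu]_x (Z j x)%:E =
    \int[mu]_(x in J `|` J_ j) (Z1 j x)%:E +
    \int[mu]_(x in J `|` J_ j) (Z2 j x)%:E + mu (J `+` J_ j))%E.
  have m1 : measurable_fun [set: T] (fun x => (Z1 j x)%:E) by exact/measurable_EFinP.
  have m2 : measurable_fun [set: T] (fun x => (Z2 j x)%:E) by exact/measurable_EFinP.
  have m3 : measurable_fun [set: T] (fun x => (Z3 j x)%:E) by exact/measurable_EFinP.
  have s1 : (\int[mu]_(x in J `|` J_ j) (Z1 j x)%:E = \int[mu]_x (Z1 j x)%:E)%E.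
    apply: integral_support => x /not_orP[Jx Jx'].
    by rewrite /Z1 w0// w0_// subrr enorm0.
  have s2 : (\int[mu]_(x in J `|` J_ j) (Z2 j x)%:E = \int[mu]_x (Z2 j x)%:E)%E.
    apply: integral_support => x /not_orP[Jx Jx'].
    by rewrite /Z2 w0// w0_// enorm0 addr0 g00 mul0r.
  have s3 : (mu (J `+` J_ j) = \int[mu]_x (Z3 j x)%:E)%E.
    by rewrite /Z3 integral_indic// setIT.
  rewrite s1 s2 s3 -ge0_integralD//; [|by move=> x _; rewrite lee_fin..].
  have m12 := emeasurable_funD m1 m2.
  rewrite -(ge0_integralD mu measurableT _ m12 _ m3); last 2 first.
  - by move=> x _; rewrite -EFinD lee_fin addr_ge0.
  - by move=> x _; rewrite lee_fin.
  by apply: eq_integral => x _; rewrite -!EFinD.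
rewrite (funext ZE) -[X in _ --> X]adde0 -[X in nbhs (X + _)%E]adde0.
by apply: cvgeD => //; apply: cvgeD.
Qed.

Let a_ge0 x : 0 <= a x.
Proof.
have [Jx|Jx] := pselect (J x); last by rewrite a0.
by rewrite aJ//; exact/g_ge0/etaJ.
Qed.

Let a__ge0 j x : 0 <= a_ j x.
Proof.
have [Jx|Jx] := pselect (J_ j x); last by rewrite a0_.
by rewrite aJ_//; exact/g_ge0/etaJ_.
Qed.

Let g0w_ge0 x : 0 <= g0 (enorm (w x)).
Proof. by rewrite g0_ge0// enorm_ge0. Qed.

Let Gbound M x := M * \1_J x + C * g0 (enorm (w x)).

Let Gbound_ge0 M x : 0 <= M -> 0 <= Gbound M x.
Proof. by move=> M0; rewrite addr_ge0// mulr_ge0// ?ltW// indicE. Qed.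

Let Gbound_int M : 0 <= M -> mu.-integrable [set: T] (EFin \o Gbound M).
Proof.
move=> M0.
have -> : EFin \o Gbound M = (fun x => M%:E * (\1_J x)%:E)%E \+
    (fun x => C%:E * (g0 (enorm (w x)))%:E)%E.
  by apply/funext => x; rewrite /= /Gbound EFinD !EFinM.
apply: integrableD => //; apply: integrableZl => //.
  apply/integrableP; split; first by apply/measurable_EFinP; exact: measurable_indic.
  rewrite (eq_integral (fun x => (\1_J x)%:E)); last first.
    by move=> x _; rewrite gee0_abs// lee_fin indicE.
  by rewrite integral_indic// setIT.
have -> : (fun x => (g0 (enorm (w x)))%:E) = (fun x => (g0 (enorm (w x)))%:E) \_ J.
  apply/funext => x; rewrite patchE; case: ifPn => [//|/negP]; rewrite inE => Jx.
  by rewrite w0// enorm0 g00.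
exact/(integrable_mkcond _ mJ).1.
Qed.

Let a_le M x : (forall v, enorm v = 1 -> g 0 v <= M) -> a x <= Gbound M x.
Proof.
move=> HM; have [Jx|Jx] := pselect (J x); last first.
  by rewrite a0// /Gbound indicE memNset// mulr0 add0r mulr_ge0// ltW.
by rewrite aJ// /Gbound indicE mem_set// mulr1 density_le// etaJ.
Qed.

(** The growth condition at s = 0 bounds the density by M + C g0(|w_j|), where
    g0(|w_j|) <= g0(|w|) + Z1 by subadditivity and the indicator of J_ j is at most
    that of J plus Z3. *)
Let a__le M j x : 0 <= M -> (forall v, enorm v = 1 -> g 0 v <= M) ->
  a_ j x <= Gbound M x + (M + C) * Z j x.
Proof.
move=> M0 HM.
have Zx := Z_ge0 j x; have C0' := ltW C0.
have [Jx|Jx] := pselect (J_ j x); last first.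
  by rewrite a0_// addr_ge0 ?Gbound_ge0// mulr_ge0// addr_ge0.
rewrite aJ_//; apply: le_trans (density_le _ HM (etaJ_ Jx)) _.
have g0_le : g0 (enorm (w_ j x)) <= g0 (enorm (w x)) + Z1 j x.
  apply: le_trans (g0_subadditive (enorm_ge0 _) (enorm_ge0 _)).
  apply: g0_nondecreasing; first exact: enorm_ge0.
  by rewrite (enormB_sym (w x)) -{1}(subrK (w x) (w_ j x)) addrC enormD.
have ind_le : 1 <= \1_J x + Z3 j x :> R.
  rewrite /Z3 !indicE; have [Jx'|Jx'] := pselect (J x).
    by rewrite mem_set// lerDl.
  by rewrite (_ : (x \in J `+` J_ j) = true) ?lerDr//; apply: mem_set; right.
have h1 := ler_wpM2l M0 ind_le; have h2 := ler_wpM2l C0' g0_le.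
have z1 := Z1_ge0 j x; have z2 := Z2_ge0 j x; have z3 := Z3_ge0 j x.
have h3 : 0 <= (M + C) * Z2 j x by rewrite mulr_ge0// addr_ge0.
have h4 : 0 <= M * Z1 j x by rewrite mulr_ge0.
have h5 : 0 <= C * Z3 j x by rewrite mulr_ge0.
by rewrite /Gbound /Z; move: h1 h2 h3 h4 h5; lra.
Qed.

Lemma integrable_surface_density : mu.-integrable [set: T] (EFin \o a).
Proof.
have [M M0 HM] := density_bounded g_continuous.
apply: (le_integrable measurableT _ _ (Gbound_int M0)).
  exact/measurable_EFinP.
move=> x _; rewrite /= lee_fin ger0_norm// ger0_norm ?Gbound_ge0//.
exact: a_le.
Qed.

(** Off J, the point eventually leaves J_ j.  On J it eventually lies in J_ j, the
    jumps converge as g0 vanishes only at 0, and so do the normals, because their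
    difference is weighted by at least g0(|w|) > 0. *)
Let pointwise x (s : nat -> nat) : Z (s k) x @[k --> \oo] --> 0 ->
  `|a_ (s k) x - a x| @[k --> \oo] --> 0.
Proof.
move=> Zlim.
have le_lim (f : nat -> R) : (forall k, 0 <= f k <= Z (s k) x) ->
    f k @[k --> \oo] --> (0:R).
  by move=> fZ; apply: (squeeze_cvgr _ (@cvg_cst _ _ _ _ _) Zlim); exact: nearW.
have lim1 : Z1 (s k) x @[k --> \oo] --> (0:R).
  apply: le_lim => k; rewrite Z1_ge0/= /Z -addrA lerDl addr_ge0//.
have lim2 : Z2 (s k) x @[k --> \oo] --> (0:R).
  apply: le_lim => k; rewrite Z2_ge0/= /Z addrAC lerDr addr_ge0//.
have lim3 : Z3 (s k) x @[k --> \oo] --> (0:R).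
  apply: le_lim => k; rewrite Z3_ge0/= /Z lerDr addr_ge0//.
have outside : \forall k \near \oo, ~ (J `+` J_ (s k)) x.
  move/cvgrPdist_lt : lim3 => /(_ _ ltr01); apply: filterS => k.
  rewrite sub0r normrN /Z3 indicE => h Jx; move: h.
  by rewrite mem_set// normr1 ltxx.
apply/cvgrPdist_lt => eps eps0.
have [Jx|Jx] := pselect (J x); last first.
  apply: filterS outside => k out.
  have nJk : ~ J_ (s k) x by move=> Jk; apply: out; right.
  by rewrite a0// a0_// subrr normr0 subrr normr0.
have w_gt0 : 0 < enorm (w x).
  rewrite lt_neqAle enorm_ge0 andbT eq_sym; apply/eqP => /enorm_eq0.
  exact: wJ.
have limw : enorm (w x - w_ (s k) x) @[k --> \oo] --> (0:R).
  by apply: g0_cvg0 => // k; exact: enorm_ge0.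
have limeta : enorm (eta x - eta_ (s k) x) @[k --> \oo] --> (0:R).
  have lim2' : (g0 (enorm (w x)))^-1 * Z2 (s k) x @[k --> \oo] --> (0:R).
    by rewrite -[X in _ --> X](mulr0 (g0 (enorm (w x)))^-1); apply: cvgMr.
  apply: (squeeze_cvgr _ (@cvg_cst _ _ _ _ _) lim2').
  apply: nearW => k; rewrite enorm_ge0 /= ler_pdivlMl ?g0_gt0//.
  rewrite ler_wpM2r ?enorm_ge0// g0_nondecreasing ?enorm_ge0// lerDl enorm_ge0//.
have [delta delta0 H] := density_local g_continuous (w x) (etaJ Jx) eps0.
near=> k.
have out : ~ (J `+` J_ (s k)) x by near: k.
have Jk : J_ (s k) x by apply: contrapT => nJk; apply: out; left.
rewrite sub0r normrN normr_id aJ// aJ_//; apply: H; first exact: etaJ_.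
  apply: le_lt_trans (norm_le_enorm _) _; rewrite enormB_sym.
  near: k; move/cvgrPdist_lt : limw => /(_ _ delta0); apply: filterS => k.
  by rewrite sub0r normrN ger0_norm ?enorm_ge0.
apply: le_lt_trans (norm_le_enorm _) _; rewrite enormB_sym.
near: k; move/cvgrPdist_lt : limeta => /(_ _ delta0); apply: filterS => k.
by rewrite sub0r normrN ger0_norm ?enorm_ge0.
Unshelve. all: by end_near. Qed.

Lemma surface_energy_cvg :
  (\int[mu]_x (density0 g (w_ j x) (eta_ j x))%:E @[j --> \oo] -->
   \int[mu]_x (density0 g (w x) (eta x))%:E)%E.
Proof.
have [M M0 HM] := density_bounded g_continuous.
apply: (integral_cvg_L1 measurableT ma_ integrable_surface_density).
apply: (@dominated_cvg0 _ T R mu setT _ Z (fun x => 2 * Gbound M x) (M + C)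
  measurableT _ _ mZ _ Z_ge0 _ _ _ _ Z_lim).
- by rewrite addr_ge0// ltW.
- by move=> j; apply: measurableT_comp => //; exact: measurable_funB.
- by move=> j x; exact: normr_ge0.
- have -> : EFin \o (fun x => 2 * Gbound M x) = (fun x => 2%:E * (Gbound M x)%:E)%E.
    by apply/funext => x; rewrite /= EFinM.
  by apply: integrableZl => //; exact: Gbound_int.
- by move=> x; rewrite mulr_ge0// Gbound_ge0.
- move=> j x _; have := a__le j x M0 HM; have := a_le x HM.
  have := a_ge0 x; have := a__ge0 j x; have := Z_ge0 j x.
  have := Gbound_ge0 x M0 => g0x z0 h1 h2 h3 h4.
  have h5 : 0 <= (M + C) * Z j x by rewrite mulr_ge0// addr_ge0// ltW.
  by rewrite ler_norml; apply/andP; split; move: g0x h1 h2 h3 h4 h5; lra.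
- by move=> x s _; exact: pointwise.
Qed.

End Surface_energy.

(** * Convergence of the energy *)

Lemma lebesgue_bounded_lty (R : realType) n (Omega : set 'rV[R]_n) :
  bounded_set Omega -> (leb n Omega < +oo)%E.
Proof.
move=> [M [Mreal HM]]; pose c := `|M| + 1.
have Mc : M < c by apply: le_lt_trans (ler_norm M) _; rewrite ltrDl.
have c0 : 0 <= c by rewrite addr_ge0.
apply: le_lt_trans (@lebesgue_outer_le_box R n Omega (const_mx (- c)) (const_mx c) _ _) _.
- by move=> i; rewrite !mxE ge0_cp.
- move=> x Ox i; rewrite !mxE -ler_norml.
  exact: le_trans (entry_le_norm _ _ _) (HM c Mc x Ox).
- exact: ltry.
Qed.

(** The hypothesis bounds the differential of Phi j - id almost everywhere by e;
    Phi j being Lipschitz, this bounds its Lipschitz constant. *)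
Lemma deformation_near_id (R : realType) n (Omega : set 'rV[R]_n.+1)
    (Phi : nat -> 'rV[R]_n.+1 -> 'rV[R]_n.+1) : is_deformation Omega Phi ->
  forall e, 0 < e -> \forall j \near \oo, forall x y,
    enorm ((Phi j y - y) - (Phi j x - x)) <= e * enorm (y - x).
Proof.
move=> [bilip _ dPhi _] e e0; apply: filterS (dPhi e e0) => j dj x y.
have [_ [L PhiL] _] := bilip j.
have L0 : 0 <= `|L| by [].
have PhiL' a b : enorm (Phi j a - Phi j b) <= `|L| * enorm (a - b).
  by apply: le_trans (PhiL a b) _; rewrite ler_wpM2r ?enorm_ge0// ler_norm.
have := ae_derivative_increment_le L0 (ltW e0) PhiL' dj (y - x) x.
by rewrite (_ : x + (y - x) = y)//; rewrite addrC subrK.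
Qed.

Lemma deformation_measurable (R : realType) n d (Omega : set 'rV[R]_n.+1)
    (Phi : nat -> 'rV[R]_n.+1 -> 'rV[R]_n.+1) : is_deformation Omega Phi ->
  forall j, measurable_fun [set: Haus_space R d n.+1]
    (Phi j : Haus_space R d n.+1 -> Haus_space R d n.+1).
Proof.
move=> [bilip _ _ _] j; have [_ [L PhiL] [K PhiK]] := bilip j.
have L0 : 0 < `|L| + 1 by rewrite ltr_wpDl.
have K0 : 0 < `|K| + 1 by rewrite ltr_wpDl.
have PhiL' a b : enorm (Phi j a - Phi j b) <= (`|L| + 1) * enorm (a - b).
  apply: le_trans (PhiL a b) _; rewrite ler_wpM2r ?enorm_ge0//.
  by apply: le_trans (ler_norm L) _; rewrite lerDl.
have PhiK' a b : enorm (a - b) <= (`|K| + 1) * enorm (Phi j a - Phi j b).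
  apply: le_trans (PhiK a b) _; rewrite ler_wpM2r ?enorm_ge0//.
  by apply: le_trans (ler_norm K) _; rewrite lerDl.
apply: (hausdorff_measurable_bilipschitz K0 L0 PhiK' PhiL').
apply: (@lipschitz_continuous R n _ (Phi j) (`|L| + 1)) => a b.
exact: le_trans (norm_le_enorm _) (PhiL' a b).
Qed.

Section Jump_energy.
Context {R : realType}.
Variables n m : nat.
Local Notation Rn := 'rV[R]_n.+1.
Local Notation Hs := (Haus_space R n n.+1).
Local Notation H := (haus n n.+1).
Variables (Omega : set Rn) (g : 'rV[R]_m.+1 -> Rn -> R).
Hypothesis (oO : open Omega).
Hypothesis g_even : forall s v, enorm v = 1 -> g (- s) (- v) = g s v.

(** Two orientations differ by a simultaneous change of sign of the jump and of
    the normal, to which g is insensitive. *)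
Lemma jump_energyE (u : Rn -> 'rV[R]_m.+1) nu nu' :
  Lp Omega 1 u -> is_orientation Omega u nu -> is_orientation Omega u nu' ->
  (\int[H]_(x in jump_set Omega u) (g (jump Omega u nu x) (nu x))%:E =
   \int[H]_x (density0 g (jump Omega u nu' x) (nu' x))%:E)%E.
Proof.
move=> uL1 onu onu'; rewrite integral_mkcond; congr (integral _ _ _).
apply/funext => x; rewrite patchE /density0.
have [_ nuJ nu0] := onu; have [_ nuJ' nu0'] := onu'.
have [Jx|Jx] := pselect (jump_set Omega u x); last first.
  by rewrite memNset// nu0'// eqxx.
rewrite mem_set//; have nu1 := (nuJ x Jx).1.
have nu'1 := (nuJ' x Jx).1.
have -> : (nu' x == 0) = false.
  apply/eqP => nx; move: nu'1; rewrite nx enorm0 => /eqP.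
  by rewrite eq_sym oner_eq0.
have [[-> ->]//|[-> ->]] := jump_orientation oO uL1 x onu onu'.
by rewrite g_even.
Qed.

Section Approximating_sequence.
Variables (p : R) (g0 : R -> R).
Variables (u : Rn -> 'rV[R]_m.+1) (nu : Rn -> Rn).
Variables (u_ : nat -> Rn -> 'rV[R]_m.+1) (Phi : nat -> Rn -> Rn).
Variable nu_ : nat -> Rn -> Rn.
Hypotheses (u_SBV : SBV Omega u) (nu_orientation : is_orientation Omega u nu).
Hypotheses (g0_ge0 : forall t, 0 <= t -> 0 <= g0 t)
    (g0_nondecreasing : forall s t, 0 <= s -> s <= t -> g0 s <= g0 t)
    (g0_subadditive : forall s t, 0 <= s -> 0 <= t -> g0 (s + t) <= g0 s + g0 t)
    (g0_eq0 : forall t, 0 <= t -> (g0 t = 0 <-> t = 0)).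
Hypotheses (u_jump : H.-integrable (jump_set Omega u)
       (fun x => (g0 (enorm (jump Omega u nu x)))%:E))
    (u_jump_set : (H (jump_set Omega u) < +oo)%E)
    (u_Phi_approx : approximating_sequence Omega p g0 u nu u_ Phi).
Hypotheses
    (g_ge0 : forall s v, enorm v = 1 -> 0 <= g s v)
    (g_continuous : {within [set z : 'rV[R]_m.+1 * 'rV[R]_n.+1 | enorm z.2 = 1],
       continuous (fun z => g z.1 z.2)}).
Variable C : R.
Hypotheses (C0 : 0 < C)
  (g_growth : forall s s' v, enorm v = 1 -> g (s + s') v <= g s v + C * g0 (enorm s')).
Hypothesis nu_orientation_ : forall j, is_orientation Omega (u_ j) (nu_ j).

Let normal_norm (v : Rn -> 'rV[R]_m.+1) nu' : is_orientation Omega v nu' ->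
  forall x, nu' x <> 0 -> enorm (nu' x) = 1.
Proof.
move=> [_ nuJ nu0] x nx; suff /nuJ[] : jump_set Omega v x by [].
by apply: contrapT => /nu0.
Qed.

Let density_measurable v nu' : SBV Omega v -> is_orientation Omega v nu' ->
  measurable_fun [set: Hs] (fun x => density0 g (jump Omega v nu' x) (nu' x)).
Proof.
move=> vS onu.
apply: (@measurable_density0 R m n g g_continuous _ Hs).
- by move=> i; exact: measurable_jump.
- by case: onu.
- exact: (@normal_norm v).
Qed.

Let a x := density0 g (jump Omega u nu x) (nu x).

Let a_integrable : H.-integrable [set: Hs] (EFin \o a).
Proof.
have [mnu nuJ nu0] := nu_orientation.
apply: (@integrable_surface_density _ Hs R H m n g g0 C g0_ge0 g0_eq0 g_ge0
  g_continuous C0 g_growth (jump Omega u nu) nu (jump_set Omega u)).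
- by move=> i; exact: measurable_jump.
- exact: mnu.
- exact: measurable_jump_set nu_orientation.
- by move=> x /nuJ[].
- exact: nu0.
- by move=> x Jx; exact: jump_off.
- exact: u_jump_set.
- exact: u_jump.
Qed.

Lemma jump_energy_fin_num :
  (\int[H]_(x in jump_set Omega u) (g (jump Omega u nu x) (nu x))%:E)%E \is a fin_num.
Proof.
rewrite (jump_energyE u_SBV.1 nu_orientation nu_orientation).
exact: (integrable_fin_num measurableT a_integrable).
Qed.

(** The pulled-back jumps and normals satisfy the hypotheses of
    surface_energy_cvg; the deformations are then removed in the limit. *)
Lemma jump_energy_cvg :
  (\int[H]_(x in jump_set Omega (u_ j))
      (g (jump Omega (u_ j) (nu_ j) x) (nu_ j x))%:E @[j --> \oo] -->
   \int[H]_(x in jump_set Omega u) (g (jump Omega u nu x) (nu x))%:E)%E.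
Proof.
have [u_S _ _ _ _ def [nu' onu' [lim_w lim_eta]] lim_J _ _] := u_Phi_approx.
have mPhi : forall j, measurable_fun [set: Hs] (Phi j : Hs -> Hs) :=
  deformation_measurable def.
rewrite -(fineK jump_energy_fin_num).
have -> : (fun j => \int[H]_(x in jump_set Omega (u_ j))
      (g (jump Omega (u_ j) (nu_ j) x) (nu_ j x))%:E)%E =
    (fun j => \int[H]_x (density0 g (jump Omega (u_ j) (nu' j) x) (nu' j x))%:E)%E.
  apply/funext => j.
  exact: (jump_energyE (u_S j).1 (nu_orientation_ j) (onu' j)).
apply: (near_id_integral_cvg (deformation_near_id def)).
- move=> j y; rewrite lee_fin /density0; case: eqP => // ny.
  exact/g_ge0/(normal_norm (onu' j)).
- move=> j; apply/measurable_EFinP; exact: (density_measurable (u_S j) (onu' j)).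
rewrite fineK ?jump_energy_fin_num// (jump_energyE u_SBV.1 nu_orientation nu_orientation).
have [mnu nuJ nu0] := nu_orientation.
apply: (@surface_energy_cvg _ Hs R H m n g g0 C g0_ge0 g0_nondecreasing
  g0_subadditive g0_eq0 g_ge0 g_continuous C0 g_growth (jump Omega u nu) nu
  (fun j x => jump Omega (u_ j) (nu' j) (Phi j x)) (fun j x => nu' j (Phi j x))
  (jump_set Omega u) (fun j => Phi j @^-1` jump_set Omega (u_ j))).
- by move=> i; exact: measurable_jump.
- exact: mnu.
- move=> j i.
  exact: (measurableT_comp (@measurable_jump R n m.+1 Omega (u_ j) (nu' j) i oO (u_S j) (onu' j)) (mPhi j)).
- move=> j i; have [mnu' _ _] := onu' j.
  exact: (measurableT_comp (mnu' i) (mPhi j)).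
- exact: measurable_jump_set nu_orientation.
- move=> j; have := mPhi j measurableT _ (measurable_jump_set (onu' j)).
  by rewrite setTI.
- by move=> x /nuJ[].
- exact: nu0.
- by move=> x; exact: (jump_neq0 oO u_SBV.1 nu_orientation).
- by move=> x Jx; exact: jump_off.
- by move=> j x Jx; have [_ nuJ' _] := onu' j; have [] := nuJ' _ Jx.
- by move=> j x Jx; have [_ _ nu0'] := onu' j; exact: nu0'.
- by move=> j x Jx; exact: jump_off.
- exact: u_jump_set.
- exact: u_jump.
- exact: lim_w.
- exact: lim_eta.
- exact: lim_J u_jump_set.
Qed.

End Approximating_sequence.
End Jump_energy.

Theorem corollary2p2 (R : realType) (n m : nat) (Omega : set 'rV[R]_n.+1)
    (u : 'rV[R]_n.+1 -> 'rV[R]_m.+1) (nu : 'rV[R]_n.+1 -> 'rV[R]_n.+1)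
    (p : R) (g0 : R -> R)
    (u_ : nat -> 'rV[R]_n.+1 -> 'rV[R]_m.+1)
    (Phi : nat -> 'rV[R]_n.+1 -> 'rV[R]_n.+1)
    (Omega_open : open Omega)
    (Omega_bounded : bounded_set Omega)
    (Omega_lipschitz : is_lipschitz_set Omega)
    (u_SBV : SBV Omega u)
    (nu_orientation : is_orientation Omega u nu)
    (p_ge1 : 1 <= p)
    (u_gradient : Lp Omega p (agrad u))
    (g0_ge0 : forall t, 0 <= t -> 0 <= g0 t)
    (g0_continuous : {within [set t : R | 0 <= t], continuous g0})
    (g0_nondecreasing : forall s t, 0 <= s -> s <= t -> g0 s <= g0 t)
    (g0_subadditive : forall s t, 0 <= s -> 0 <= t ->
       g0 (s + t) <= g0 s + g0 t)
    (g0_eq0 : forall t, 0 <= t -> (g0 t = 0 <-> t = 0))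
    (u_jump : (haus n n.+1).-integrable (jump_set Omega u)
       (fun x => (g0 (enorm (jump Omega u nu x)))%:E))
    (u_jump_set : (haus n n.+1 (jump_set Omega u) < +oo)%E)
    (u_Phi_approx : approximating_sequence Omega p g0 u nu u_ Phi)
    (Psi : 'M[R]_(m.+1, n.+1) -> R)
    (Psi_continuous : continuous Psi)
    (Psi_growth : exists2 C : R, 0 < C &
       forall xi, `|Psi xi| <= C * (enorm xi `^ p + 1))
    (g : 'rV[R]_m.+1 -> 'rV[R]_n.+1 -> R)
    (g_ge0 : forall s v, enorm v = 1 -> 0 <= g s v)
    (g_continuous : {within [set z : 'rV[R]_m.+1 * 'rV[R]_n.+1 | enorm z.2 = 1],
       continuous (fun z => g z.1 z.2)})
    (g_even : forall s v, enorm v = 1 -> g (- s) (- v) = g s v)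
    (g_growth : exists2 C : R, 0 < C & forall s s' v, enorm v = 1 ->
       g (s + s') v <= g s v + C * g0 (enorm s'))
    (g_coercive : exists2 alpha : R, 0 < alpha &
       forall v, enorm v = 1 -> alpha <= g 0 v)
    (nu_ : nat -> 'rV[R]_n.+1 -> 'rV[R]_n.+1)
    (nu_orientation_ : forall j, is_orientation Omega (u_ j) (nu_ j)) :
  [/\ (\int[leb n.+1]_(x in Omega) (Psi (agrad (u_ j) x))%:E @[j --> \oo] -->
         \int[leb n.+1]_(x in Omega) (Psi (agrad u x))%:E)%E,
      (\int[haus n n.+1]_(x in jump_set Omega (u_ j))
           (g (jump Omega (u_ j) (nu_ j) x) (nu_ j x))%:E @[j --> \oo] -->
         \int[haus n n.+1]_(x in jump_set Omega u)
           (g (jump Omega u nu x) (nu x))%:E)%E &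
      energy Psi g Omega (u_ j) (nu_ j) Omega @[j --> \oo] -->
        energy Psi g Omega u nu Omega].
Proof.
have [u_S _ _ _ [Du_ Du limDu] _ _ _ _ _] := u_Phi_approx.
have [CPsi CPsi0 Psi_le] := Psi_growth.
have [C C0 g_le] := g_growth.
have mO := lebesgue_measurable_open Omega_open.
have Ofin := lebesgue_bounded_lty Omega_bounded.
have bulk := @Lp_continuous_integral _ (Leb_space R n.+1) R (leb n.+1) m.+1 n.+1 Omega p
  (fun j => agrad (u_ j)) (agrad u) Psi CPsi mO Ofin p_ge1 CPsi0
  (fun j => (Du_ j).1) Du.1 Du.2 limDu Psi_continuous Psi_le.
have bulk_fin : (\int[leb n.+1]_(x in Omega) (Psi (agrad u x))%:E)%E \is a fin_num.
  apply: (integrable_fin_num mO).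
  exact: (@integrable_growth _ (Leb_space R n.+1) R (leb n.+1) m.+1 n.+1 Omega p
    (agrad u) Psi CPsi mO Ofin CPsi0 Du.1 Du.2 Psi_continuous Psi_le).
have surface := jump_energy_cvg Omega_open g_even u_SBV nu_orientation g0_ge0
  g0_nondecreasing g0_subadditive g0_eq0 u_jump u_jump_set u_Phi_approx g_ge0
  g_continuous C0 g_le nu_orientation_.
have surface_fin := jump_energy_fin_num Omega_open g_even u_SBV nu_orientation g0_ge0
  g0_eq0 u_jump u_jump_set g_ge0 g_continuous C0 g_le.
have jumpI v : jump_set Omega v `&` Omega = jump_set Omega v.
  by apply/seteqP; split => x; [case|move=> Jx; split => //; exact: Jx.1].
split; [exact: bulk|exact: surface|].
rewrite /energy jumpI.
have -> : (fun j => \int[leb n.+1]_(x in Omega) (Psi (agrad (u_ j) x))%:E +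
    \int[haus n n.+1]_(x in jump_set Omega (u_ j) `&` Omega)
      (g (jump Omega (u_ j) (nu_ j) x) (nu_ j x))%:E)%E =
  (fun j => \int[leb n.+1]_(x in Omega) (Psi (agrad (u_ j) x))%:E +
    \int[haus n n.+1]_(x in jump_set Omega (u_ j))
      (g (jump Omega (u_ j) (nu_ j) x) (nu_ j x))%:E)%E.
  by apply/funext => j; rewrite jumpI.
apply: (cvgeD _ bulk surface); exact: fin_num_adde_defr.
Qed.
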